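(* For each of the following families $\mathcal{F}$ of graphs, the set $\mathcal{S}$ of all minimal obstructions to full $\mathcal{F}$-colouring (up to isomorphism) is as given: (1) if $\mathcal{F}$ is the family of quasi-threshold graphs, then $\mathcal{S}=\{P_4,\overline{2P_3}\}$; (2) if $\mathcal{F}$ is the family of threshold graphs, then $\mathcal{S}=\{2K_2,P_4,\overline{2P_3}\}$; (3) if $\mathcal{F}$ is the family of split graphs, then $\mathcal{S}=\{2K_2,C_5,A,\text{house},\overline{X_{170}},\overline{2P_3}\}$; (4) if $\mathcal{F}$ is the family of forests, then $\mathcal{S}=\{A,B\}\cup\{C_n : n=3\text{ or }n\ge 5\}$; (5) if $\mathcal{F}$ is the family of chordal graphs, then $\mathcal{S}=F_{C_4}\cup\{C_n : n\ge 5\}$; (6) if $\mathcal{F}$ is the family of interval graphs, then $\mathcal{S}=F_{C_4}\cup\{C_n : n\ge 5\}\cup\mathcal{I}$; (7) if $\mathcal{F}$ is the family of strongly chordal graphs, then $\mathcal{S}=F_{C_4}\cup\{C_n : n\ge 5\}\cup\{T_n : n\ge 3\}$.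
   Context: Graphs are finite and undirected, with neither loops nor parallel edges. A full homomorphism from $G$ to $H$ is a function $\varphi\colon V_G\to V_H$ such that, for all $u,v\in V_G$, $uv\in E_G$ if and only if $\varphi(u)\varphi(v)\in E_H$. A graph is fully $\mathcal{F}$-colourable if it admits a full homomorphism to some graph in $\mathcal{F}$. A minimal obstruction to full $\mathcal{F}$-colouring is a graph that is not fully $\mathcal{F}$-colourable but all of whose proper induced subgraphs are. $P_n$, $C_n$, $K_n$ are the path, cycle and complete graph on $n$ vertices; $nG$ is the disjoint union of $n$ copies of $G$; $\overline{G}$ is the complement of $G$. Graph families: quasi-threshold (trivially perfect) graphs are the $\{P_4,C_4\}$-free graphs; threshold graphs are the $\{2K_2,P_4,C_4\}$-free graphs; split graphs are the graphs whose vertex set can be partitioned into a clique and an independent set (equivalently, $\{2K_2,C_4,C_5\}$-free graphs); chordal graphs are the graphs with no induced cycle of length at least $4$; interval graphs are the intersection graphs of intervals on the real line; strongly chordal graphs are the chordal graphs containing no trampoline as an induced subgraph (''free'' always refers to induced subgraphs). A trampoline is a graph obtained from a complete graph $K$ of order $n\ge 3$ by choosing a hamiltonian cycle $C$ of $K$ and adding, for each edge $e$ of $C$, a new vertex adjacent to exactly the two endpoints of $e$; $T_n$ is the trampoline obtained from $K_n$. $F_{C_4}=\{A,B,\text{house},\overline{X_{170}},\overline{2P_3}\}$. Starting from a 4-cycle $u_1u_2u_3u_4u_1$: the house is obtained by adding a vertex adjacent to exactly $u_1,u_2$; $A$ is obtained by adding two nonadjacent vertices $v,w$, with $v$ adjacent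 only to $u_1$ and $w$ only to $u_2$; $B$ is obtained from $A$ by adding the edge $vw$; $\overline{X_{170}}$ is obtained by adding two nonadjacent vertices $v,w$ with $v$ adjacent exactly to $u_1$ and $w$ adjacent exactly to $u_1,u_2,u_3$; $\overline{2P_3}$ is the complement of $2P_3$. $\mathcal{I}$ is the set (Lekkerkerker and Boland's minimal obstructions for interval graphs other than cycles) consisting of the following graphs: (i) the tree obtained from $K_{1,3}$ by subdividing each edge once; (ii) the 7-vertex graph consisting of an induced path $x_1x_2x_3x_4x_5$, a vertex $d$ adjacent to $x_1,\dots,x_5$, and a vertex $u$ adjacent only to $x_3$; (iii) for each $k\ge 2$, the graph consisting of an induced path $p\,x_1x_2\cdots x_k\,q$, a vertex $c$ adjacent on this path exactly to $x_1,\dots,x_k$, and a vertex $d$ adjacent only to $c$; (iv) for each $k\ge 1$, the graph consisting of an induced path $p\,x_1x_2\cdots x_k\,q$, two adjacent vertices $l,r$, with $l$ adjacent on the path exactly to $p,x_1,\dots,x_k$ and $r$ adjacent on the path exactly to $x_1,\dots,x_k,q$, and a vertex $t$ adjacent exactly to $l$ and $r$. *)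

(* Defs.v *)
From HB Require Import structures.
From mathcomp Require Import all_boot all_order all_algebra.
From mathcomp Require Import reals.
From Stdlib Require List.

Set Implicit Arguments.
Unset Strict Implicit.
Unset Printing Implicit Defensive.

Record sgraph : Type := SGraph {
  vertex :> finType;
  adj : rel vertex;
  adj_sym : symmetric adj;
  adj_irr : irreflexive adj
}.

Definition graph_family : Type := sgraph -> Prop.

Section OfRel.
Variables (T : finType) (r : rel T).

(* The symmetric, loopless closure of [r], so that each edge has to be given
   in one direction only. *)
Definition edge_of_rel : rel T := fun x y => (x != y) && (r x y || r y x).

Lemma edge_of_rel_sym : symmetric edge_of_rel.
Proof. by move=> x y; rewrite /edge_of_rel eq_sym orbC. Qed.

Lemma edge_of_rel_irr : irreflexive edge_of_rel.
Proof. by move=> x; rewrite /edge_of_rel eqxx. Qed.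

Definition graph_of_rel : sgraph := SGraph edge_of_rel_sym edge_of_rel_irr.
End OfRel.

Definition graph_on (n : nat) (r : rel nat) : sgraph :=
  graph_of_rel (fun i j : 'I_n => r i j).

Definition graph_of_edges (n : nat) (E : seq (nat * nat)) : sgraph :=
  graph_on n (fun i j => (i, j) \in E).

Definition induced (G : sgraph) (S : {set G}) : sgraph :=
  graph_of_rel (fun x y : {z : G | z \in S} => adj (val x) (val y)).

Definition compl_graph (G : sgraph) : sgraph :=
  graph_of_rel (fun x y : G => ~~ adj x y).

Definition copies (n : nat) (G : sgraph) : sgraph :=
  graph_of_rel (fun x y : 'I_n * G => (x.1 == y.1) && adj x.2 y.2).

(* [List.In] rather than [\in], as [sgraph] has no decidable equality. *)
Definition one_of (s : seq sgraph) : graph_family := fun H => List.In H s.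

Definition full_hom (G H : sgraph) (f : G -> H) : Prop :=
  forall u v : G, adj u v <-> adj (f u) (f v).

Definition isomorphic (G H : sgraph) : Prop :=
  exists2 f : G -> H, bijective f & full_hom f.

Definition fully_colourable (F : graph_family) (G : sgraph) : Prop :=
  exists2 H : sgraph, F H & exists f : G -> H, full_hom f.

Definition minimal_obstruction (F : graph_family) (G : sgraph) : Prop :=
  ~ fully_colourable F G /\
  forall S : {set G}, S \proper [set: G] -> fully_colourable F (induced S).

(* Up to isomorphism, the minimal obstructions are the members of [S]. *)
Definition minimal_obstructions_are (F S : graph_family) : Prop :=
  forall G : sgraph,
    minimal_obstruction F G <-> exists2 H : sgraph, S H & isomorphic G H.

Definition contains_induced (G H : sgraph) : Prop :=
  exists S : {set G}, isomorphic (induced S) H.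

Definition is_free (L : graph_family) (G : sgraph) : Prop :=
  forall H : sgraph, L H -> ~ contains_induced G H.

Definition path_graph (n : nat) : sgraph := graph_on n (fun i j => i.+1 == j).

(* The cycle on [n] vertices only for [3 <= n]. *)
Definition cycle_graph (n : nat) : sgraph :=
  graph_on n (fun i j => i.+1 %% n == j).

Definition complete_graph (n : nat) : sgraph := graph_on n (fun _ _ => true).

(* The trampoline obtained from the complete graph on [0 .. n-1] by choosing
   the hamiltonian cycle [0, 1, .., n-1, 0]; vertex [n + i] is the one added
   for the edge [i, (i + 1) mod n]. Only meaningful for [3 <= n]. *)
Definition trampoline (n : nat) : sgraph :=
  graph_on (n + n) (fun i j =>
    ((i < n) && (j < n)) ||
    [&& n <= i, j < n & (j == i - n) || (j == (i - n).+1 %% n)]).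

Definition quasi_threshold : graph_family :=
  is_free (one_of [:: path_graph 4; cycle_graph 4]).

Definition threshold : graph_family :=
  is_free (one_of [:: copies 2 (complete_graph 2); path_graph 4; cycle_graph 4]).

Definition split_graph : graph_family := fun G =>
  exists K : {set G},
    (forall x y, x \in K -> y \in K -> x != y -> adj x y) /\
    (forall x y, x \notin K -> y \notin K -> ~~ adj x y).

Definition forest : graph_family := fun G =>
  forall s : seq G, 2 < size s -> ~ ucycle (@adj G) s.

Definition chordal : graph_family :=
  is_free (fun H => exists2 n, 4 <= n & H = cycle_graph n).

(* Intervals of any kind are allowed: open, closed, half-open, unbounded. *)
Definition interval_graph (R : realType) : graph_family := fun G =>
  exists I : G -> interval R, forall u v : G, u != v ->
    (adj u v <-> exists x : R, x \in I u /\ x \in I v).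

Definition strongly_chordal : graph_family :=
  fun G => chordal G /\
    is_free (fun H => exists2 n, 3 <= n & H = trampoline n) G.

(* In the next four graphs, u_1, .., u_4 are 0, .., 3 and v, w are 4, 5; in
   the house, the added vertex is 4. *)
Definition square_edges : seq (nat * nat) := [:: (0, 1); (1, 2); (2, 3); (3, 0)].

Definition house : sgraph :=
  graph_of_edges 5 (square_edges ++ [:: (4, 0); (4, 1)]).

Definition graph_A : sgraph :=
  graph_of_edges 6 (square_edges ++ [:: (4, 0); (5, 1)]).

Definition graph_B : sgraph :=
  graph_of_edges 6 (square_edges ++ [:: (4, 0); (5, 1); (4, 5)]).

Definition co_X170 : sgraph :=
  graph_of_edges 6 (square_edges ++ [:: (4, 0); (5, 0); (5, 1); (5, 2)]).

Definition co_2P3 : sgraph := compl_graph (copies 2 (path_graph 3)).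

Definition F_C4 : graph_family := one_of
  [:: graph_A; graph_B; house; co_X170; co_2P3].

(* 0 is the centre of the claw, 1, 2, 3 are the subdividing vertices and
   4, 5, 6 the leaves. *)
Definition subdivided_claw : sgraph :=
  graph_of_edges 7 [:: (0, 1); (0, 2); (0, 3); (1, 4); (2, 5); (3, 6)].

(* The path x_1, .., x_5 is 0, .., 4, the vertex adjacent to the whole path
   is 5, and the one adjacent to x_3 only is 6. *)
Definition umbrella : sgraph :=
  graph_of_edges 7 [:: (0, 1); (1, 2); (2, 3); (3, 4);
                       (5, 0); (5, 1); (5, 2); (5, 3); (5, 4); (6, 2)].

(* The path p, x_1, .., x_k, q is 0, 1, .., k, k+1; moreover c = k+2 and
   d = k+3. *)
Definition LB_one_hub (k : nat) : sgraph :=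
  graph_on k.+4 (fun i j =>
    [|| (i.+1 == j) && (j <= k.+1),
        (i == k.+2) && (1 <= j <= k) |
        (i == k.+3) && (j == k.+2)]).

(* The path p, x_1, .., x_k, q is 0, 1, .., k, k+1; moreover l = k+2, r = k+3
   and t = k+4. *)
Definition LB_two_hubs (k : nat) : sgraph :=
  graph_on k.+4.+1 (fun i j =>
    [|| (i.+1 == j) && (j <= k.+1),
        (i == k.+2) && (j == k.+3),
        (i == k.+2) && (j <= k),
        (i == k.+3) && (1 <= j <= k.+1) |
        (i == k.+4) && ((j == k.+2) || (j == k.+3))]).

Definition LB_obstructions : graph_family := fun H =>
  one_of [:: subdivided_claw; umbrella] H \/
  (exists2 k, 2 <= k & H = LB_one_hub k) \/
  (exists2 k, 1 <= k & H = LB_two_hubs k).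

(* Main.v *)
Require Import Defs.
From HB Require Import structures.
From mathcomp Require Import all_boot all_order all_algebra.
From mathcomp Require Import reals.
From mathcomp Require Import zify.
From Stdlib Require Import Classical.

Set Implicit Arguments.
Unset Strict Implicit.
Unset Printing Implicit Defensive.

(** A full homomorphism identifies only vertices with the same neighbours (twins),
    so for a hereditary family a twin-free graph is colourable exactly if it
    belongs to the family, and minimal obstructions are twin-free. Hence one has to
    show that each graph listed is a minimal obstruction and that each twin-free
    graph outside the family contains one of them ([minimal_obstructions_areI]).

    Each family is described by forbidden induced subgraphs. These are twin-free,
    except for the four-cycle. In a twin-free graph some vertex distinguishes the
    two ends of each diagonal of a four-cycle, and adding two such vertices always
    yields a member of the family [F_C4] ([twin_free_four_cycle]). The completeness
    of the lists then follows from descriptions of the families by forbidden induced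
    subgraphs. For (quasi-)threshold, chordal and strongly chordal graphs these are
    the definitions. A chordal triangle-free graph is a forest
    ([chordal_triangle_free_forest]), and split graphs are the graphs without induced
    2K2, C4, C5 ([free_split]).

    For interval graphs one needs the theorem of Lekkerkerker and Boland
    ([chordal_nat_interval_or_LB]), which is proved in two steps. Chordality is always
    used in the form [links_closed].

    - A chordal graph without asteroidal triples is an interval graph
      ([asteroidal_free_orientable]). In a counterexample with all proper induced
      subgraphs interval graphs, a minimal separator [S] is a clique. If every
      component can be laid out with [S] at one end, then at most two components
      are not complete to [S] (three of them contain an asteroidal triple), and the
      layouts can be glued together. So each minimal separator is the neighbourhood
      of a vertex whose closed neighbourhood does not disconnect the rest. Three such
      vertices would form an asteroidal triple, and one or two are not enough:
      looking at the two ends of a layout of the graph without one of them shows how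
      to insert this vertex, or the other one, at an end.

    - A chordal graph with an asteroidal triple contains one of the graphs of
      Lekkerkerker and Boland ([asteroidal_LB]). With the three paths that witness
      the triple chosen of smallest total length, consider how the neighbours of the
      third vertex on its two paths see the path between the first two.

    That the graphs listed are minimal obstructions is a finite computation for the
    sporadic ones ([finite_minimal_obstruction]). Cycles without a vertex are paths,
    the graphs of Lekkerkerker and Boland are shown to be minimal by explicit
    interval models, and a trampoline contains no smaller one since its hamiltonian
    cycle has to be mapped round that of the larger ([trampoline_embeds]). *)

(** * Obstructions and twin-free graphs *)

Definition embeds (H G : sgraph) : Prop :=
  exists2 f : H -> G, injective f & forall u v, adj (f u) (f v) = adj u v.

Definition hereditary (F : graph_family) : Prop :=
  forall G H, embeds H G -> F G -> F H.

Definition twin_free (G : sgraph) : Prop :=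
  forall u v : G, (forall w, adj u w = adj v w) -> u = v.

Lemma adj_neq (G : sgraph) (u v : G) : adj u v -> u != v.
Proof. by move=> uv; apply: contraTN uv => /eqP->; rewrite adj_irr. Qed.

Lemma embeds_refl G : embeds G G.
Proof. by exists id. Qed.

Lemma embeds_trans H G K : embeds H G -> embeds G K -> embeds H K.
Proof.
move=> [f fI fA] [g gI gA]; exists (g \o f); first exact: inj_comp.
by move=> u v; rewrite /= gA fA.
Qed.

Lemma full_homE (G H : sgraph) (f : G -> H) :
  full_hom f <-> forall u v, adj (f u) (f v) = adj u v.
Proof.
split=> fA u v; last by rewrite fA.
by apply/idP/idP => /fA.
Qed.

Lemma adj_induced (G : sgraph) (S : {set G}) (u v : induced S) :
  adj u v = adj (val u) (val v).
Proof.
rewrite /= /edge_of_rel (adj_sym (val v)) orbb -val_eqE.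
by case: eqP => //= ->; rewrite adj_irr.
Qed.

Lemma embeds_induced (G : sgraph) (S : {set G}) : embeds (induced S) G.
Proof. by exists val; [exact: val_inj | move=> u v; rewrite adj_induced]. Qed.

Lemma embeds_into_induced (H G : sgraph) (S : {set G}) (f : H -> G) :
  injective f -> (forall u v, adj (f u) (f v) = adj u v) ->
  (forall u, f u \in S) -> embeds H (induced S).
Proof.
move=> fI fA fS; exists (fun u => Sub (f u) (fS u) : induced S).
  by move=> u v /(congr1 val) /=; exact: fI.
by move=> u v; rewrite adj_induced /= fA.
Qed.

Lemma isomorphic_embeds G H : isomorphic G H -> embeds H G /\ embeds G H.
Proof.
move=> [f [g fK gK] /full_homE fA]; split.
  by exists g => [|u v]; [exact: can_inj gK | rewrite -fA !gK].
by exists f; first exact: can_inj fK.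
Qed.

Lemma contains_inducedP G H : contains_induced G H <-> embeds H G.
Proof.
split=> [[S /isomorphic_embeds [HS _]]|[f fI fA]].
  exact: embeds_trans HS (embeds_induced S).
exists [set f x | x : H].
have inv (y : induced [set f x | x : H]) : {x : H | f x == val y}.
  by apply/sigW; case/imsetP: (valP y) => x _ ->; exists x.
exists (fun y => sval (inv y)).
  have fS x : f x \in [set f x | x : H] by apply: imset_f.
  exists (fun x => Sub (f x) (fS x)) => y.
    by apply: val_inj; rewrite /=; apply/eqP; exact: svalP (inv y).
  by apply: fI; exact/eqP/(svalP (inv (Sub (f y) (fS y)))).
apply/full_homE => u v; rewrite -fA adj_induced.
by rewrite (eqP (svalP (inv u))) (eqP (svalP (inv v))).
Qed.

Lemma is_free_hereditary L : hereditary (is_free L).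
Proof.
move=> G H HG freeG K LK /contains_inducedP KH.
by apply: (freeG K LK); apply/contains_inducedP; apply: embeds_trans KH HG.
Qed.

Lemma family_colourable (F : graph_family) G : F G -> fully_colourable F G.
Proof. by move=> FG; exists G => //; exists id. Qed.

Lemma embeds_colourable F H G :
  embeds H G -> fully_colourable F G -> fully_colourable F H.
Proof.
move=> [g _ gA] [K FK [f /full_homE fA]]; exists K => //.
by exists (f \o g); apply/full_homE => u v; rewrite /= fA gA.
Qed.

(** A full homomorphism can only identify twins, so it is injective on a
    twin-free graph. *)
Lemma twin_free_colourable (F : graph_family) G :
  hereditary F -> twin_free G -> fully_colourable F G -> F G.
Proof.
move=> hF tf [H FH [f /full_homE fA]]; apply: hF FH; exists f => // u v fuv.
by apply: tf => w; rewrite -!fA fuv.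
Qed.

(** Deleting one of two twins does not change colourability: the deleted
    vertex can be sent where its twin goes. *)
Lemma minimal_obstruction_twin_free F G :
  minimal_obstruction F G -> twin_free G.
Proof.
move=> [ncol minG] u v uv; apply/eqP/negPn/negP => neq; apply: ncol.
have neu : u \in [set~ v] by rewrite !inE.
have /minG : [set~ v] \proper [set: G].
  by apply/properP; split; [exact: subsetT | exists v; rewrite !inE ?eqxx].
case=> K FK [f /full_homE fA]; exists K => //.
pose r x := odflt (Sub u neu : induced [set~ v]) (insub x).
have rE x : val (r x) = if x == v then u else x.
  rewrite /r; case: insubP => [y|] /=; rewrite !inE.
    by move=> /negPf -> ->.
  by rewrite negbK => ->.
exists (f \o r); apply/full_homE => x y; rewrite /= fA adj_induced !rE.
case: (eqVneq x v) => [->|_]; case: (eqVneq y v) => [->|_] //.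
- by rewrite !adj_irr.
- by rewrite adj_sym uv adj_sym.
Qed.

(** Homomorphisms of the graph without [v], as maps on all its vertices in order to
    avoid the subtype of the vertices other than [v]. *)
Definition colourable_without (F : graph_family) (G : sgraph) (v : G) : Prop :=
  exists2 K, F K & exists f : G -> K,
    forall x y, x != v -> y != v -> adj (f x) (f y) = adj x y.

Lemma minimal_obstructionI F G :
  ~ fully_colourable F G -> (forall v : G, colourable_without F v) ->
  minimal_obstruction F G.
Proof.
move=> ncol col; split=> // S /properP [_ [v _ vS]].
have [K FK [f fA]] := col v; exists K => //; exists (f \o val).
apply/full_homE => x y; rewrite adj_induced /= fA //.
  by apply: contraNneq vS => <-; exact: valP.
by apply: contraNneq vS => <-; exact: valP.
Qed.

Lemma embeds_without (G H : sgraph) (f : H -> G) (v : G) :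
  injective f -> (forall x y, adj (f x) (f y) = adj x y) ->
  (forall x, f x != v) -> embeds H (induced [set~ v]).
Proof.
by move=> fI fA fv; apply: (embeds_into_induced fI fA) => u; rewrite !inE.
Qed.

Lemma minimal_obstruction_iso F G H :
  isomorphic G H -> minimal_obstruction F H -> minimal_obstruction F G.
Proof.
move=> isoGH [ncol minH]; split.
  by move=> /(embeds_colourable (isomorphic_embeds isoGH).1).
move=> S /properP [_ [v _ vS]].
have [f [g fK gK] /full_homE fA] := isoGH.
have /minH : [set~ f v] \proper [set: H].
  by apply/properP; split; [exact: subsetT | exists (f v); rewrite !inE ?eqxx].
apply: embeds_colourable.
apply: (@embeds_without _ (induced S) (f \o val)).
- by apply: inj_comp val_inj; exact: can_inj fK.
- by move=> x y; rewrite adj_induced /= fA.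
move=> x; rewrite /= (can_eq fK).
by apply: contraNneq vS => <-; exact: valP.
Qed.

(** If a minimal obstruction contains another one, it has no further vertices, since
    otherwise the latter would be colourable. So a set of minimal obstructions is
    complete once every twin-free graph outside the family contains one of them. *)
Lemma minimal_obstructions_areI (F S : graph_family) :
  (forall H, S H -> minimal_obstruction F H) ->
  (forall G, twin_free G -> ~ F G -> exists2 H, S H & embeds H G) ->
  minimal_obstructions_are F S.
Proof.
move=> minS complete G; split=> [minG|[H SH isoGH]]; last first.
  by apply: minimal_obstruction_iso isoGH _; exact: minS.
have [|H SH [f fI fA]] := complete G (minimal_obstruction_twin_free minG).
  by move=> /family_colourable; exact: minG.1.
exists H => //.
have [surj|] := boolP [forall y, y \in codom f]; last first.
  case/forallPn => v /negP vf; case: (minS H SH).1.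
  have /minG.2 : [set~ v] \proper [set: G].
    by apply/properP; split; [exact: subsetT | exists v; rewrite !inE ?eqxx].
  apply: embeds_colourable; apply: (embeds_without fI fA) => x.
  by apply/eqP => fx; apply: vf; rewrite -fx codom_f.
have [g gK] : exists g : G -> H, cancel g f.
  have inv y : {x | f x == y}.
    by apply/sigW; have /codomP [x ->] := forallP surj y; exists x.
  by exists (fun y => sval (inv y)) => y; exact/eqP/(svalP (inv y)).
exists g; last by apply/full_homE => u v; rewrite -fA !gK.
by exists f => // x; apply: fI; rewrite gK.
Qed.

Lemma colourable_withoutI (F : graph_family) (G : sgraph) (v x0 : G) :
  x0 != v -> (forall S : {set G}, v \notin S -> F (induced S)) ->
  colourable_without F v.
Proof.
move=> x0v FG; have x0S : x0 \in [set~ v] by rewrite !inE.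
exists (induced [set~ v]); first by apply: FG; rewrite !inE eqxx.
pose r x := odflt (Sub x0 x0S : induced [set~ v]) (insub x).
have rE x : x != v -> val (r x) = x.
  by move=> xv; rewrite /r insubT //= !inE.
by exists r => x y xv yv; rewrite adj_induced !rE.
Qed.

(** * Walks, induced paths and chordality *)

Lemma adj_graph_on n (r : rel nat) (i j : graph_on n r) :
  adj i j = (i != j :> nat) && (r i j || r j i).
Proof. by rewrite /= /edge_of_rel -val_eqE. Qed.

Lemma embeds_graph_on n (r : rel nat) (G : sgraph) (g : nat -> G) :
  (forall i j, i < j -> j < n ->
     g i != g j /\ adj (g i) (g j) = r i j || r j i) ->
  embeds (graph_on n r) G.
Proof.
move=> gP; exists (fun i => g (nat_of_ord i)) => [i j gij|i j].
  apply: val_inj => /=.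
  case: (ltngtP i j) => // /gP/(_ (ltn_ord _)) [/eqP ne _]; last by case: ne.
  by case: ne.
rewrite adj_graph_on; case: (ltngtP i j) => [ij|ji|/val_inj ->] /=.
- exact: (gP i j ij (ltn_ord j)).2.
- by rewrite adj_sym orbC; exact: (gP j i ji (ltn_ord i)).2.
by rewrite adj_irr.
Qed.

Lemma cycle_relE n i j : 2 < n -> i < j -> j < n ->
  (i.+1 %% n == j) || (j.+1 %% n == i) = (j == i.+1) || (i == 0) && (j.+1 == n).
Proof.
move=> n3 ij jn; rewrite (@modn_small i.+1); last by lia.
case: (ltngtP j.+1 n) => jn'; [|by lia|by rewrite jn' modnn; lia].
by rewrite modn_small //; lia.
Qed.

Section Walks.
Variable G : sgraph.
Implicit Types (T : {set G}) (p : nat -> G) (x y u v : G).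

Definition conn T : rel G :=
  connect (fun u v => [&& adj u v, u \in T & v \in T]).

(** Walks are functions on [nat] that matter up to their length only, so that
    subwalks and reversed walks are obtained by reindexing. *)
Definition walk T m p x y : Prop :=
  [/\ p 0 = x, p m = y, forall i, i <= m -> p i \in T &
      forall i, i < m -> adj (p i) (p i.+1)].

Definition ipath m p : Prop :=
  (forall i j, i <= m -> j <= m -> p i = p j -> i = j) /\
  (forall i j, i <= m -> j <= m ->
     adj (p i) (p j) = (i.+1 == j) || (j.+1 == i)).

Lemma conn_sym T : symmetric (conn T).
Proof.
by apply: sym_connect_sym => x y; rewrite adj_sym; case: (x \in T);
  rewrite ?andbF /= ?andbT ?andbF /=.
Qed.

Lemma conn_trans T : transitive (conn T). Proof. exact: connect_trans. Qed.

Lemma conn_adj T x y : x \in T -> y \in T -> adj x y -> conn T x y.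
Proof. by move=> xT yT xy; apply: connect1; rewrite xy xT. Qed.

Lemma sub_conn T T' x y : T \subset T' -> conn T x y -> conn T' x y.
Proof.
move=> /subsetP sTT'; apply: connect_sub => u v /and3P [uv uT vT].
by apply: conn_adj => //; exact: sTT'.
Qed.

Lemma conn_closed T (A : {set G}) x y : conn T x y -> x \in A ->
  (forall u v, u \in A -> u \in T -> v \in T -> adj u v -> v \in A) -> y \in A.
Proof.
case/connectP => s; elim: s x => [|z s IH] x /=; first by move=> _ ->.
case/andP => /and3P [xz xT zT] zs yE xA clA.
by apply: (IH z zs yE _ clA); exact: (clA x z).
Qed.

Lemma conn_mem T x y : x \in T -> conn T x y -> y \in T.
Proof. by move=> xT /conn_closed; apply. Qed.

Lemma walk_conn T p i j : i <= j ->
  (forall t, i <= t <= j -> p t \in T) ->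
  (forall t, i <= t < j -> adj (p t) (p t.+1)) -> conn T (p i) (p j).
Proof.
move=> ij; rewrite -(subnKC ij); elim: (j - i) => [|d IH] pT pA.
  by rewrite addn0; exact: connect0.
apply: (@conn_trans _ (p (i + d))).
  by apply: IH => t t_le; [apply: pT | apply: pA]; lia.
by rewrite addnS; apply: conn_adj; [apply: pT | apply: pT | apply: pA]; lia.
Qed.

Lemma conn_walk T x y : x \in T -> conn T x y -> exists m p, walk T m p x y.
Proof.
move=> xT /connectP [s sP ->]; exists (size s), (nth x (x :: s)).
split=> //; first by rewrite nth_last.
  move=> i; elim: i => [|i IH] // i_lt.
  by have /and3P [] := pathP x sP i i_lt.
by move=> i i_lt; have /and3P [] := pathP x sP i i_lt.
Qed.

(** A repetition or a chord of a walk gives a shortcut, so that a shortest walk is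
    an induced path. *)
Lemma walk_ipath T m p x y : walk T m p x y ->
  exists m' q, [/\ m' <= m, walk T m' q x y & ipath m' q].
Proof.
elim/ltn_ind: m p => m IH p wp; have [p0 pm pT pA] := wp.
(* a chord, or a return to a vertex after the first, gives a shortcut *)
have [[i [j [ij jm sc]]]|noshort] := classic (exists i j,
    [/\ i.+1 < j, j <= m & adj (p i) (p j) || (p i.+1 == p j)]).
  pose q t := if t <= i then p t else p (t + (j - i.+1)).
  have lt_m : m - (j - i.+1) < m by lia.
  have [|m' [q' [m'm w' ip']]] := IH _ lt_m q.
    split.
    - by rewrite /q leq0n.
    - by rewrite /q; case: leqP => h; [lia | rewrite subnK //; lia].
    - by move=> t t_le; rewrite /q; case: leqP => h; apply: pT; lia.
    move=> t t_lt; rewrite /q; case: (ltngtP t i) => h.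
    + by apply: pA; lia.
    + by rewrite addSn; apply: pA; lia.
    have -> : t.+1 + (j - i.+1) = j by lia.
    rewrite h.
    case/orP: sc => [//|/eqP <-]; apply: pA; lia.
  by exists m', q'; split=> //; lia.
have noadj i j : i.+1 < j -> j <= m -> ~~ adj (p i) (p j).
  by move=> ij jm; apply/negP => h; case: noshort; exists i, j; rewrite h.
have [[i [j [ij jm pij]]]|inj] :=
    classic (exists i j, [/\ i < j, j <= m & p i = p j]).
  case: i ij pij => [|i] ij pij.
    pose q t := p (t + j).
    have lt_m : m - j < m by lia.
    have [|m' [q' [m'm w' ip']]] := IH _ lt_m q.
      split; rewrite /q ?add0n -?pij ?subnK //.
      - by move=> t t_le; apply: pT; lia.
      by move=> t t_lt; rewrite addSn; apply: pA; lia.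
    by exists m', q'; split=> //; lia.
  by case: noshort; exists i, j; rewrite pij eqxx orbT; split=> //; lia.
exists m, p; split=> //.
have lt_inj i j : i < j -> j <= m -> p i <> p j.
  by move=> ij jm h; case: inj; exists i, j.
have ltA i j : i < j -> j <= m -> adj (p i) (p j) = (i.+1 == j).
  move=> ij jm; case: eqP => [<-|ne]; first by apply: pA; lia.
  by apply/negbTE/noadj => //; lia.
split=> i j im jm; first by case: (ltngtP i j) => // h e;
  [case: (lt_inj i j) | case: (lt_inj j i)].
case: (ltngtP i j) => [h|h|->].
- by rewrite ltA //; lia.
- by rewrite adj_sym ltA //; lia.
by rewrite adj_irr; lia.
Qed.

Lemma conn_ipath T x y : x \in T -> conn T x y ->
  exists m p, walk T m p x y /\ ipath m p.
Proof.
move=> xT /(conn_walk xT) [m [p /walk_ipath [m' [q [_ wq iq]]]]].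
by exists m', q.
Qed.

Lemma ipath_sub m p d k :
  ipath m p -> d + k <= m -> ipath k (fun i => p (d + i)).
Proof.
move=> [pI pA] dk; split=> i j ik jk; last by rewrite pA; lia.
by move/pI => h; apply/(@addnI d)/h; lia.
Qed.

Lemma ipath_rev m p : ipath m p -> ipath m (fun i => p (m - i)).
Proof.
move=> [pI pA]; split=> i j ik jk; last first.
  by rewrite pA ?leq_subr // orbC; congr (_ || _); apply/eqP/eqP; lia.
by move/pI => h; have e : m - i = m - j; [apply: h|]; lia.
Qed.

Lemma walk_rev T m p x y :
  walk T m p x y -> walk T m (fun i => p (m - i)) y x.
Proof.
move=> [p0 pm pT pA]; split; rewrite ?subn0 ?subnn //.
  by move=> i _; apply: pT; lia.
move=> i im; rewrite adj_sym.
have -> : m - i = (m - i.+1).+1 by lia.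
by apply: pA; lia.
Qed.

(** The form in which chordality is used: a shortest link between [u] and [v] outside
    the closed neighbourhood of [a] closes up with [a] to a chordless cycle, of
    length at least four unless [u] and [v] are equal or adjacent. *)
Definition links_closed : Prop := forall (a u v : G) (T : {set G}),
  adj a u -> adj a v -> u \in T -> conn T u v ->
  (forall x, x \in T -> x != u -> x != v -> x != a /\ ~~ adj a x) ->
  (u == v) || adj u v.

Lemma links_closed_no_cycle n : 4 <= n ->
  links_closed -> ~ embeds (cycle_graph n) G.
Proof.
case: n => [|n] // n4 lc [f fI fA].
have gA i j : i < j -> j <= n -> adj (f (inord i)) (f (inord j)) =
    (j == i.+1) || (i == 0) && (j == n).
  move=> ij jn; rewrite fA adj_graph_on !inordK; try lia.
  by rewrite cycle_relE //; lia.
pose T' := [set f j | j : 'I_n.+1 & j != ord0 :> 'I_n.+1].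
have memT i : 1 <= i <= n -> f (inord i) \in T'.
  move=> i_le; apply: imset_f; rewrite inE -val_eqE /= inordK; lia.
have f1n : f (inord 1) == f (inord n) = false.
  by apply/eqP => /fI /(congr1 val); rewrite /= !inordK; lia.
suff : (f (inord 1) == f (inord n)) || adj (f (inord 1)) (f (inord n)).
  by rewrite f1n gA; lia.
apply: (lc (f (inord 0)) _ _ T'); try by rewrite gA ?eqxx ?orbT; lia.
- by apply: memT; lia.
- apply: (@walk_conn T' (fun i => f (inord i))) => [|t t_le|t t_le].
  + by lia.
  + by apply: memT; lia.
  by rewrite gA ?eqxx //; lia.
move=> x /imsetP [j]; rewrite inE -val_eqE /= => j0 ->.
have jn := ltn_ord j; rewrite -[in f j](inord_val j) => ne1 nen.
have j1 : nat_of_ord j <> 1 by move=> e; move: ne1; rewrite e eqxx.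
have jn' : nat_of_ord j <> n by move=> e; move: nen; rewrite e eqxx.
rewrite gA; [split; last by lia | by lia | by lia].
by apply/eqP => /fI /(congr1 val); rewrite /= !inordK; lia.
Qed.

Lemma chordal_links_closed : chordal G -> links_closed.
Proof.
move=> chG a u v T au av uT cuv out; apply/negP => /negP.
rewrite negb_or => /andP [neq nadj].
have [m [p [[p0 pm pT pA] [pI pE]]]] := conn_ipath uT cuv.
have m2 : 1 < m.
  case: m p0 pm pI pA {pE pT} => [|[|m]] p0 pm pI pA //.
    by move: neq; rewrite -p0 -pm eqxx.
  by move: nadj; rewrite -p0 -pm pA.
have outp i : 0 < i < m -> p i != a /\ ~~ adj a (p i).
  move=> i_lt; apply: out; first by apply: pT; lia.
    by rewrite -p0; apply/eqP => /pI h; have e : i = 0; [apply: h|]; lia.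
  by rewrite -pm; apply/eqP => /pI h; have e : i = m; [apply: h|]; lia.
have apE i : i <= m -> adj a (p i) = (i == 0) || (i == m).
  move=> im; case: (posnP i) => [->|i0]; first by rewrite p0 au.
  case: (eqVneq i m) => [->|im']; first by rewrite pm av orbT.
  by have [|_ /negbTE ->] := outp i; lia.
have pa i : i <= m -> p i != a.
  move=> im; case: (posnP i) => [->|i0]; first by rewrite p0 eq_sym adj_neq.
  case: (eqVneq i m) => [->|im']; first by rewrite pm eq_sym adj_neq.
  by have [|] := outp i; lia.
apply: (chG (cycle_graph m.+2)); first by exists m.+2.
apply/contains_inducedP.
apply: (@embeds_graph_on _ _ G (fun i => if i <= m then p i else a)).
move=> i j ij jm; rewrite cycle_relE //; last by lia.
have -> : i <= m by lia.
case: leqP => jm'; last first.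
  split; first by apply: pa; lia.
  by rewrite adj_sym apE; lia.
split; first by apply/eqP => /pI h; have e : i = j; [apply: h|]; lia.
by rewrite pE; lia.
Qed.

Lemma links_closed_chordal : links_closed -> chordal G.
Proof.
by move=> lc H [n n4 ->] /contains_inducedP; exact: links_closed_no_cycle.
Qed.

End Walks.

(** * Chordal graphs without asteroidal triples *)

Section Orientations.
Variable G : sgraph.
Implicit Types (W S T A B : {set G}) (lt : rel G) (u v w x y z s : G).

Definition cadj : rel G := fun u v => (u == v) || adj u v.

Definition outN z : {set G} := [set v | ~~ cadj z v].

Definition avoids z x y : Prop :=
  [/\ x \in outN z, y \in outN z & conn (outN z) x y].

Definition asteroidal x y z : Prop :=
  [/\ avoids z x y, avoids y x z & avoids x y z].

(** A transitive orientation of the non-edges inside [W]; for intervals,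
    [lt u v] reads: [u] lies entirely to the left of [v]. As [cadj] is reflexive,
    [lt] is irreflexive. *)
Definition orients W lt : Prop :=
  (forall x y z, x \in W -> y \in W -> z \in W ->
     lt x y -> lt y z -> lt x z) /\
  (forall x y, x \in W -> y \in W -> cadj x y = ~~ (lt x y || lt y x)).

Definition orientable W : Prop := exists lt, orients W lt.

Lemma cadj_sym : symmetric cadj.
Proof. by move=> u v; rewrite /cadj eq_sym adj_sym. Qed.

Lemma cadjxx u : cadj u u.
Proof. by rewrite /cadj eqxx. Qed.

Lemma adj_cadj u v : adj u v -> cadj u v.
Proof. by rewrite /cadj orbC => ->. Qed.

Lemma orients_rev W lt : orients W lt -> orients W (fun x y => lt y x).
Proof.
move=> [tr cmp]; split; last by move=> x y xW yW; rewrite cmp // orbC.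
by move=> x y z xW yW zW yx zy; exact: (tr z y x).
Qed.

Lemma orients_sub W W' lt : W' \subset W -> orients W lt -> orients W' lt.
Proof.
move=> /subsetP sW [tr cmp]; split.
  by move=> x y z xW yW zW; apply: tr; exact: sW.
by move=> x y xW yW; apply: cmp; exact: sW.
Qed.

Lemma orients_cadjF W lt x y :
  orients W lt -> x \in W -> y \in W -> cadj x y -> lt x y = false.
Proof. by move=> [_ cmp] xW yW; rewrite cmp // negb_or; case: (lt x y). Qed.

Lemma orients_asym W lt x y :
  orients W lt -> x \in W -> y \in W -> lt x y -> lt y x = false.
Proof.
move=> o xW yW xy; apply/negP => yx.
by have := orients_cadjF o xW xW (cadjxx x); rewrite (o.1 x y x).
Qed.

(** A vertex whose neighbours have nothing on their right can be put at the right
    end. *)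
Lemma orientable_add_top W lt x :
  orients (W :\ x) lt ->
  (forall s w, s \in W :\ x -> w \in W :\ x -> adj x s -> ~~ lt s w) ->
  orientable W.
Proof.
move=> o top.
have inW u : u \in W -> u != x -> u \in W :\ x by rewrite !inE => -> ->.
exists (fun u v => if v == x then ~~ cadj x u else (u != x) && lt u v).
split=> [u v w uW vW wW|u v uW vW].
  case: (eqVneq w x) => [_|wx]; case: (eqVneq v x) => [->|vx] //=.
    case: (eqVneq u x) => [//|ux] /= uv vx'.
    rewrite /cadj eq_sym (negbTE ux) /=; apply/negP => xu.
    by move/negP: (top u v (inW _ uW ux) (inW _ vW vx) xu).
  case: (eqVneq u x) => [//|ux] /=.
  by apply: o.1; exact: inW.
case: (eqVneq v x) => [->|vx]; case: (eqVneq u x) => [->|ux] /=.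
- by rewrite cadjxx.
- by rewrite orbF negbK cadj_sym.
- by rewrite negbK.
by apply: o.2; exact: inW.
Qed.

Lemma orientable_add_bottom W lt x :
  orients (W :\ x) lt ->
  (forall s w, s \in W :\ x -> w \in W :\ x -> adj x s -> ~~ lt w s) ->
  orientable W.
Proof.
by move=> /orients_rev o bot; apply: (orientable_add_top o) => s w; exact: bot.
Qed.

(** The clique [S] extends to the right end of [A] and to the left end of [B], and its
    vertices may cover the whole of the rest [R], so that [A], [R] and [B] can be
    laid out in this order. *)
Lemma orientable_glue W S A B ltA ltB ltR :
  let R := W :\: (A :|: B :|: S) in
  [disjoint A & B] -> [disjoint A & S] -> [disjoint B & S] ->
  orients (A :|: S) ltA -> (forall s a, s \in S -> a \in A -> ~~ ltA s a) ->
  orients (B :|: S) ltB -> (forall s b, s \in S -> b \in B -> ~~ ltB b s) ->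
  orients R ltR -> (forall r s, r \in R -> s \in S -> adj r s) ->
  (forall s s', s \in S -> s' \in S -> cadj s s') ->
  (forall a b, a \in A -> b \in B -> ~~ cadj a b) ->
  (forall a r, a \in A -> r \in R -> ~~ cadj a r) ->
  (forall b r, b \in B -> r \in R -> ~~ cadj b r) ->
  orientable W.
Proof.
move=> R dAB dAS dBS oA topA oB botB oR RS clS nAB nAR nBR.
pose cl u := if u \in A then 0 else if u \in B then 2 else
             if u \in S then 3 else 1.
pose inc u v := match cl u, cl v with
  | 0, 0 | 0, 3 => ltA u v | 0, _ => true
  | 1, 1 => ltR u v | 1, 2 => true
  | 2, 2 => ltB u v
  | 3, 2 => ltB u v
  | _, _ => false end.
have clP u : u \in W -> [\/ u \in A /\ cl u = 0, u \in R /\ cl u = 1,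
                            u \in B /\ cl u = 2 | u \in S /\ cl u = 3].
  move=> uW; rewrite /cl /R !inE uW.
  case uA: (u \in A); first by constructor 1.
  case uB: (u \in B); first by constructor 3.
  by case uS: (u \in S); [constructor 4 | constructor 2].
have inA a : a \in A -> a \in A :|: S by rewrite inE => ->.
have inB b : b \in B -> b \in B :|: S by rewrite inE => ->.
have inSA s : s \in S -> s \in A :|: S by rewrite inE orbC => ->.
have inSB s : s \in S -> s \in B :|: S by rewrite inE orbC => ->.
have clSA s s' : s \in S -> s' \in S -> ltA s s' = false.
  by move=> sS s'S; rewrite (orients_cadjF oA) ?inSA ?clS.
have clSB s s' : s \in S -> s' \in S -> ltB s s' = false.
  by move=> sS s'S; rewrite (orients_cadjF oB) ?inSB ?clS.
exists inc; split=> [u v w uW vW wW|u v uW vW].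
  rewrite /inc.
  have [] := clP u uW => -[uX ->]; have [] := clP v vW => -[vX ->];
  have [] := clP w wW => -[wX ->] //;
  try (by apply: oA.1; auto); try (by apply: oB.1; auto);
  try (by apply: oR.1; auto).
have [] := clP u uW => -[uX cu]; have [] := clP v vW => -[vX cv];
  rewrite /inc cu cv /= ?orbT ?orbF /=;
  try (by apply: oA.2; auto); try (by apply: oB.2; auto);
  try (by apply: oR.2; auto);
  try (by apply/negbTE; auto);
  try (by apply/negbTE; rewrite cadj_sym; auto);
  try (by rewrite /cadj RS // orbT); try (by rewrite cadj_sym /cadj RS // orbT);
  try (by rewrite clS // ?clSA ?clSB).
all: first
  [ rewrite (oA.2 u v); [|by auto|by auto] | rewrite (oB.2 u v); [|by auto|by auto] ].
all: by rewrite ?(negbTE (topA u v uX vX)) ?(negbTE (topA v u vX uX))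
                ?(negbTE (botB u v uX vX)) ?(negbTE (botB v u vX uX)) ?orbF.
Qed.

(** Without [w < t], the four vertices would span a chordless cycle [y v t w]. *)
Lemma orients_no_2plus2 W lt y t w v : links_closed G -> orients W lt ->
  y \in W -> t \in W -> w \in W -> v \in W ->
  lt y t -> lt w v -> cadj y v -> lt w t.
Proof.
move=> lc o yW tW wW vW yt wv yv; apply/negPn/negP => wt.
have tr := o.1; have cmp := o.2.
have F a b : a \in W -> b \in W -> lt a b -> cadj a b = false.
  by move=> aW bW ab; rewrite cmp // ab.
have yvF : lt y v = false by exact: orients_cadjF o _ _ yv.
have vyF : lt v y = false by apply: orients_cadjF o _ _ _; rewrite // cadj_sym.
have yw : cadj y w.
  rewrite cmp // negb_or; apply/andP; split; apply/negP => h.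
    by move: yvF; rewrite (tr y w v).
  by move/negP: wt; rewrite (tr w y t).
have wt' : cadj w t.
  rewrite cmp // (negbTE wt) /=; apply/negP => h.
  by move: yvF; rewrite (tr y t v) // (tr t w v).
have tv : cadj t v.
  rewrite cmp // negb_or; apply/andP; split; apply/negP => h.
    by move: yvF; rewrite (tr y t v).
  by move/negP: wt; rewrite (tr w v t).
have neA a b : cadj a b -> a != b -> adj a b.
  by rewrite /cadj => /orP [->|].
have yNv : y != v by apply: contraTneq wv => <-; rewrite (orients_cadjF o) // cadj_sym.
have yNw : y != w by apply: contraTneq yt => ->.
have tNv : t != v by apply: contraTneq yt => ->; rewrite yvF.
have wNt : w != t by apply: contraTneq wv => ->; rewrite (orients_cadjF o).
have tT : forall a, a \in [set t; v; w] -> [|| a == t, a == v | a == w].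
  by move=> a; rewrite !inE -orbA.
suff : cadj v w by rewrite cadj_sym (F w v).
apply: (lc y v w [set t; v; w] (neA _ _ yv yNv) (neA _ _ yw yNw)).
- by rewrite !inE eqxx orbT.
- apply: (@conn_trans _ _ t); apply: conn_adj; rewrite ?inE ?eqxx ?orbT //.
    by rewrite adj_sym neA.
  by rewrite adj_sym neA // eq_sym.
move=> a /tT /or3P [] /eqP -> ; rewrite ?eqxx // => _ _; split.
  by apply: contraTneq yt => ->; rewrite (orients_cadjF o) ?cadjxx.
by apply/negP => /adj_cadj; rewrite (F y t).
Qed.

(** Take [y] with the most vertices on its right, the interval that ends first. An
    interval [v] that meets [y] cannot begin after the end of another one, [w],
    which would then have more vertices on its right. *)
Lemma orients_first_end W lt : links_closed G -> W != set0 -> orients W lt ->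
  exists2 y, y \in W & forall v w, v \in W -> w \in W -> cadj y v -> ~~ lt w v.
Proof.
move=> lc /set0Pn [y0 y0W] o; pose succ y := [set v in W | lt y v].
case: (arg_maxnP (fun y => #|succ y|) y0W) => y yW ymax.
exists y => // v w vW wW yv; apply/negP => wv.
have [sub|/subsetPn [t]] := boolP (succ y \subset succ w).
  have /properP/proper_card : succ y \subset succ w /\
      exists2 x, x \in succ w & x \notin succ y.
    by split=> //; exists v; rewrite !inE vW //= (orients_cadjF o).
  by have := ymax w wW; lia.
rewrite !inE => /andP [tW yt]; rewrite tW /=.
by rewrite (orients_no_2plus2 lc o yW tW wW vW yt wv yv).
Qed.
End Orientations.

(* Arithmetic goals do not depend on the hypotheses about the graph. *)
Ltac graph_lia := repeat match goal with
  | H : context [@adj] |- _ => clear H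
  | H : context [@in_mem] |- _ => clear H
  | H : context [@conn] |- _ => clear H
  | H : context [@cadj] |- _ => clear H
  | H : context [@ipath] |- _ => clear H
  | H : context [@walk] |- _ => clear H
  | H : context [vertex] |- _ => clear H end; lia.

Section Separators.
Variables (G : sgraph) (W : {set G}).
Implicit Types (S T A B : {set G}) (lt : rel G) (u v w x y z s : G).
Hypothesis lc : links_closed G.

Definition component T x : {set G} := [set y in T | conn T x y].

Definition separates : pred {set G} := fun S =>
  (S \subset W) &&
  [exists u, exists v, [&& u \in W :\: S, v \in W :\: S & ~~ conn (W :\: S) u v]].

Lemma component_mem T x y : y \in component T x -> y \in T.
Proof. by rewrite inE => /andP []. Qed.

Lemma conn_component T x y : conn T x y -> conn (component T x) x y.
Proof.
move=> cxy.
have : y \in [set z | conn (component T x) x z].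
  apply: (conn_closed cxy); first by rewrite inE; exact: connect0.
  move=> u v; rewrite !inE => cu uT vT uv; apply: (conn_trans cu).
  have xu : conn T x u.
    by apply: sub_conn cu; apply/subsetP => z; rewrite inE => /andP [].
  apply: conn_adj; rewrite ?inE ?uT ?vT //.
  by apply: (conn_trans xu); exact: conn_adj.
by rewrite inE.
Qed.

Lemma component_conn T x y z : y \in component T x -> z \in component T x ->
  conn (component T x) y z.
Proof.
rewrite !inE => /andP [yT xy] /andP [zT xz].
by apply: conn_trans (conn_component xz); rewrite conn_sym; exact: conn_component.
Qed.

Lemma component_adj T x y z : y \in component T x -> z \in T -> adj y z -> z \in component T x.
Proof.
rewrite !inE => /andP [yT xy] zT yz; rewrite zT.
by apply: conn_trans xy _; exact: conn_adj.
Qed.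

Lemma minset_separates S : minset separates S ->
  [/\ S \subset W, exists2 u, u \in W :\: S & exists2 v, v \in W :\: S &
      ~~ conn (W :\: S) u v & forall s, s \in S -> ~~ separates (S :\ s)].
Proof.
case/minsetP => /andP [SW /existsP [u /existsP [v /and3P [uS vS uv]]]] minS.
split=> //; first by exists u => //; exists v.
move=> s sS; apply/negP => /minS/(_ (subsetDl _ _)) e.
by move: sS; rewrite -e !inE eqxx.
Qed.

Lemma separated_from S x : minset separates S -> x \in W :\: S ->
  exists2 y, y \in W :\: S & ~~ conn (W :\: S) x y.
Proof.
case/minset_separates => SW [u uS [v vS uv]] _ xS.
case xu : (conn (W :\: S) x u); last by exists u; rewrite ?xu.
exists v => //; apply: contraNN uv => xv.
by apply: (@conn_trans _ _ x) => //; rewrite conn_sym.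
Qed.

(** A vertex of a minimal separator without neighbours in some component could be
    left out. *)
Lemma separator_attached S x s : minset separates S -> x \in W :\: S -> s \in S ->
  exists2 c, c \in component (W :\: S) x & adj s c.
Proof.
move=> mS xS sS; have [y yS nxy] := separated_from mS xS.
have [SW _ minS] := minset_separates mS.
have [/exists_inP [c cx sc]|/exists_inPn nc] :=
  boolP [exists c in component (W :\: S) x, adj s c]; first by exists c.
case/negP: (minS s sS); apply/andP; split.
  by apply: subset_trans SW; exact: subsetDl.
have inT u : u \in W :\: S -> u \in W :\: (S :\ s).
  by rewrite !inE => /andP [/negbTE -> ->]; rewrite andbF.
apply/existsP; exists x; apply/existsP; exists y; rewrite !inT //=.
apply: contraNN nxy => cxy.
have xx : x \in component (W :\: S) x by rewrite inE xS; exact: connect0.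
have : y \in component (W :\: S) x.
  apply: (conn_closed cxy xx) => u v ux uT vT uv; apply: (component_adj ux _ uv).
  have vs : v != s by apply: contraNneq (nc u ux) => <-; rewrite adj_sym.
  by move: vT; rewrite !inE vs.
by rewrite inE => /andP [].
Qed.

(** An induced path from [s] to [s'] through a component leaves the neighbourhood of
    [s] after its first step. *)
Lemma separator_link S x s s' : minset separates S -> x \in W :\: S ->
  s \in S -> s' \in S -> ~~ cadj s s' ->
  exists c T, [/\ c \in component (W :\: S) x, adj s c, c \in T, conn T c s' &
    forall z, z \in T -> z != c -> ~~ cadj s z].
Proof.
move=> mS xS sS s'S nss; set C := component (W :\: S) x.
have [c cC sc] := separator_attached mS xS sS.
have [d dC sd] := separator_attached mS xS s'S.
pose T := s |: (s' |: C).
have CT z : z \in C -> z \in T by move=> h; rewrite !in_setU1 h !orbT.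
have sT : s \in T by rewrite !inE eqxx.
have s'T : s' \in T by rewrite !inE eqxx orbT.
have cT : conn T s s'.
  apply: (@conn_trans _ _ c); first by apply: conn_adj => //; exact: CT.
  apply: (@conn_trans _ _ d).
    by apply: sub_conn (component_conn cC dC); apply/subsetP => z; exact: CT.
  by apply: conn_adj => //; [exact: CT | rewrite adj_sym].
have [m [p [[p0 pm pT pA] [pI pE]]]] := conn_ipath sT cT.
have m2 : 1 < m.
  case: m p0 pm pI pA {pE pT} => [|[|m]] p0 pm pI pA //.
    by move: nss; rewrite -p0 -pm /cadj eqxx.
  by move: nss; rewrite -p0 -pm /cadj pA ?orbT.
have ps i : 0 < i <= m -> p i != s.
  by move=> im; rewrite -p0; apply/eqP => /pI h; have e : i = 0; [apply: h|]; graph_lia.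
have p1C : p 1 \in C.
  have := pT 1 (ltnW m2); rewrite !in_setU1 (negbTE (ps 1 _)) /=; last by graph_lia.
  case/orP => // /eqP e; move: (pI 1 m); rewrite pm -e => h.
  by have : 1 = m; [apply: h => //|]; graph_lia.
exists (p 1), [set p (i : 'I_m.+1) | i : 'I_m.+1 & 0 < i]; split=> //.
- by rewrite -p0; apply: pA; graph_lia.
- by apply/imsetP; exists (inord 1); rewrite ?inE inordK //; graph_lia.
- rewrite -pm; apply: walk_conn => [|t t_le|t t_le]; first by graph_lia.
    by apply/imsetP; exists (inord t); rewrite ?inE inordK //; graph_lia.
  by apply: pA; graph_lia.
move=> z /imsetP [i]; rewrite inE => i0 -> ne1; have im := ltn_ord i.
rewrite /cadj eq_sym (negbTE (ps i _)) /=; last by graph_lia.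
rewrite -p0 pE; try graph_lia.
by have : nat_of_ord i <> 1 by [move=> e; move: ne1; rewrite e eqxx]; graph_lia.
Qed.

(** Ways through two components link two neighbours of [s] outside its closed
    neighbourhood, although they lie in different components. *)
Lemma separator_clique S s s' :
  minset separates S -> s \in S -> s' \in S -> cadj s s'.
Proof.
move=> mS sS s'S; apply/negPn/negP => nss.
have [_ [u uS [v vS nuv]] _] := minset_separates mS.
have [c [T [cC sc cT ccs cout]]] := separator_link mS uS sS s'S nss.
have [d [T' [dC sd dT' cds dout]]] := separator_link mS vS sS s'S nss.
have : (c == d) || adj c d.
  apply: (lc (a := s) (T := T :|: T')) => //; first by rewrite inE cT.
    apply: (@conn_trans _ _ s'); first exact: sub_conn (subsetUl _ _) ccs.
    by rewrite conn_sym; exact: sub_conn (subsetUr _ _) cds.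
  move=> x; rewrite inE => xT xc xd.
  have : ~~ cadj s x by case/orP: xT => xT; [exact: cout | exact: dout].
  by rewrite negb_or eq_sym => /andP.
move=> cd; case/negP: nuv; move: cC dC; rewrite !inE => /andP [cS uc] /andP [dS vd].
apply: conn_trans uc _; rewrite conn_sym; apply: conn_trans vd _.
rewrite conn_sym; case/orP: cd => [/eqP ->|cd]; first exact: connect0.
by apply: conn_adj => //; rewrite !inE ?cS ?dS.
Qed.

(** A vertex [c] of the component with the most neighbours in [S] will do: if it
    misses [s], then the last vertex before [s] on an induced path from [c] to [s] is
    adjacent to all neighbours of [c] in [S], and to [s] in addition. *)
Lemma separator_complete S x : minset separates S -> x \in W :\: S ->
  exists2 c, c \in component (W :\: S) x & forall s, s \in S -> adj c s.
Proof.
move=> mS xS; set C := component (W :\: S) x.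
have xC : x \in C by rewrite inE xS; exact: connect0.
case: (arg_maxnP (fun c => #|[set s in S | adj c s]|) xC) => c cC cmax.
exists c => // s sS; apply/negPn/negP => ncs.
have notS z : z \in C -> z \notin S by rewrite !inE => /andP [/andP []].
have [d dC sd] := separator_attached mS xS sS.
pose T := s |: C.
have CT z : z \in C -> z \in T by move=> h; rewrite in_setU1 h orbT.
have sT : s \in T by rewrite !inE eqxx.
have cT : conn T c s.
  apply: (@conn_trans _ _ d).
    by apply: sub_conn (component_conn cC dC); apply/subsetP => z; exact: CT.
  by apply: conn_adj => //; [exact: CT | rewrite adj_sym].
have [m [p [[p0 pm pT pA] [pI pE]]]] := conn_ipath (CT c cC) cT.
have m2 : 1 < m.
  case: m p0 pm pI pA {pE pT} => [|[|m]] p0 pm pI pA //.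
    by move: (notS c cC); rewrite -p0 pm sS.
  by move: ncs; rewrite -p0 -pm pA.
have ps i : i < m -> p i != s.
  by move=> im; rewrite -pm; apply/eqP => /pI h; have e : i = m; [apply: h|]; graph_lia.
have pC i : i < m -> p i \in C.
  by move=> im; have := pT i (ltnW im); rewrite !inE (negbTE (ps i im)).
pose y := p m.-1.
have yC : y \in C by apply: pC; graph_lia.
have sy : adj s y by rewrite -pm pE; graph_lia.
have sub : [set t in S | adj c t] \subset [set t in S | adj y t].
  apply/subsetP => t; rewrite !inE => /andP [tS ct]; rewrite tS /=.
  have nts : t != s by apply: contraNneq ncs => <-.
  have st : adj s t.
    by have := separator_clique mS sS tS; rewrite /cadj eq_sym (negbTE nts).
  pose T' := t |: [set p (i : 'I_m) | i : 'I_m & true].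
  have pT' i : i < m -> p i \in T'.
    by move=> im; rewrite inE; apply/orP; right; apply/imsetP; exists (Ordinal im).
  have cT' : c \in T' by rewrite -p0; apply: pT'; graph_lia.
  have : (t == y) || adj t y.
    apply: (lc (a := s) (T := T')) => //; first by rewrite !inE eqxx.
      apply: (@conn_trans _ _ c).
        by apply: conn_adj => //; [exact: setU11 | rewrite adj_sym].
      rewrite -p0; apply: walk_conn => [|i i_le|i i_le] //.
        by apply: pT'; graph_lia.
      by apply: pA; graph_lia.
    move=> z; rewrite !inE => /orP [/eqP -> |]; first by rewrite eqxx.
    case/imsetP => i _ -> _ ne; have im := ltn_ord i; split; first exact: ps.
    have : nat_of_ord i <> m.-1 by move=> e; move: ne; rewrite e eqxx.
    by rewrite -pm pE; graph_lia.
  rewrite adj_sym; case/orP => // /eqP e; move: (notS y yC); by rewrite -e tS.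
have : s \in [set t in S | adj y t] by rewrite inE sS adj_sym.
have := cmax y yC => /= le_yc; have /eqP <- : [set t in S | adj c t] == [set t in S | adj y t].
  by rewrite eqEcard sub.
by rewrite inE (negbTE ncs) andbF.
Qed.
End Separators.

Section AsteroidalFree.
Variable G : sgraph.
Implicit Types (W S T A B : {set G}) (lt : rel G) (u v w x y z s : G).
Hypothesis lc : links_closed G.
Hypothesis noAT : forall x y z : G, ~ asteroidal x y z.

Section InductiveStep.
Variable W : {set G}.
Hypothesis IH : forall W', W' \proper W -> orientable W'.

(** [S] is the neighbourhood of [z], and separates [z] from a connected rest. *)
Definition cuts_off S z : Prop :=
  [/\ z \in W, forall w, w \in W -> adj z w = (w \in S) &
      forall u v, u \in W :&: outN z -> v \in W :&: outN z ->
        conn (W :&: outN z) u v].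

(** Let [z], in another component, be complete to [S]. In a layout of the component
    together with [S] and [z], the component lies on one side of [z], and all of [S]
    reaches over to [z]. Such a layout is available unless there are no further
    vertices, and then [S] cuts off [z]. *)
Lemma component_on_the_left S x : minset (separates W) S -> x \in W :\: S ->
  (forall z, ~ cuts_off S z) ->
  exists2 lt, orients (component (W :\: S) x :|: S) lt &
    forall s c, s \in S -> c \in component (W :\: S) x -> ~~ lt s c.
Proof.
move=> mS xS nogood; set C := component (W :\: S) x.
have [y yS nxy] := separated_from mS xS.
have [z zC zS] := separator_complete lc mS yS.
have [SW _ _] := minset_separates mS.
have CW c : c \in C -> c \in W :\: S by exact: component_mem.
have zWS : z \in W :\: S by move: zC; rewrite inE => /andP [].
have zNC : z \notin C.
  apply: contraNN nxy; move: zC; rewrite !in_set => /andP [_ yz] /andP [_ xz].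
  by apply: conn_trans xz _; rewrite conn_sym.
have zNS : z \notin S by move: zWS; rewrite inE => /andP [].
have cz c : c \in C -> cadj z c = false.
  move=> cC; apply/negbTE; apply: contraNN zNC => /orP [/eqP -> //|zc].
  by apply: (component_adj cC zWS); rewrite adj_sym.
pose W' := z |: (C :|: S).
have sub : W' \subset W.
  apply/subsetP => w; rewrite !in_setU in_set1 => /or3P [/eqP ->|/CW|].
  - by move: zWS; rewrite inE => /andP [].
  - by rewrite inE => /andP [].
  exact: (subsetP SW).
have xC : x \in C by rewrite inE xS; exact: connect0.
have [W'W|] := boolP (W' \proper W); last first.
  rewrite properE sub negbK => /subsetP WW'.
  case: (nogood z); split.
  - by apply: (subsetP sub); rewrite !in_setU in_set1 eqxx.
  - move=> w /WW'; rewrite !in_setU in_set1 => /or3P [/eqP ->|wC|wS].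
    + by rewrite adj_irr (negbTE zNS).
    + have := cz w wC; rewrite /cadj => /norP [_ /negbTE ->].
      by have := CW w wC; rewrite inE => /andP [/negbTE ->].
    by rewrite zS.
  have inC w : w \in W :&: outN z -> w \in C.
    rewrite in_setI [w \in outN z]in_set => /andP [/WW'].
    rewrite !in_setU in_set1.
    case/or3P => [/eqP ->|//|/zS zw]; first by rewrite cadjxx.
    by rewrite adj_cadj.
  move=> u v /inC uC /inC vC; apply: sub_conn (component_conn uC vC).
  apply/subsetP => c cC; rewrite in_setI [c \in outN z]in_set cz // andbT.
  by have := CW c cC; rewrite inE => /andP [].
have [lt o] := IH W'W.
have zW' : z \in W' by rewrite !in_setU in_set1 eqxx.
have CW' c : c \in C -> c \in W' by move=> h; rewrite !in_setU h orbT.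
have SW' s : s \in S -> s \in W' by move=> h; rewrite !in_setU h !orbT.
have subU : C :|: S \subset W' by apply/subsetP => w h; rewrite in_setU h orbT.
(* being connected and away from [z], the component lies on one side of [z] *)
have side lt' : orients W' lt' -> lt' x z -> forall s c, s \in S -> c \in C -> ~~ lt' s c.
  move=> o' xz.
  have allz c : c \in C -> lt' c z.
    move=> cC; have : c \in [set c in C | lt' c z].
      apply: (conn_closed (component_conn xC cC)); first by rewrite inE xC.
      move=> u v; rewrite inE => /andP [uC uz] _ vC uv; rewrite inE vC /=.
      have := o'.2 z v zW' (CW' v vC); rewrite (cz v vC).
      case: (boolP (lt' v z)) => //; rewrite orbF => _ /esym/negbFE zv.
      have := orients_cadjF o' (CW' u uC) (CW' v vC) (adj_cadj uv).
      by rewrite (o'.1 u z v); auto.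
    by rewrite inE => /andP [].
  move=> s c sS cC; apply/negP => sc.
  have := orients_cadjF o' (SW' s sS) zW'.
  rewrite (o'.1 s c z) ?allz //; auto.
  by rewrite cadj_sym adj_cadj ?zS // => /(_ isT).
have := o.2 z x zW' (CW' x xC); rewrite (cz x xC) => /esym/negbFE/orP [zx|xz].
  exists (fun u v => lt v u); first exact/(orients_sub subU)/orients_rev.
  by apply: (side (fun u v => lt v u)) => //; exact: orients_rev.
by exists lt; [exact: orients_sub o | exact: side].
Qed.

(** The way leads through the component of [x], the vertex [s] and the component of
    [y], none of which meets the closed neighbourhood of [z]. *)
Lemma avoids_through S x y z s : S \subset W ->
  x \in W :\: S -> y \in W :\: S -> z \in W :\: S -> minset (separates W) S ->
  ~~ conn (W :\: S) x z -> ~~ conn (W :\: S) y z -> s \in S -> ~~ adj z s ->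
  avoids z x y.
Proof.
move=> SW xS yS zS mS nxz nyz sS nzs.
have out w c : ~~ conn (W :\: S) w z -> c \in component (W :\: S) w -> c \in outN z.
  move=> nwz cC; rewrite inE; apply: contraNN nwz => zc.
  have : z \in component (W :\: S) w.
    case/orP: zc => [/eqP -> //|zc]; apply: (component_adj cC zS).
    by rewrite adj_sym.
  by rewrite inE => /andP [].
have sOut : s \in outN z.
  rewrite inE /cadj negb_or nzs andbT; apply: contraTneq zS => ->.
  by rewrite inE sS.
have xx w : w \in W :\: S -> w \in component (W :\: S) w.
  by move=> wS; rewrite inE wS; exact: connect0.
have to_s w : w \in W :\: S -> ~~ conn (W :\: S) w z -> conn (outN z) w s.
  move=> wS nwz; have [c cC sc] := separator_attached mS wS sS.
  apply: (@conn_trans _ _ c).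
    apply: sub_conn (component_conn (xx w wS) cC).
    by apply/subsetP => d; exact: out.
  by apply: conn_adj; rewrite ?(out w c) // adj_sym.
split; [exact: out (xx x xS) | exact: out (xx y yS) |].
by apply: conn_trans (to_s x xS nxz) _; rewrite conn_sym; exact: to_s.
Qed.

(** The two components that may be incomplete to [S] are put at the two ends; three
    of them would contain an asteroidal triple. *)
Lemma separator_dichotomy S : minset (separates W) S ->
  orientable W \/ exists z, cuts_off S z.
Proof.
move=> mS; have [?|nogood] := classic (exists z, cuts_off S z); first by right.
left; have [SW [u0 u0S _] _] := minset_separates mS.
have left_of x : x \in W :\: S -> _ := fun xS =>
  component_on_the_left mS xS (fun z h => nogood (ex_intro _ z h)).
pose inc := [set x in W :\: S | [exists s in S, ~~ adj x s]].
have incP x : x \in inc -> x \in W :\: S /\ exists2 s, s \in S & ~~ adj x s.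
  by rewrite inE => /andP [? /exists_inP [s sS xs]]; split=> //; exists s.
have [u1 u1S u1inc] : exists2 u1, u1 \in W :\: S & (inc != set0 -> u1 \in inc).
  case: (set_0Vmem inc) => [->|[u u_inc]]; first by exists u0; rewrite ?eqxx.
  by exists u; [case: (incP u u_inc) | ].
pose A := component (W :\: S) u1.
have [B BP] : exists B : {set G}, [\/ B = set0 /\ inc \subset A |
    exists2 u2, u2 \in inc :\: A & B = component (W :\: S) u2].
  case: (set_0Vmem (inc :\: A)) => [e|[u2 u2P]].
    by exists set0; left; split=> //; rewrite -setD_eq0 e.
  by exists (component (W :\: S) u2); right; exists u2.
have BS b : b \in B -> b \in W :\: S.
  by case: BP => [[-> _]|[u2 _ ->]]; [rewrite in_set0 | exact: component_mem].
have AS a : a \in A -> a \in W :\: S by exact: component_mem.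
have Acl a b : a \in A -> b \in W :\: S -> cadj a b -> b \in A.
  by move=> aA bS /orP [/eqP <- //|]; exact: component_adj.
have Bcl a b : a \in B -> b \in W :\: S -> cadj a b -> b \in B.
  case: BP => [[-> _]|[u2 _ ->]]; first by rewrite inE.
  by move=> aA bS /orP [/eqP <- //|]; exact: component_adj.
have dAB x : x \in A -> x \in B -> False.
  case: BP => [[-> _]|[u2 u2P ->]]; first by move=> _; rewrite in_set0.
  move: u2P; rewrite !in_set => /andP [n u2inc] /andP [xS ux] /andP [_ u2x].
  case/negP: n; apply/andP; split; first by case/andP: u2inc.
  by apply: conn_trans ux _; rewrite conn_sym.
have disjWS X : (forall x, x \in X -> x \in W :\: S) -> [disjoint X & S].
  move=> XS; apply/pred0P => x /=; apply/negP => /andP [/XS].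
  by rewrite inE => /andP [/negP].
have [ltA oA topA] := left_of u1 u1S.
have [ltB oB botB] : exists2 lt, orients (B :|: S) lt &
    forall s b, s \in S -> b \in B -> ~~ lt b s.
  case: BP => [[-> _]|[u2 u2P ->]].
    exists (fun _ _ => false) => //; split=> // x y.
    by rewrite !in_setU !in_set0 /= => xS yS; exact: separator_clique mS xS yS.
  have [|lt o top] := left_of u2; first by move: u2P; rewrite !inE => /and3P [].
  by exists (fun u v => lt v u); [exact: orients_rev | exact: top].
pose R := W :\: (A :|: B :|: S).
have RP r : r \in R -> [/\ r \in W :\: S, r \notin A & r \notin B].
  by rewrite !in_setD !in_setU !negb_or => /andP [/andP [/andP [-> ->] ->] ->].
have [ltR oR] : orientable R.
  apply: IH; apply/properP; split; first exact: subsetDl.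
  exists u1; first by move: u1S; rewrite inE => /andP [].
  by rewrite !in_setD !in_setU in_set u1S [conn _ _ _]connect0.
have RS r s : r \in R -> s \in S -> adj r s.
  move=> rR sS; apply/negPn/negP => nrs; have [rS rA rB] := RP r rR.
  have r_inc : r \in inc by rewrite inE rS; apply/exists_inP; exists s.
  case: BP => [[_ /subsetP/(_ r r_inc)]|[u2 u2P BE]]; first by rewrite (negbTE rA).
  have [u2A u2inc] : u2 \notin A /\ u2 \in inc.
    by move: u2P; rewrite in_setD => /andP [].
  have [u2S [s2 s2S ns2]] := incP u2 u2inc.
  have [|_ [s1 s1S ns1]] := incP u1; first by apply: u1inc; apply/set0Pn; exists r.
  have n12 : ~~ conn (W :\: S) u1 u2.
    by apply: contraNN u2A => h; rewrite inE u2S.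
  have n1r : ~~ conn (W :\: S) u1 r by apply: contraNN rA => h; rewrite inE rS.
  have n2r : ~~ conn (W :\: S) u2 r.
    by apply: contraNN rB => h; rewrite BE inE rS.
  apply: (noAT (x := u1) (y := u2) (z := r)); split.
  - exact: (avoids_through SW u1S u2S rS mS n1r n2r sS nrs).
  - by apply: (avoids_through SW u1S rS u2S mS n12 _ s2S ns2); rewrite conn_sym.
  by apply: (avoids_through SW u2S rS u1S mS _ _ s1S ns1); rewrite conn_sym.
apply: (orientable_glue (W := W) (S := S) (A := A) (B := B)
  (ltA := ltA) (ltB := ltB) (ltR := ltR)) => //.
- by apply/pred0P => x /=; apply/negP => /andP [/dAB].
- exact: disjWS.
- exact: disjWS.
- by move=> s s' sS s'S; exact: separator_clique mS sS s'S.
- by move=> a b aA bB; apply/negP => ab; case: (dAB b) => //; exact: Acl (BS b bB) ab.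
- move=> a r aA /RP [rS rA _]; by apply: contraNN rA; exact: Acl.
by move=> b r bB /RP [rS _ rB]; apply: contraNN rB; exact: Bcl.
Qed.

Lemma cut_off_nonadjacent S1 S2 z1 z2 :
  minset (separates W) S1 -> minset (separates W) S2 -> S1 != S2 ->
  cuts_off S1 z1 -> cuts_off S2 z2 -> ~~ cadj z1 z2.
Proof.
move=> m1 m2 ne [z1W a1 c1] [z2W a2 c2].
have [S1W [u uS [v vS nuv]] _] := minset_separates m1.
have [S2W _ _] := minset_separates m2.
apply/negP => /orP [/eqP e|z12].
  case/eqP: ne; apply/setP => w; case wW : (w \in W).
    by rewrite -a1 // e a2.
  by rewrite (contraFF (subsetP S1W w)) // (contraFF (subsetP S2W w)).
(* [z2] has a neighbour outside [S1], which must then be adjacent to [z1] *)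
have z2S1 : z2 \in S1 by rewrite -a1.
have z1S2 : z1 \in S2 by rewrite -a2 // adj_sym.
have [x xS xz] : exists2 x, x \in W :\: S1 & x != z1.
  have [e|?] := eqVneq u z1; last by exists u.
  exists v => //; apply: contraNneq nuv => ->; rewrite e; exact: connect0.
have [c cC z2c] := separator_attached m1 xS z2S1.
have cW : c \in W :\: S1 by move: cC; rewrite inE => /andP [].
have [cW' cS1] : c \in W /\ c \notin S1 by move: cW; rewrite inE => /andP [].
have cS2 : c \in S2 by rewrite -a2.
case/orP: (separator_clique lc m2 z1S2 cS2) => [/eqP e|].
  case/eqP: xz; apply/set1P.
  have xC : x \in component (W :\: S1) x by rewrite inE xS; exact: connect0.
  apply: (conn_closed (component_conn cC xC)); first by rewrite -e set11.
  move=> u' v' /set1P -> _ /component_mem; rewrite in_setD => /andP [vS1 vW].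
  rewrite a1 //.
  by rewrite (negbTE vS1).
by rewrite a1 // (negbTE cS1).
Qed.

(** Each of the three vertices leaves the rest connected, so that together they would
    form an asteroidal triple. *)
Lemma three_cut_off S1 S2 S3 z1 z2 z3 :
  minset (separates W) S1 -> minset (separates W) S2 -> minset (separates W) S3 ->
  cuts_off S1 z1 -> cuts_off S2 z2 -> cuts_off S3 z3 ->
  S1 != S2 -> (S3 == S1) || (S3 == S2).
Proof.
move=> m1 m2 m3 g1 g2 g3 n12; apply/negPn/negP; rewrite negb_or => /andP [n31 n32].
have n := cut_off_nonadjacent.
have a12 := n _ _ _ _ m1 m2 n12 g1 g2.
have a31 := n _ _ _ _ m3 m1 n31 g3 g1.
have a32 := n _ _ _ _ m3 m2 n32 g3 g2.
have av S z x y : cuts_off S z -> x \in W -> y \in W -> ~~ cadj z x -> ~~ cadj z y ->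
    avoids z x y.
  move=> [zW _ c] xW yW zx zy; split; rewrite ?inE //.
  apply: sub_conn (c x y _ _); first exact: subsetIr.
    by rewrite in_setI xW inE.
  by rewrite in_setI yW inE.
have [w1 _ _] := g1; have [w2 _ _] := g2; have [w3 _ _] := g3.
apply: (noAT (x := z1) (y := z2) (z := z3)); split.
- exact: av g3 w1 w2 a31 a32.
- by apply: av g2 w1 w3 _ _; rewrite cadj_sym.
by apply: av g1 w2 w3 _ _; rewrite // cadj_sym.
Qed.

Hypothesis not_orientable : ~ orientable W.

(** A universal vertex can be added to any layout as an interval that covers
    everything. *)
Lemma no_universal_vertex u : u \in W -> exists2 v, v \in W & ~~ cadj u v.
Proof.
move=> uW; apply/exists_inP; apply: contraT => /exists_inPn univ; exfalso.
have univ' v : v \in W -> cadj u v by move=> /univ; rewrite negbK.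
have [lt o] := IH (properD1 uW).
apply: not_orientable; exists (fun x y => [&& x != u, y != u & lt x y]).
have inW x : x \in W -> x != u -> x \in W :\ u by rewrite !inE => -> ->.
split=> [x y z xW yW zW|x y xW yW].
  move=> /and3P [xu yu xy] /and3P [_ zu yz] /=; rewrite xu zu.
  by apply: (o.1 x y z); auto.
case: (eqVneq x u) => [->|xu] /=; first by rewrite andbF univ'.
case: (eqVneq y u) => [->|yu] /=; first by rewrite cadj_sym univ'.
by apply: o.2; exact: inW.
Qed.

(** The neighbourhood of [u], which separates [u] from its non-neighbours, contains a
    minimal separator. *)
Lemma small_separator u : u \in W -> exists S z,
  [/\ minset (separates W) S, forall s, s \in S -> adj u s & cuts_off S z].
Proof.
move=> uW; have [v vW nuv] := no_universal_vertex uW.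
have : separates W [set s in W | adj u s].
  apply/andP; split; first by apply/subsetP => s; rewrite inE => /andP [].
  have nv : ~~ adj u v by apply: contraNN nuv => /adj_cadj.
  apply/existsP; exists u; apply/existsP; exists v.
  rewrite !inE uW vW adj_irr nv /=; apply/negP => cuv.
  have : v \in [set u].
    apply: (conn_closed cuv); first exact: set11.
    by move=> x y /set1P -> _; rewrite !inE => /andP [] /nandP [/negP|/negPf ->].
  by rewrite inE => /eqP e; move: nuv; rewrite e cadjxx.
case/minset_exists => S mS /subsetP SN.
case: (separator_dichotomy mS) => // -[z g]; exists S, z; split=> // s /SN.
by rewrite inE => /andP [].
Qed.

Lemma cut_off_attached S z : cuts_off S z -> S != set0.
Proof.
move=> [zW a _]; apply/negP => /eqP e.
have [lt o] := IH (properD1 zW).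
apply: not_orientable; apply: (orientable_add_top o) => s w.
by rewrite !inE => /andP [_ sW] _; rewrite a // e inE.
Qed.

(** Every minimal separator is one of two, [S1] and [S2], which cut off [z1] and [z2].
    In a layout of [W] without [z1], the interval that ends first is separated by a
    part of its neighbourhood; if this part is [S1], then [z1] can be put at this
    end. So [S2] reaches both ends of this layout and meets everything but [z1]. In
    a layout of [W] without [z2] the vertices of [S2] then have only [z1] on one
    side, and nothing on the other, where [z2] can be put. *)
Lemma orientable_step : False.
Proof.
have [W0|[x0 x0W]] := set_0Vmem W.
  by apply: not_orientable; exists (fun _ _ => false); split=> x ?; rewrite W0 inE.
have [S1 [z1 [m1 _ g1]]] := small_separator x0W.
have /set0Pn [s1 s1S1] := cut_off_attached g1.
have [S1W _ _] := minset_separates m1.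
have s1W : s1 \in W by exact: (subsetP S1W).
have [S2 [z2 [m2 S2s1 g2]]] := small_separator s1W.
have [S2W _ _] := minset_separates m2.
have n12 : S1 != S2.
  by apply/eqP => e; have := S2s1 s1; rewrite -e s1S1 adj_irr => /(_ isT).
have nz12 := cut_off_nonadjacent m1 m2 n12 g1 g2.
have [z1W a1 _] := g1; have [z2W a2 _] := g2.
have z1S2 : z1 \notin S2.
  by rewrite -a2 //; apply: contraNN nz12 => h; rewrite cadj_sym adj_cadj.
have z2S2 : z2 \notin S2 by rewrite -a2 // adj_irr.
have z12 : z1 != z2 by apply: contraNneq nz12 => ->; exact: cadjxx.
pose H := W :\ z1.
have inH w : w \in W -> w != z1 -> w \in H by rewrite !inE => -> ->.
have HW w : w \in H -> w \in W by rewrite inE => /andP [].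
have S2H s : s \in S2 -> s \in H.
  move=> sS; apply: inH; first exact: (subsetP S2W).
  by apply: contraNneq z1S2 => <-.
have H0 : H != set0 by apply/set0Pn; exists z2; apply: inH; rewrite // eq_sym.
have S2_left lt s w : orients H lt -> s \in S2 -> w \in H -> ~~ lt w s.
  move=> o sS wH; have [y yH ymin] := orients_first_end lc H0 o.
  have [T [z [mT Ty gT]]] := small_separator (HW y yH).
  have inTmin t : t \in T -> t != z1 -> t \in H /\ forall w, w \in H -> ~~ lt w t.
    move=> tT tz1; have [TW _ _] := minset_separates mT.
    have tH := inH t (subsetP TW t tT) tz1.
    split=> // v vH; apply: (ymin t v) => //.
    by apply/adj_cadj/Ty.
  case/orP: (three_cut_off m1 m2 mT g1 g2 gT n12) => /eqP TE.
    exfalso; apply: not_orientable; apply: (orientable_add_bottom o) => t v tH vH.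
    have tz1 : t != z1 by move: tH; rewrite in_setD1 => /andP [].
    rewrite a1; last exact: HW.
    by rewrite -TE => tT; case: (inTmin t tT tz1) => _; apply.
  have sz1 : s != z1 by move: (S2H s sS); rewrite in_setD1 => /andP [].
  have sT : s \in T by rewrite TE.
  by case: (inTmin s sT sz1) => _; apply.
have [lt o] : orientable H by apply: IH; exact: properD1.
have S2_univ s w : s \in S2 -> w \in H -> cadj s w.
  move=> sS wH; rewrite o.2 //; last exact: S2H.
  by rewrite negb_or (S2_left _ _ _ (orients_rev o)) // (S2_left lt).
have S2z1 s : s \in S2 -> ~~ cadj s z1.
  move=> sS; have [v vW nsv] := no_universal_vertex (subsetP S2W s sS).
  by have [<- //|vz] := eqVneq v z1; rewrite S2_univ // inH in nsv.
pose K := W :\ z2.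
have [lt2 o2] : orientable K by apply: IH; exact: properD1.
have z1K : z1 \in K by rewrite !inE z12.
have S2K s : s \in S2 -> s \in K.
  move=> sS; rewrite in_setD1 (subsetP S2W) // andbT.
  by apply: contraNneq z2S2 => <-.
have /set0Pn [s0 s0S] := cut_off_attached g2.
have last_step lt' : orients K lt' -> lt' z1 s0 -> False.
  move=> o' zs0; apply: not_orientable; apply: (orientable_add_top o') => s w sK wK.
  have sW : s \in W by move: sK; rewrite inE => /andP [].
  rewrite a2 // => sS; apply/negP => sw.
  have zs : lt' z1 s.
    have := o'.2 s z1 (S2K s sS) z1K; rewrite (negbTE (S2z1 s sS)).
    move/esym/negbFE/orP => [sz|//].
    have := orients_cadjF o' (S2K s sS) (S2K s0 s0S) (separator_clique lc m2 sS s0S).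
    by rewrite (o'.1 s z1 s0) // S2K.
  have [we|wz] := eqVneq w z1.
    by have := orients_asym o' z1K (S2K s sS) zs; rewrite -we sw.
  have wH : w \in H by apply: inH => //; move: wK; rewrite inE => /andP [].
  by have := orients_cadjF o' (S2K s sS) wK (S2_univ s w sS wH); rewrite sw.
have := o2.2 s0 z1 (S2K s0 s0S) z1K; rewrite (negbTE (S2z1 s0 s0S)).
move/esym/negbFE/orP => [sz|zs]; last exact: last_step o2 zs.
exact: (last_step (fun u v => lt2 v u) (orients_rev o2) sz).
Qed.
End InductiveStep.

Theorem asteroidal_free_orientable W : orientable W.
Proof.
have [n] := ubnP #|W|; elim: n W => // n IHn W Wn.
apply: NNPP => nW; apply: (orientable_step _ nW) => W' /proper_card W'W.
by apply: IHn; lia.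
Qed.
End AsteroidalFree.

(** * Asteroidal triples in chordal graphs *)

(* Evaluating the comparisons one at a time keeps the proof terms small: [lia] alone makes a case
   distinction on every comparison of the relation. *)
Ltac decide_nat := repeat match goal with
  | |- context [leq ?a ?b] => first
      [ rewrite (_ : leq a b = true); [|graph_lia] | rewrite (_ : leq a b = false); [|graph_lia] ]
  | |- context [?a == ?b] => first
      [ rewrite (_ : (a == b) = true); [|graph_lia] | rewrite (_ : (a == b) = false);
        [|graph_lia] ]
  end; rewrite ?(andbT, andbF, orbT, orbF) //=.

(** The relation behind [LB_two_hubs k]: the induced path [p x_1 .. x_k q] is [0 .. k.+1], and
    [l], [r], [t] are [k.+2], [k.+3], [k.+4]. *)
Definition two_hubs_rel k : rel nat := fun i j =>
  [|| (i.+1 == j) && (j <= k.+1),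
      (i == k.+2) && (j == k.+3),
      (i == k.+2) && (j <= k),
      (i == k.+3) && (1 <= j <= k.+1) |
      (i == k.+4) && ((j == k.+2) || (j == k.+3))].

(** For [i < j] the larger vertex [j] tells which clauses can hold. *)
Lemma two_hubs_relE k i j : i < j -> two_hubs_rel k i j || two_hubs_rel k j i =
  [|| (j <= k.+1) && (i.+1 == j), (j == k.+2) && (i <= k),
      (j == k.+3) && ((1 <= i <= k.+1) || (i == k.+2)) |
      (j == k.+4) && ((i == k.+2) || (i == k.+3))].
Proof.
rewrite /two_hubs_rel => ij; have [jk|kj] := leqP j k.+1; first by decide_nat.
case: (j =P k.+2) => [e|j2]; first by subst j; decide_nat.
case: (j =P k.+3) => [e|j3]; first by subst j; decide_nat; case: (i =P k.+2); lia.
decide_nat; by case: (j =P k.+4).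
Qed.

Section AsteroidalTriples.
Variable G : sgraph.
Implicit Types (T : {set G}) (p q r : nat -> G) (a b c d x y z : G).
Hypothesis lc : links_closed G.

Definition contains_LB : Prop := exists2 H, LB_obstructions H & embeds H G.

(** The vertices [p i], .., [p j] of a walk, where [i <= j]. *)
Definition seg p i j : {set G} := [set p (k : 'I_j.+1) | k : 'I_j.+1 & i <= k].

Lemma mem_seg p i j k : i <= k <= j -> p k \in seg p i j.
Proof.
move=> /andP [ik kj]; have kj' : k < j.+1 by [].
by apply/imsetP; exists (Ordinal kj'); rewrite ?inE.
Qed.

Lemma segP p i j x : x \in seg p i j -> exists2 k, i <= k <= j & x = p k.
Proof.
by case/imsetP => k; rewrite inE => ik ->; exists k; rewrite // ik -ltnS ltn_ord.
Qed.

Lemma seg_conn p i j k l m : ipath m p -> i <= k <= j -> i <= l <= j -> j <= m ->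
  conn (seg p i j) (p k) (p l).
Proof.
move=> [_ pA]; wlog kl : k l / k <= l => [W kij lij jm|].
  by have [kl|lk] := leqP k l; [exact: W | rewrite conn_sym; apply: W => //; exact: ltnW].
move=> kij lij jm; apply: walk_conn => // [t t_le|t t_le]; first by apply: mem_seg; graph_lia.
by rewrite pA ?eqxx //; graph_lia.
Qed.

Lemma linked a u v T : adj a u -> adj a v -> u \in T -> conn T u v ->
  (forall x, x \in T -> x != u -> x != v -> ~~ cadj a x) -> cadj u v.
Proof.
move=> au av uT uv out; apply: (lc au av uT uv) => x xT xu xv.
by have := out x xT xu xv; rewrite negb_or eq_sym => /andP.
Qed.

(** The last neighbour of [c] before a gap and the first one after it would be
    linked outside the closed neighbourhood of [c]. *)
Lemma ipath_contiguous m p c i t j : ipath m p -> (forall k, k <= m -> p k != c) ->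
  i <= t <= j -> j <= m -> adj c (p i) -> adj c (p j) -> adj c (p t).
Proof.
move=> ip pc itj jm ci cj; have [pI pA] := ip; apply/negPn/negP => nct.
have [i' /andP [i't ci'] i'max] : exists2 i', (i' <= t) && adj c (p i') &
    forall k, (k <= t) && adj c (p k) -> k <= i'.
  have ex : exists k, (k <= t) && adj c (p k) by exists i; rewrite ci; graph_lia.
  have ub k : (k <= t) && adj c (p k) -> k <= t by case/andP.
  by case: (ex_maxnP ex ub) => i' ? ?; exists i'.
have [j' /andP [tj' cj'] j'min] : exists2 j', (t <= j') && adj c (p j') &
    forall k, (t <= k) && adj c (p k) -> j' <= k.
  have ex : exists k, (t <= k) && adj c (p k) by exists j; rewrite cj; graph_lia.
  by case: (ex_minnP ex) => j' ? ?; exists j'.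
have j'j : j' <= j by apply: j'min; rewrite cj; graph_lia.
have ti' : t <> i' by move=> e; rewrite e ci' in nct.
have tj'' : t <> j' by move=> e; rewrite e cj' in nct.
have : cadj (p i') (p j').
  apply: (linked (T := seg p i' j') ci' cj').
  - by apply: mem_seg; graph_lia.
  - by apply: (seg_conn ip); graph_lia.
  move=> x /segP [k kij ->] ki kj.
  have ki' : k <> i' by move=> e; rewrite e eqxx in ki.
  have kj' : k <> j' by move=> e; rewrite e eqxx in kj.
  rewrite /cadj eq_sym (negbTE (pc k _)) /=; last by graph_lia.
  apply/negP => ck; have [kt|tk] := leqP k t.
    by have := i'max k; rewrite kt ck => /(_ isT); graph_lia.
  by have := j'min k; rewrite (ltnW tk) ck => /(_ isT); graph_lia.
case/orP => [/eqP/pI h|]; first by have : i' = j'; [apply: h|]; graph_lia.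
by rewrite pA; graph_lia.
Qed.

(** The neighbours of the hub [c] on the path, together with the vertices before and
    after them, form the path of the obstruction, and [d] is its pendant vertex. *)
Lemma hub_LB m p c d i j : ipath m p -> adj c d ->
  (forall t, t <= m -> p t \in outN d) -> ~~ adj c (p 0) -> ~~ adj c (p m) ->
  i < j -> j <= m -> adj c (p i) -> adj c (p j) -> contains_LB.
Proof.
move=> ip cd pd nc0 ncm ij jm ci cj; have [pI pA] := ip.
have pd' t : t <= m -> p t != d /\ adj (p t) d = false.
  by move=> /pd; rewrite inE negb_or eq_sym adj_sym => /andP [-> /negbTE].
have pc t : t <= m -> p t != c.
  by move=> /pd' [_ h]; apply/eqP => e; move: h; rewrite e cd.
have ctg := ipath_contiguous ip pc.
have [al /andP [alm cal] almin] : exists2 k, (k <= m) && adj c (p k) &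
    forall t, (t <= m) && adj c (p t) -> k <= t.
  have ex : exists k, (k <= m) && adj c (p k) by exists i; rewrite ci; graph_lia.
  by case: (ex_minnP ex) => k ? ?; exists k.
have [be /andP [bem cbe] bemax] : exists2 k, (k <= m) && adj c (p k) &
    forall t, (t <= m) && adj c (p t) -> t <= k.
  have ex : exists k, (k <= m) && adj c (p k) by exists i; rewrite ci; graph_lia.
  have ub k : (k <= m) && adj c (p k) -> k <= m by case/andP.
  by case: (ex_maxnP ex ub) => k ? ?; exists k.
have al0 : al <> 0 by move=> e; rewrite -e cal in nc0.
have bem' : be <> m by move=> e; rewrite -e cbe in ncm.
have ali : al <= i by apply: almin; rewrite ci; graph_lia.
have jbe : j <= be by apply: bemax; rewrite cj; graph_lia.
have cE t : t <= m -> adj c (p t) = (al <= t <= be).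
  move=> tm; apply/idP/idP => [ct|tab]; last exact: (ctg al t be).
  by rewrite almin ?bemax // ct tm.
pose k := (be - al).+1.
exists (LB_one_hub k); first by right; left; exists k => //; rewrite /k; graph_lia.
apply: (@embeds_graph_on _ _ G (fun t => if t <= k.+1 then p (al.-1 + t) else
  if t == k.+2 then c else d)).
move=> s t st tk; case: (leqP t k.+1) => tk1.
  have -> : s <= k.+1 by graph_lia.
  split; first by apply/eqP => /pI h; have : al.-1 + s = al.-1 + t;
    [apply: h; rewrite /k in tk1; graph_lia | graph_lia].
  rewrite pA; [|by rewrite /k in tk1; graph_lia|by rewrite /k in tk1; graph_lia].
  graph_lia.
case: (eqVneq t k.+2) => tk2.
  have sk : s <= k.+1 by graph_lia.
  rewrite sk; split; first by apply: pc; rewrite /k in sk; graph_lia.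
  rewrite adj_sym cE; rewrite /k in sk tk2 tk1 *; graph_lia.
have tk3 : t = k.+3 by graph_lia.
case: (leqP s k.+1) => sk.
  have [|ne ->] := pd' (al.-1 + s); first by rewrite /k in sk; graph_lia.
  by split=> //; graph_lia.
have -> : s = k.+2 by graph_lia.
rewrite eqxx cd; split; first exact: adj_neq.
graph_lia.
Qed.

(** Paths that witness an asteroidal triple: [p] from [x1] to [x2], and [q] and [r]
    from [x3] to [x1] and to [x2]. *)
Definition triple_paths m p n q l r x1 x2 x3 : Prop :=
  [/\ walk (outN x3) m p x1 x2 /\ ipath m p,
      walk (outN x2) n q x3 x1 /\ ipath n q &
      walk (outN x1) l r x3 x2 /\ ipath l r].

Lemma triple_paths_swap m p n q l r x1 x2 x3 :
  triple_paths m p n q l r x1 x2 x3 ->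
  triple_paths m (fun i => p (m - i)) l r n q x2 x1 x3.
Proof.
move=> [[wp ip] [wq iq] [wr ir]]; split=> //; split; [exact: walk_rev|exact: ipath_rev].
Qed.

Lemma triple_paths_rotate m p n q l r x1 x2 x3 :
  triple_paths m p n q l r x1 x2 x3 ->
  triple_paths n q l (fun i => r (l - i)) m (fun i => p (m - i)) x3 x1 x2.
Proof.
move=> [[wp ip] [wq iq] [wr ir]].
by split=> //; split; try exact: walk_rev; exact: ipath_rev.
Qed.

Section Triple.
Variables (m n l : nat) (p q r : nat -> G) (x1 x2 x3 : G).
Hypothesis tp : triple_paths m p n q l r x1 x2 x3.
Let a := q 1.
Let b := r 1.

Lemma triple_distinct :
  [/\ ~~ cadj x1 x2, ~~ cadj x1 x3 & ~~ cadj x2 x3].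
Proof.
have [[[p0 pm pT _] _] [[q0 qn qT _] _] _] := tp.
split.
- by have := qT n (leqnn _); rewrite qn inE cadj_sym.
- by have := pT 0 (leq0n _); rewrite p0 inE cadj_sym.
by have := pT m (leqnn _); rewrite pm inE cadj_sym.
Qed.

Lemma triple_lengths : [/\ 1 < m, 1 < n & 1 < l].
Proof.
have [n12 n13 n23] := triple_distinct.
have len T k (s : nat -> G) u v : walk T k s u v -> ~~ cadj u v -> 1 < k.
  case: k => [|[|k]] // [s0 s1 _ sA]; rewrite -s0 -s1; first by rewrite cadjxx.
  by rewrite adj_cadj // sA.
have [[wp _] [wq _] [wr _]] := tp.
by split; [apply: len wp _ | apply: len wq _ | apply: len wr _]; rewrite // cadj_sym.
Qed.

Lemma triple_first : [/\ adj x3 a, adj x3 b, ~~ cadj a x2 & ~~ cadj b x1].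
Proof.
have [[wp _] [[q0 _ qT qA] _] [[r0 _ rT rA] _]] := tp.
have [_ n1 l1] := triple_lengths.
split; [by rewrite -q0 qA // ltnW | by rewrite -r0 rA // ltnW | |].
  by have := qT 1 (ltnW n1); rewrite inE cadj_sym.
by have := rT 1 (ltnW l1); rewrite inE cadj_sym.
Qed.

Lemma triple_off_path c t : adj x3 c -> t <= m -> p t != c.
Proof.
have [[[_ _ pT _] _] _ _] := tp.
move=> xc /pT; rewrite inE; apply: contraNneq => ->; exact: adj_cadj.
Qed.

Lemma ipath_cadj0 k (s : nat -> G) i j : ipath k s -> j <= k -> i.+1 < j ->
  ~~ cadj (s i) (s j).
Proof.
move=> [sI sA] jk ij; rewrite /cadj sA; [|graph_lia|graph_lia].
have -> : (s i == s j) = false.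
  by apply/eqP => /sI h; have : i = j; [apply: h|]; graph_lia.
by graph_lia.
Qed.

(** Both are neighbours of [x3], linked along [q], [p] and the reverse of [r]. *)
Lemma triple_first_cadj : cadj a b.
Proof.
have [[[p0 pm pT pA] ip] [[q0 qn qT _] iq] [[r0 rl rT _] ir]] := tp.
have [m1 n1 l1] := triple_lengths; have [xa xb _ _] := triple_first.
apply: (linked (a := x3) (T := seg q 1 n :|: (seg p 0 m :|: seg r 1 l))) => //.
- by rewrite inE mem_seg //; graph_lia.
- apply: (@conn_trans _ _ x1).
    apply: (sub_conn (T := seg q 1 n)); first exact: subsetUl.
    by rewrite -qn; apply: (seg_conn iq); graph_lia.
  apply: (@conn_trans _ _ x2).
    apply: (sub_conn (T := seg p 0 m)); first by rewrite setUCA subsetUl.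
    by rewrite -p0 -pm; apply: (seg_conn ip); graph_lia.
  apply: (sub_conn (T := seg r 1 l)); first by rewrite setUA subsetUr.
  by rewrite -rl; apply: (seg_conn ir); graph_lia.
move=> x; rewrite !in_setU => /or3P [] /segP [k kn ->] ne1 ne2.
- have k1 : k <> 1 by move=> e; rewrite e eqxx in ne1.
  by rewrite -q0; apply: (ipath_cadj0 iq); graph_lia.
- by have := pT k; rewrite inE; apply; graph_lia.
have k1 : k <> 1 by move=> e; rewrite e eqxx in ne2.
by rewrite -r0; apply: (ipath_cadj0 ir); graph_lia.
Qed.

(** The neighbours of [a] are a beginning of the path, those of [b] an end of it, and
    the two overlap, for otherwise there would be a chordless cycle. *)
Lemma triple_two_hubs : adj a x1 -> adj b x2 -> contains_LB.
Proof.
have [[[p0 pm pT pA] ip] _ _] := tp; have [pI pE] := ip.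
have [xa xb na2 nb1] := triple_first; have cab := triple_first_cadj.
have offa t := triple_off_path (t := t) xa; have offb t := triple_off_path (t := t) xb.
move=> ax1 bx2.
have ab : adj a b by case/orP: cab => // /eqP e; rewrite -e adj_cadj in nb1.
have [be /andP [bem abe] bemax] : exists2 k, (k <= m) && adj a (p k) &
    forall t, (t <= m) && adj a (p t) -> t <= k.
  have ex : exists k, (k <= m) && adj a (p k) by exists 0; rewrite p0 ax1.
  have ub k : (k <= m) && adj a (p k) -> k <= m by case/andP.
  by case: (ex_maxnP ex ub) => k ? ?; exists k.
have [al /andP [alm bal] almin] : exists2 k, (k <= m) && adj b (p k) &
    forall t, (t <= m) && adj b (p t) -> k <= t.
  have ex : exists k, (k <= m) && adj b (p k) by exists m; rewrite pm bx2 leqnn.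
  by case: (ex_minnP ex) => k ? ?; exists k.
have aE t : t <= m -> adj a (p t) = (t <= be).
  move=> tm; apply/idP/idP => [ct|tbe]; first by apply: bemax; rewrite tm.
  by apply: (ipath_contiguous (i := 0) (j := be) ip offa); rewrite ?p0.
have bE t : t <= m -> adj b (p t) = (al <= t).
  move=> tm; apply/idP/idP => [ct|tal]; first by apply: almin; rewrite tm.
  by apply: (ipath_contiguous (i := al) (j := m) ip offb); rewrite ?pm // tal tm.
have bem' : be <> m.
  by move=> e; case/negP: na2; rewrite -pm -e adj_cadj.
have al0 : al <> 0.
  by move=> e; case/negP: nb1; rewrite -p0 -e adj_cadj.
have albe : al <= be.
  rewrite leqNgt; apply/negP => lt.
  have : cadj (p be) b.
    apply: (linked (a := a) (T := b |: seg p be al)) => //.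
    - by rewrite in_setU1 mem_seg ?orbT //; graph_lia.
    - apply: (@conn_trans _ _ (p al)).
        apply: (sub_conn (T := seg p be al)); first exact: subsetUr.
        by apply: (seg_conn ip); graph_lia.
      apply: conn_adj; [|exact: setU11|by rewrite adj_sym].
      by rewrite in_setU1 mem_seg ?orbT //; graph_lia.
    move=> x; rewrite in_setU1 => /orP [/eqP ->|/segP [k kab ->]].
      by rewrite eqxx.
    move=> kbe _; have kbe' : k <> be by move=> e; rewrite e eqxx in kbe.
    rewrite /cadj eq_sym (negbTE (offa k _)) /= ?aE //; graph_lia.
  by rewrite /cadj (negbTE (offb be _)) // adj_sym bE //=; graph_lia.
pose k := (be - al).+1.
exists (LB_two_hubs k); first by right; right; exists k.
have x3E t : t <= m -> p t != x3 /\ adj (p t) x3 = false.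
  by move=> /pT; rewrite inE negb_or eq_sym adj_sym => /andP [-> /negbTE].
apply: (@embeds_graph_on _ (two_hubs_rel k) G (fun t => if t <= k.+1 then p (al.-1 + t) else
  if t == k.+2 then a else if t == k.+3 then b else x3)).
have kE : k.+1 = (be - al).+2 by [].
clearbody k => s t st tk; rewrite two_hubs_relE //; case: (leqP t k.+1) => tk1.
  have -> : s <= k.+1 by graph_lia.
  split; first by apply/eqP => /pI h; have : al.-1 + s = al.-1 + t; [apply: h|]; graph_lia.
  rewrite pE; [|graph_lia|graph_lia]; rewrite -addnS eqn_add2l.
  by decide_nat.
have neb : a != b by exact: adj_neq.
case: (eqVneq t k.+2) => tk2.
  have sk : s <= k.+1 by graph_lia.
  rewrite sk; split; first by apply: offa; graph_lia.
  by rewrite adj_sym aE; [decide_nat; graph_lia|graph_lia].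
case: (eqVneq t k.+3) => tk3.
  case: (leqP s k.+1) => sk.
    split; first by apply: offb; graph_lia.
    by rewrite adj_sym bE; [decide_nat; graph_lia|graph_lia].
  have -> : s = k.+2 by graph_lia.
  by rewrite eqxx ab; split=> //; decide_nat.
have tk4 : t = k.+4 by graph_lia.
case: (leqP s k.+1) => sk.
  have [|ne ->] := x3E (al.-1 + s); first by graph_lia.
  by split=> //; decide_nat.
have ne c : adj x3 c -> c != x3 by move=> h; rewrite eq_sym adj_neq.
case: (eqVneq s k.+2) => sk2.
  by rewrite ne // adj_sym xa; split=> //; decide_nat.
case: (eqVneq s k.+3) => sk3; last by graph_lia.
by rewrite ne // adj_sym xb; split=> //; decide_nat.
Qed.

(** The centre of the claw is [p i]. *)
Lemma triple_claw c i : adj x3 c -> 1 < i -> i.+2 <= m ->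
  (forall t, t <= m -> adj c (p t) = (t == i)) -> contains_LB.
Proof.
have [[[_ _ pT _] ip] _ _] := tp; have [pI pE] := ip.
move=> xc i1 im cE.
have offc t := triple_off_path (t := t) xc.
have x3E t : t <= m -> p t != x3 /\ adj (p t) x3 = false.
  by move=> /pT; rewrite inE negb_or eq_sym adj_sym => /andP [-> /negbTE].
pose s := [:: p i; p i.-1; p i.+1; c; p i.-2; p i.+2; x3].
exists subdivided_claw; first by left; left.
have pne u v : u <= m -> v <= m -> (u == v) = false -> p u != p v.
  by move=> um vm; apply: contraFneq => /pI ->.
have cx3 : c != x3 by rewrite eq_sym adj_neq.
have cE' t : t <= m -> adj (p t) c = (t == i) by move=> tm; rewrite adj_sym cE.
have neC t : t <= m -> c != p t by move=> tm; rewrite eq_sym offc.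
apply: (@embeds_graph_on _ _ G (nth x3 s)) => u v uv v7.
case: v uv v7 => [|[|[|[|[|[|[|v]]]]]]] //; case: u => [|[|[|[|[|[|u]]]]]] //= _ _;
split; try (by apply: pne; graph_lia); try (by apply: offc; graph_lia);
try (by apply: neC; graph_lia); try (by apply: (x3E _ _).1; graph_lia); try exact: cx3;
rewrite ?inE ?xpair_eqE /= 1?(adj_sym x3) ?xc //;
try (by rewrite pE; graph_lia); try (by rewrite cE; graph_lia); try (by rewrite cE'; graph_lia);
try (by rewrite (x3E _ _).2; graph_lia); try (by rewrite adj_sym xc).
Qed.

(** Two neighbours of [c] on the path make it a hub. A single one is the centre of a
    subdivided claw, unless it is too close to an end of the path. *)
Lemma triple_neutral c : adj x3 c -> ~~ adj c x1 -> ~~ adj c x2 ->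
  [\/ contains_LB, forall t, t <= m -> ~~ adj c (p t),
      forall t, t <= m -> adj c (p t) = (t == 1) |
      forall t, t <= m -> adj c (p t) = (t == m.-1)].
Proof.
have [[[p0 pm pT _] ip] _ _] := tp => xc nc1 nc2.
have [[i [im ci]]|none] := classic (exists i, i <= m /\ adj c (p i)); last first.
  by constructor 2 => t tm; apply/negP => ct; case: none; exists t.
have [[j [jm ij cj]]|uniq] :=
    classic (exists j, [/\ j <= m, i <> j & adj c (p j)]).
  constructor 1; rewrite adj_sym in xc.
  rewrite -p0 in nc1; rewrite -pm in nc2.
  have [lt|lt|//] := ltngtP i j.
    exact: (hub_LB ip xc pT nc1 nc2 lt).
  exact: (hub_LB ip xc pT nc1 nc2 lt).
have cE t : t <= m -> adj c (p t) = (t == i).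
  move=> tm; have [->|ti] := eqVneq t i; first exact: ci.
  by apply/negP => ct; case: uniq; exists t; split=> // e; rewrite e eqxx in ti.
have i0 : i <> 0 by move=> e; rewrite -p0 -e ci in nc1.
have im' : i <> m by move=> e; rewrite -pm -e ci in nc2.
have [i1|i1] := eqVneq i 1; first by constructor 3; rewrite -i1.
have [i2|i2] := eqVneq i m.-1; first by constructor 4; rewrite -i2.
by constructor 1; apply: (triple_claw xc _ _ cE); graph_lia.
Qed.

(** The cycle along [p] and [q] through [a] shows that the vertex after [a] on [q] is
    adjacent to [p m.-1], which is therefore a hub of the path [q], with pendant
    vertex [x2]. *)
Lemma triple_last_but_one : 2 < m ->
  (forall t, t <= m -> adj a (p t) = (t == m.-1)) -> contains_LB.
Proof.
have [[[p0 pm pT pA] ip] [[q0 qn qT qA] iq] _] := tp; have [pI pE] := ip.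
have [xa _ _ _] := triple_first; have [_ n1 _] := triple_lengths.
move=> m3 aE; have offa t := triple_off_path (t := t) xa.
have am : adj a (p m.-1) by rewrite aE ?eqxx //; graph_lia.
have n2 : 2 < n.
  have n2' : n <> 2.
    move=> e; have : adj a (p 0) by rewrite p0 -qn e qA // e.
    by rewrite aE //; graph_lia.
  graph_lia.
have pmx : adj (p m.-1) x2 by rewrite -pm pE; graph_lia.
have : cadj (q 2) (p m.-1).
  apply: (linked (a := a) (T := seg q 2 n :|: seg p 0 m.-1)) => //.
  - by rewrite qA // ltnW.
  - by rewrite inE mem_seg //; graph_lia.
  - apply: (@conn_trans _ _ x1).
      apply: (sub_conn (T := seg q 2 n)); first exact: subsetUl.
      by rewrite -qn; apply: (seg_conn iq); graph_lia.
    apply: (sub_conn (T := seg p 0 m.-1)); first exact: subsetUr.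
    by rewrite -p0; apply: (seg_conn ip); graph_lia.
  move=> x; rewrite in_setU => /orP [] /segP [k kn ->] ne1 ne2.
    have k2 : k <> 2 by move=> e; rewrite e eqxx in ne1.
    by apply: (ipath_cadj0 iq); graph_lia.
  have km : k <> m.-1 by move=> e; rewrite e eqxx in ne2.
  rewrite /cadj eq_sym (negbTE (offa k _)) ?aE /=; graph_lia.
case/orP => [/eqP e|q2p].
  by have := qT 2 (ltnW n2); rewrite e inE cadj_sym adj_cadj.
apply: (hub_LB (i := 1) (j := 2) iq pmx) => //; try by rewrite adj_sym.
- by rewrite q0 adj_sym; have := pT m.-1; rewrite inE negb_or leq_pred => /(_ isT)/andP [].
by rewrite qn -p0 pE; graph_lia.
Qed.

(** By chordality [b] sees all of the path but [x1]. The umbrella consists of the path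
    [x3], [a], [p 1], [p 2], [p 3], of [b] and of [x1]. *)
Lemma triple_umbrella : 2 < m -> adj b x2 ->
  (forall t, t <= m -> adj a (p t) = (t == 1)) -> contains_LB.
Proof.
have [[[p0 pm pT pA] ip] _ _] := tp; have [pI pE] := ip.
have [xa xb na2 nb1] := triple_first; have cab := triple_first_cadj.
have offa t := triple_off_path (t := t) xa; have offb t := triple_off_path (t := t) xb.
move=> m3 bx2 aE.
have ab : adj a b.
  by case/orP: cab => // /eqP e; rewrite e adj_cadj // in na2.
have [al /andP [alm bal] almin] : exists2 k, (k <= m) && adj b (p k) &
    forall t, (t <= m) && adj b (p t) -> k <= t.
  have ex : exists k, (k <= m) && adj b (p k) by exists m; rewrite pm bx2 leqnn.
  by case: (ex_minnP ex) => k ? ?; exists k.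
have al0 : al <> 0 by move=> e; case/negP: nb1; rewrite -p0 -e adj_cadj.
have al1 : al = 1.
  have : cadj a (p al).
    apply: (linked (a := b) (T := a |: seg p 1 al)) => //.
    - by rewrite adj_sym.
    - exact: setU11.
    - apply: (@conn_trans _ _ (p 1)).
        apply: conn_adj; [exact: setU11 | | by rewrite aE //; graph_lia].
        by rewrite in_setU1 mem_seg ?orbT //; graph_lia.
      apply: (sub_conn (T := seg p 1 al)); first exact: subsetUr.
      by apply: (seg_conn ip); graph_lia.
    move=> x; rewrite in_setU1 => /orP [/eqP ->|/segP [k kab ->]].
      by rewrite eqxx.
    move=> _ kal; have kal' : k <> al by move=> e; rewrite e eqxx in kal.
    have km : k <= m by graph_lia.
    rewrite /cadj eq_sym (negbTE (offb k km)) /=; apply/negP => bk.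
    have : al <= k by apply: almin; rewrite km.
    graph_lia.
  case/orP => [/eqP e|]; first by have := offa al alm; rewrite e eqxx.
  by rewrite aE // => /eqP.
rewrite al1 in bal.
have bE t : 0 < t <= m -> adj b (p t).
  move=> tm; apply: (ipath_contiguous (i := 1) (j := m) ip offb) => //.
  by rewrite pm.
have b0 : adj b (p 0) = false.
  by apply/negbTE; apply: contraNN nb1; rewrite p0; exact: adj_cadj.
have x3E t : t <= m -> x3 != p t /\ adj x3 (p t) = false.
  by move=> /pT; rewrite inE negb_or => /andP [-> /negbTE].
exists umbrella; first by left; right; left.
have pne u v : u <= m -> v <= m -> (u == v) = false -> p u != p v.
  by move=> um vm; apply: contraFneq => /pI ->.
have nea t : t <= m -> a != p t by move=> tm; rewrite eq_sym offa.
have aE' t : t <= m -> adj (p t) a = (t == 1) by move=> tm; rewrite adj_sym aE.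
have bE' t : 0 < t <= m -> adj (p t) b by move=> tm; rewrite adj_sym bE.
have nexa : x3 != a by exact: adj_neq.
have nexb : x3 != b by exact: adj_neq.
have neab : a != b by exact: adj_neq.
have neb t : t <= m -> b != p t by move=> tm; rewrite eq_sym offb.
apply: (@embeds_graph_on _ _ G (nth x3 [:: x3; a; p 1; p 2; p 3; b; p 0])) => u v uv v7.
case: v uv v7 => [|[|[|[|[|[|[|v]]]]]]] //; case: u => [|[|[|[|[|[|u]]]]]] //= _ _;
split; try (by []); try (by apply: pne; graph_lia); try (by apply: offb; graph_lia);
try (by apply: nea; graph_lia); try (by apply: neb; graph_lia); try (by apply: (x3E _ _).1;
  graph_lia);
rewrite ?inE ?xpair_eqE /= ?xa ?xb ?ab ?b0 //;
try (by rewrite pE; graph_lia); try (by rewrite aE; graph_lia);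
try (by rewrite bE' //; graph_lia); try (by rewrite (x3E _ _).2; graph_lia).
Qed.
End Triple.

(** If [a] has no neighbour on the path from [x1] to [x2], then it can replace [x3],
    which shortens [q] without making [r] longer. *)
Lemma triple_shrink m n l p q r x1 x2 x3 :
  triple_paths m p n q l r x1 x2 x3 ->
  (forall t, t <= m -> ~~ adj (q 1) (p t)) ->
  exists n' q' l' r', n' + l' < n + l /\
    triple_paths m p n' q' l' r' x1 x2 (q 1).
Proof.
move=> tp nap; have [[[p0 pm pT pA] ip] [[q0 qn qT qA] iq] [[r0 rl rT rA] ir]] := tp.
have [m1 n1 l1] := triple_lengths tp; have [xa xb na2 nb1] := triple_first tp.
have offa t := triple_off_path tp (t := t) xa.
have aOut t : t <= m -> p t \in outN (q 1).
  by move=> tm; rewrite inE negb_or nap // eq_sym offa.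
have ax1 : q 1 \in outN x1.
  by have := aOut 0 (leq0n _); rewrite p0 !inE cadj_sym.
have wq : walk (outN x2) n.-1 (fun i => q (1 + i)) (q 1) x1.
  split=> //; first by rewrite -qn; congr q; graph_lia.
    by move=> i i_le; apply: qT; graph_lia.
  by move=> i i_lt; rewrite addnS; apply: qA; graph_lia.
have [l' [r' [l'l wr' ir']]] :
  exists l' r', [/\ l' <= l, walk (outN x1) l' r' (q 1) x2 & ipath l' r'].
  have [l0 [r0' [l0l wr]]] : exists l0 r0', l0 <= l /\ walk (outN x1) l0 r0' (q 1) x2.
    case/orP: (triple_first_cadj tp) => [/eqP e|ab].
      exists l.-1, (fun i => r (1 + i)); split; first by graph_lia.
      split; first by rewrite e.
      - by rewrite -rl; congr r; graph_lia.
      - by move=> i i_le; apply: rT; graph_lia.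
      by move=> i i_lt; rewrite addnS; apply: rA; graph_lia.
    exists l, (fun i => if i == 0 then q 1 else r i); split=> //; split=> //.
    - by case: eqP => // e; rewrite e in l1.
    - by move=> i i_le; case: eqP => // _; exact: rT.
    by case=> [|i] i_lt //=; exact: rA.
  have [l' [r' [h w' i']]] := walk_ipath wr.
  by exists l', r'; split=> //; exact: leq_trans h l0l.
exists n.-1, (fun i => q (1 + i)), l', r'; split; first by graph_lia.
split=> //; split=> //.
by apply: (ipath_sub iq); graph_lia.
Qed.

(** Take the three paths with smallest total length, and [p] of length at least three
    if one of them is that long. If [a] and [b] see the ends of [p], they are the two
    hubs of an obstruction. Otherwise, by symmetry, [a] sees neither end. By
    [triple_shrink] it sees some vertex of [p], and by [triple_neutral] only the
    second vertex or the last but one. The latter is [triple_last_but_one]; in the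
    former case, either [b] sees [x2] and there is an umbrella, or [b] is subject to
    the same alternatives, of which the last leaves a chordless cycle. *)
Theorem asteroidal_LB x1 x2 x3 : asteroidal x1 x2 x3 -> contains_LB.
Proof.
move=> [[x1o x2o c12] [x1o' x3o c13] [x2o' x3o' c23]].
have [m [p [wp ip]]] := conn_ipath x1o c12.
have [n [q [wq iq]]] := conn_ipath x3o (etrans (conn_sym _ _ _) c13).
have [l [r [wr ir]]] := conn_ipath x3o' (etrans (conn_sym _ _ _) c23).
have tp : triple_paths m p n q l r x1 x2 x3 by [].
have [N] := ubnP (m + n + l).
move: tp; clear -lc; elim: N m n l p q r x1 x2 x3 => // N IH m n l p q r x1 x2 x3 tp lN.
wlog m3 : m n l p q r x1 x2 x3 tp lN / 2 < m \/ [/\ m = 2, n = 2 & l = 2].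
  move=> W; have [m1 n1 l1] := triple_lengths tp.
  have [m3|m3] := ltnP 2 m; first by apply: (W _ _ _ _ _ _ _ _ _ tp) => //; left.
  have [n3|n3] := ltnP 2 n.
    by apply: (W _ _ _ _ _ _ _ _ _ (triple_paths_rotate tp)); [graph_lia | left].
  have [l3|l3] := ltnP 2 l; last first.
    by apply: (W _ _ _ _ _ _ _ _ _ tp) => //; right; split; graph_lia.
  apply: (W _ _ _ _ _ _ _ _ _ (triple_paths_rotate (triple_paths_rotate tp))).
    by graph_lia.
  by left.
wlog na1 : m n l p q r x1 x2 x3 tp lN m3 /
    (adj (q 1) x1 /\ adj (r 1) x2) \/ ~~ adj (q 1) x1.
  move=> W; have [ax1|nax1] := boolP (adj (q 1) x1); last first.
    by apply: (W _ _ _ _ _ _ _ _ _ tp) => //; right.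
  have [bx2|nbx2] := boolP (adj (r 1) x2).
    by apply: (W _ _ _ _ _ _ _ _ _ tp) => //; left.
  apply: (W _ _ _ _ _ _ _ _ _ (triple_paths_swap tp)); [graph_lia | | by right].
  by case: m3 => [m3|[em en el]]; [left | right].
case: na1 => [[ax1 bx2]|nax1]; first exact: (triple_two_hubs tp).
have [xa xb na2 nb1] := triple_first tp.
case: m3 => [m3|[_ en _]]; last first.
  have [_ [[_ qn _ qA] _] _] := tp; case/negP: nax1.
  by rewrite -qn en; apply: qA; rewrite en.
have nadj (u v : G) : ~~ cadj u v -> ~~ adj u v by apply: contraNN; exact: adj_cadj.
have shrink m' p' n' q' l' r' y1 y2 y3 : triple_paths m' p' n' q' l' r' y1 y2 y3 ->
    m' + n' + l' < N.+1 -> (forall t, t <= m' -> ~~ adj (q' 1) (p' t)) -> contains_LB.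
  move=> tp' lN' /(triple_shrink tp') [n2 [q2 [l2 [r2 [lt tp2]]]]].
  by apply: (IH _ _ _ _ _ _ _ _ _ tp2); graph_lia.
have [//|none|first|last] := triple_neutral tp xa nax1 (nadj _ _ na2).
- exact: shrink tp lN none.
- have [bx2|nbx2] := boolP (adj (r 1) x2); first exact: (triple_umbrella tp).
  have tps := triple_paths_swap tp.
  have [//|none|first'|last'] := triple_neutral tp xb (nadj _ _ nb1) nbx2.
  + by apply: (shrink _ _ _ _ _ _ _ _ _ tps); [graph_lia | move=> t tm; apply: none; graph_lia].
  + apply: (triple_last_but_one tps) => // t tm.
    by rewrite first'; graph_lia.
  (* [a], [b] and the path between the vertices they see form a chordless cycle *)
  exfalso; have [[[_ _ pT pA] ip] _ _] := tp.
  have offa t := triple_off_path tp (t := t) xa.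
  have offb t := triple_off_path tp (t := t) xb.
  have ab : adj (q 1) (r 1).
    case/orP: (triple_first_cadj tp) => // /eqP e.
    by have := first 1; rewrite e last'; graph_lia.
  have : cadj (q 1) (p m.-1).
    apply: (linked (a := r 1) (T := q 1 |: seg p 1 m.-1)).
    - by rewrite adj_sym.
    - by rewrite last' ?eqxx //; graph_lia.
    - exact: setU11.
    - apply: (@conn_trans _ _ (p 1)).
        apply: conn_adj; [exact: setU11 | | by rewrite first //; graph_lia].
        by rewrite in_setU1 mem_seg ?orbT //; graph_lia.
      apply: (sub_conn (T := seg p 1 m.-1)); first exact: subsetUr.
      by apply: (seg_conn ip); graph_lia.
    move=> x; rewrite in_setU1 => /orP [/eqP ->|/segP [k kab ->]].
      by rewrite eqxx.
    move=> _ km; have km' : k <> m.-1 by move=> e; rewrite e eqxx in km.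
    by rewrite /cadj eq_sym (negbTE (offb k _)) ?last' /=; graph_lia.
  rewrite /cadj eq_sym (negbTE (offa _ _)) /= ?first; graph_lia.
exact: (triple_last_but_one tp).
Qed.
End AsteroidalTriples.

(** * Interval models *)

Lemma conn_ind (G : sgraph) (T : {set G}) (P : G -> Prop) x y :
  conn T x y -> P x ->
  (forall u v, P u -> u \in T -> v \in T -> adj u v -> P v) -> P y.
Proof.
case/connectP => s; elim: s x => [|z s IH] x /=; first by move=> _ ->.
case/andP => /and3P [xz xT zT] zs yE Px step.
by apply: (IH z zs yE) => //; exact: (step x z).
Qed.

Section ConvexModels.
Variables (disp : Order.disp_t) (T : orderType disp) (G : sgraph).
Variable I : G -> T -> Prop.
Import Order.Theory.
Local Open Scope order_scope.

Definition convex_family : Prop :=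
  forall u x y z, I u x -> I u z -> x <= y -> y <= z -> I u y.

Hypothesis cvx : convex_family.
Hypothesis adj_meet : forall u v, adj u v -> exists2 x, I u x & I v x.

(** A way from [a] to [c] that avoids [b] stays on one side of each point of [b], so
    that no point of [b] lies between points of [a] and [c]. Twins are allowed to
    meet, so that the statement applies to the preimage of a model under a full
    homomorphism. *)
Lemma convex_no_asteroidal :
  (forall u v x, u != v -> I u x -> I v x ->
     adj u v \/ forall w, adj u w = adj v w) ->
  forall a b c : G, ~ asteroidal a b c.
Proof.
move=> meet_adj.
have nbr (a b c : G) : avoids b a c -> a != c -> exists2 a', a' \in outN b & adj a a'.
  move=> [aO cO ac] ne.
  pose P d := d = a \/ exists2 a', a' \in outN b & adj a a'.
  have : P c.
    apply: (conn_ind ac); first by left.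
    by move=> u v [->|ex] _ vO uv; right; [exists v | exact: ex].
  by case=> // e; rewrite e eqxx in ne.
have nomeet w w' b x : w \in outN b -> w' \in outN b -> adj w w' ->
    I w x -> I b x -> False.
  move=> wO w'O ww' wx bx; move: wO w'O; rewrite !inE !negb_or.
  move=> /andP [bw nbw] /andP [_ nbw']; rewrite eq_sym in bw.
  case: (meet_adj w b x bw wx bx) => [wb|tw]; first by rewrite adj_sym wb in nbw.
  by rewrite -tw ww' in nbw'.
have side (a b c : G) xa xb xc : avoids b a c -> a != c -> I a xa -> I b xb -> I c xc ->
    [/\ xa != xb, xa < xb -> xc < xb & xb < xa -> xb < xc].
  move=> av ne axa bxb cxc; have [a' a'O aa'] := nbr _ _ _ av ne.
  have [aO cO ac] := av; split=> [|lt|lt].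
  - by apply/eqP => e; apply: (nomeet _ _ _ _ aO a'O aa' axa); rewrite e.
  - pose P d := (exists2 d', d' \in outN b & adj d d') /\ forall y, I d y -> y < xb.
    have [_] : P c; last by apply.
    apply: (conn_ind ac).
      split; first by exists a'.
      move=> y ay; rewrite ltNge; apply/negP => le.
      exact: (nomeet _ _ _ _ aO a'O aa' (cvx axa ay (ltW lt) le) bxb).
    move=> u v [_ ult] uO vO uv; have vu : adj v u by rewrite adj_sym.
    split; first by exists u.
    have [z uz vz] := adj_meet uv.
    move=> y vy; rewrite ltNge; apply/negP => le.
    exact: (nomeet _ _ _ _ vO uO vu (cvx vz vy (ltW (ult z uz)) le) bxb).
  pose P d := (exists2 d', d' \in outN b & adj d d') /\ forall y, I d y -> xb < y.
  have [_] : P c; last by apply.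
  apply: (conn_ind ac).
    split; first by exists a'.
    move=> y ay; rewrite ltNge; apply/negP => le.
    exact: (nomeet _ _ _ _ aO a'O aa' (cvx ay axa le (ltW lt)) bxb).
  move=> u v [_ ult] uO vO uv; have vu : adj v u by rewrite adj_sym.
  split; first by exists u.
  have [z uz vz] := adj_meet uv.
  move=> y vy; rewrite ltNge; apply/negP => le.
  exact: (nomeet _ _ _ _ vO uO vu (cvx vy vz le (ltW (ult z uz))) bxb).
move=> a b c [av_c av_b av_a].
have out (u v w : G) : avoids w u v -> u != w.
  by case=> uO _ _; move: uO; rewrite inE negb_or eq_sym => /andP [].
have avC (u v w : G) : avoids w u v -> avoids w v u.
  by case=> ? ? ?; split=> //; rewrite conn_sym.
have ac := out _ _ _ av_c; have ab := out _ _ _ av_b.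
have bc := out _ _ _ (avC _ _ _ av_c).
have [a' a'O aa'] := nbr _ _ _ av_c ab; have [xa axa _] := adj_meet aa'.
have [b' b'O bb'] := nbr _ _ _ av_a bc; have [xb bxb _] := adj_meet bb'.
have ca : c != a by rewrite eq_sym.
have [c' c'O cc'] := nbr _ _ _ (avC _ _ _ av_b) ca; have [xc cxc _] := adj_meet cc'.
(* one of the three points lies between the other two *)
have [nab ltab gtab] := side _ _ _ _ _ _ av_b ac axa bxb cxc.
have [nac ltac gtac] := side _ _ _ _ _ _ av_c ab axa cxc bxb.
have [nba ltba gtba] := side _ _ _ _ _ _ av_a bc bxb axa cxc.
case: (ltgtP xa xb) nab => // hab _.
  have cb := ltab hab; have bc' := ltac (gtba hab).
  by have := lt_trans cb bc'; rewrite ltxx.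
have bc' := gtab hab; have cb := gtac (ltba hab).
by have := lt_trans cb bc'; rewrite ltxx.
Qed.

(** A way from [u] to [v] outside the neighbourhood of [a] would have to stay on
    one side of the interval of [a] and to jump over it. *)
Lemma convex_links_closed :
  (forall u v x, u != v -> I u x -> I v x -> adj u v) -> links_closed G.
Proof.
move=> meet_adj; apply: NNPP => nlc.
have {nlc} [a [u [v [S [au av uS [cuv out nuv]]]]]] : exists a u v (S : {set G}),
    [/\ adj a u, adj a v, u \in S & [/\ conn S u v,
      (forall x, x \in S -> x != u -> x != v -> x != a /\ ~~ adj a x) &
      ~~ ((u == v) || adj u v)]].
  apply: NNPP => nex; apply: nlc => a u v S au av uS cuv out.
  by apply/negPn/negP => n; apply: nex; exists a, u, v, S.
have [pu apu upu] := adj_meet au; have [pv apv vpv] := adj_meet av.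
have vS := conn_mem uS cuv.
wlog lt : u v pu pv au av uS vS cuv out nuv apu upu apv vpv / pu < pv.
  move=> W; case: (ltgtP pu pv) => [lt|lt|e]; first by apply: (W u v pu pv).
    apply: (W v u pv pu) => //; first by rewrite conn_sym.
      by move=> x xS xv xu; exact: out.
    by rewrite eq_sym adj_sym.
  case/norP: nuv => neq /negP; apply; apply: (meet_adj u v pu) => //.
  by rewrite e.
case/norP: nuv => neq nadj.
have right_v y : I v y -> pu < y.
  move=> vy; rewrite ltNge; apply/negP => le; case/negP: nadj.
  exact: (meet_adj u v pu neq upu (cvx vy vpv le (ltW lt))).
have left_u y : I u y -> y < pv.
  move=> uy; rewrite ltNge; apply/negP => le; case/negP: nadj.
  exact: (meet_adj u v pv neq (cvx upu uy (ltW lt) le) vpv).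
have inner x y : x \in S -> x != u -> x != v -> I x y -> pu <= y -> y <= pv -> False.
  move=> xS xu xv xy le1 le2; have [xa /negP] := out x xS xu xv; apply.
  by rewrite adj_sym; apply: (meet_adj x a y xa xy); exact: (cvx apu apv le1 le2).
pose P w := w = u \/ [/\ w \in S, w != u, w != v & forall y, I w y -> y < pu].
have : P v; last by case=> [e|[_ _ /eqP //]]; rewrite e eqxx in neq.
apply: (conn_ind cuv); first by left.
move=> w x Pw wS xS wx; have [-> |xu] := eqVneq x u; first by left.
have [z wz xz] := adj_meet wx.
have zlt : z < pu \/ (w = u /\ z < pv).
  by case: Pw => [e|[_ _ _]]; [right; split; rewrite // left_u // -e | left; auto].
have xv : x != v.
  apply/eqP => e; case: zlt => [zlt|[e' _]]; last first.
    by case/negP: nadj; rewrite -e -e'.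
  by have := lt_trans zlt (right_v z _); rewrite -e ltxx => /(_ xz).
have zpu : z < pu.
  case: zlt => // -[_ zpv]; rewrite ltNge; apply/negP => le.
  exact: (inner x z xS xu xv xz le (ltW zpv)).
right; split=> // y xy; rewrite ltNge; apply/negP => le.
exact: (inner x pu xS xu xv (cvx xz xy (ltW zpu) le) (lexx _) (ltW lt)).
Qed.
End ConvexModels.

Definition nat_interval (G : sgraph) : Prop :=
  exists l r : G -> nat, (forall u, l u <= r u) /\
    forall u v, u != v -> adj u v = (l u <= r v) && (l v <= r u).

Lemma nat_interval_hereditary : hereditary nat_interval.
Proof.
move=> G H [f fI fA] [l [r [lr A]]]; exists (l \o f), (r \o f); split=> [u|u v uv].
  exact: lr.
by rewrite -fA A // (inj_eq fI).
Qed.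

Lemma nat_interval_model G : nat_interval G -> exists I : G -> nat -> Prop,
  [/\ convex_family I, forall u v, adj u v -> exists2 x, I u x & I v x &
      forall u v x, u != v -> I u x -> I v x -> adj u v].
Proof.
move=> [l [r [lr A]]]; exists (fun u x => l u <= x <= r u); split.
- move=> u x y z; rewrite !leEnat => /andP [lx _] /andP [_ zr] xy yz.
  by rewrite (leq_trans lx xy) (leq_trans yz zr).
- move=> u v uv; move: (uv); rewrite A ?adj_neq // => /andP [uv' vu].
  by exists (maxn (l u) (l v)); have := lr u; have := lr v; lia.
by move=> u v x uv ux vx; rewrite A //; lia.
Qed.

Lemma nat_interval_links_closed G : nat_interval G -> links_closed G.
Proof. by case/nat_interval_model => I [c m a]; exact: convex_links_closed c m a. Qed.

Lemma nat_interval_chordal G : nat_interval G -> chordal G.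
Proof. by move/nat_interval_links_closed; exact: links_closed_chordal. Qed.

Lemma nat_interval_no_asteroidal G :
  nat_interval G -> forall a b c : G, ~ asteroidal a b c.
Proof.
case/nat_interval_model => I [cv m A]; apply: (convex_no_asteroidal cv m).
by move=> u v x uv ux vx; left; exact: A ux vx.
Qed.

(** The left end point of an interval is the number of intervals before it, and its
    right end point is the largest left end point of an interval it meets. *)
Lemma orientable_nat_interval G :
  links_closed G -> orientable [set: G] -> nat_interval G.
Proof.
move=> lc [lt o]; pose l u := #|[set w | lt w u]|.
pose r u := \max_(w | cadj u w) l w.
have T u : u \in [set: G] by rewrite inE.
have lr u v : cadj u v -> l v <= r u by move=> uv; exact: leq_bigmax_cond.
have sep u v : lt u v -> r u < l v.
  move=> uv; have pos : 0 < l v by apply/card_gt0P; exists u; rewrite inE.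
  rewrite -(prednK pos) ltnS; apply/bigmax_leqP => w uw.
  rewrite -ltnS (prednK pos); apply/proper_card/properP; split.
    apply/subsetP => t; rewrite !inE => tw.
    exact: (orients_no_2plus2 lc o (T u) (T v) (T t) (T w) uv tw uw).
  by exists u; rewrite !inE // (orients_cadjF o).
exists l, r; split=> [u|u v uv]; first exact/lr/cadjxx.
have := o.2 u v (T u) (T v); rewrite /cadj (negbTE uv) /= => ->.
apply/idP/idP => [nlt|].
  have cuv : cadj u v by rewrite (o.2 u v).
  by rewrite !lr // cadj_sym.
move=> /andP [luv lvu]; apply/norP; split; apply/negP => /sep; lia.
Qed.

(** The theorem of Lekkerkerker and Boland. *)
Theorem chordal_nat_interval_or_LB G :
  chordal G -> nat_interval G \/ contains_LB G.
Proof.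
move=> /chordal_links_closed lc.
have [|nLB] := classic (contains_LB G); first by right.
left; apply: orientable_nat_interval => //.
apply: asteroidal_free_orientable => // x y z /(asteroidal_LB lc).
exact: nLB.
Qed.

Section RealIntervals.
Import Order.TTheory GRing.Theory Num.Theory.
Variable R : realType.

Lemma itv_convex (i : interval R) (x y z : R) :
  x \in i -> z \in i -> (x <= y)%R -> (y <= z)%R -> y \in i.
Proof.
case: i => [[[] a|[]] [[] b|[]]]; rewrite !in_itv /= ?andbT ?andbF //.
- by move=> /andP [ax _] /andP [_ zb] xy yz; rewrite (le_trans ax xy) (le_lt_trans yz zb).
- by move=> /andP [ax _] /andP [_ zb] xy yz; rewrite (le_trans ax xy) (le_trans yz zb).
- by move=> ax _ xy _; exact: le_trans ax xy.
- by move=> /andP [ax _] /andP [_ zb] xy yz; rewrite (lt_le_trans ax xy) (le_lt_trans yz zb).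
- by move=> /andP [ax _] /andP [_ zb] xy yz; rewrite (lt_le_trans ax xy) (le_trans yz zb).
- by move=> ax _ xy _; exact: lt_le_trans ax xy.
- by move=> _ zb _ yz; exact: le_lt_trans yz zb.
by move=> _ zb _ yz; exact: le_trans yz zb.
Qed.

Lemma nat_interval_interval_graph G : nat_interval G -> interval_graph R G.
Proof.
move=> [l [r [lr A]]]; exists (fun u => `[((l u)%:R : R), (r u)%:R]%R) => u v uv.
rewrite A //; split=> [/andP [uv' vu]|[x []]]; last first.
  rewrite !in_itv /= => /andP [lu ur] /andP [lv vr].
  by rewrite -!(ler_nat R) (le_trans lu vr) (le_trans lv ur).
exists (maxn (l u) (l v))%:R%R; rewrite !in_itv /= !ler_nat.
by have := lr u; have := lr v; lia.
Qed.

Lemma interval_graph_hereditary : hereditary (interval_graph R).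
Proof.
move=> G H [f fI fA] [I IA]; exists (I \o f) => u v uv.
by rewrite -fA; apply: IA; rewrite (inj_eq fI).
Qed.

Lemma interval_graph_chordal G : interval_graph R G -> chordal G.
Proof.
move=> [I IA]; apply: links_closed_chordal.
apply: (@convex_links_closed _ R G (fun u x => x \in I u)).
- by move=> u x y z; exact: itv_convex.
- by move=> u v uv; have [x [ux vx]] := (IA u v (adj_neq uv)).1 uv; exists x.
by move=> u v x uv ux vx; apply/IA => //; exists x.
Qed.

Lemma asteroidal_not_colourable (G : sgraph) (a b c : G) :
  asteroidal a b c -> ~ fully_colourable (interval_graph R) G.
Proof.
move=> ast [H [I IA] [f /full_homE fA]]; move: a b c ast.
apply: (@convex_no_asteroidal _ R G (fun u x => x \in I (f u))).
- by move=> u x y z; exact: itv_convex.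
- move=> u v; rewrite -fA => uv.
  by have [x [ux vx]] := (IA _ _ (adj_neq uv)).1 uv; exists x.
move=> u v x uv ux vx; have [e|ne] := eqVneq (f u) (f v).
  by right=> w; rewrite -!fA e.
by left; rewrite -fA; apply/IA => //; exists x.
Qed.
End RealIntervals.

(** * Deciding properties of explicit finite graphs *)

Section Finite.
Implicit Types (n m : nat) (r s : rel nat) (t L : seq nat).

Definition erel r : rel nat := fun i j => (i != j) && (r i j || r j i).

Lemma adj_erel n r (i j : graph_on n r) : adj i j = erel r i j.
Proof. exact: adj_graph_on. Qed.

Lemma erel_sym r : symmetric (erel r).
Proof. by move=> i j; rewrite /erel eq_sym orbC. Qed.

(** Depth-first search for a list of [k] numbers below [n] that extends [t]. The
    comparison of [find] with [n] stops at the first success, unlike [has] in a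
    strict evaluation. *)
Fixpoint search (ok : seq nat -> nat -> bool) n k t : bool :=
  if k is k'.+1 then
    find (fun x => if ok t x then search ok n k' (rcons t x) else false) (iota 0 n) < n
  else true.

Lemma searchP (ok : seq nat -> nat -> bool) n k t : reflect
  (exists2 u, size u = k & forall i, i < k ->
     nth 0 u i < n /\ ok (t ++ take i u) (nth 0 u i))
  (search ok n k t).
Proof.
elim: k t => [|k IH] t; first by apply: ReflectT; exists [::].
rewrite /= -[X in _ < X](size_iota 0 n) -has_find.
apply: (iffP hasP) => [[x]|[[|x u] //= [su] uP]].
  rewrite mem_iota => xn; case: ifP => // okx /IH [u su uP].
  exists (x :: u); first by rewrite /= su.
  case=> [|i] ik /=; first by rewrite cats0.
  by rewrite -cat_rcons; exact: uP.
have [xn okx] := uP 0 isT; rewrite cats0 in okx.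
exists x; first by rewrite mem_iota.
rewrite okx; apply/IH; exists u => // i ik.
by rewrite cat_rcons; exact: (uP i.+1).
Qed.

(** [t] lists the images of the first [size t] vertices of [graph_on m s]. *)
Definition embed_ok s r t x : bool := (x \notin t) &&
  all (fun i => erel r (nth 0 t i) x == erel s i (size t)) (iota 0 (size t)).

Definition embedsb m s n r : bool := search (embed_ok s r) n m [::].

Lemma embed_okP s r u j : j < size u -> embed_ok s r (take j u) (nth 0 u j) ->
  forall i, i < j -> nth 0 u i != nth 0 u j /\
    erel r (nth 0 u i) (nth 0 u j) = erel s i j.
Proof.
move=> ju /andP [new /allP old] i ij.
have st : size (take j u) = j by rewrite size_takel // ltnW.
have := old i; rewrite st mem_iota ij nth_take // => /(_ isT)/eqP; split=> //.
by apply: contraNneq new => <-; rewrite -(nth_take 0 ij) mem_nth // st.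
Qed.

Lemma embedsP m s n r : reflect (embeds (graph_on m s) (graph_on n r)) (embedsb m s n r).
Proof.
apply: (iffP (searchP _ _ _ _)) => [[u su uP]|[f fI fA]].
  have un i : i < m -> nth 0 u i < n by move=> /uP [].
  have uE i j : i < j -> j < m -> nth 0 u i != nth 0 u j /\
      erel r (nth 0 u i) (nth 0 u j) = erel s i j.
    by move=> ij jm; apply: embed_okP ij; [rewrite su | exact: (uP j jm).2].
  exists (fun i : 'I_m => Ordinal (un i (ltn_ord i))).
    move=> i j [e]; apply: val_inj; case: (ltngtP i j) => // h.
      by have [] := uE i j h (ltn_ord j); rewrite e eqxx.
    by have [] := uE j i h (ltn_ord i); rewrite e eqxx.
  move=> i j; rewrite !adj_erel /=; case: (ltngtP i j) => [h|h|/val_inj ->].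
  - exact: (uE i j h (ltn_ord j)).2.
  - by rewrite erel_sym (uE j i h (ltn_ord i)).2 erel_sym.
  by rewrite /erel !eqxx.
case: m f fI fA => [|m] f fI fA; first by exists [::].
pose g i := nat_of_ord (f (inord i)).
exists (mkseq g m.+1); first by rewrite size_mkseq.
move=> j jm; rewrite nth_mkseq //; split; first exact: ltn_ord.
have st : size (take j (mkseq g m.+1)) = j by rewrite size_takel // size_mkseq ltnW.
apply/andP; split.
  apply/negP => /(nthP 0) [i]; rewrite st => ij.
  rewrite nth_take // nth_mkseq; last by lia.
  by move=> /val_inj/fI/(congr1 val); rewrite /= !inordK; lia.
rewrite st; apply/allP => i; rewrite mem_iota => ij.
rewrite nth_take // nth_mkseq; last by lia.
by rewrite -adj_erel fA adj_erel !inordK //; lia.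
Qed.

Definition twins_without n r v : rel nat := fun x y =>
  all (fun z => (z == v) || (erel r x z == erel r y z)) (iota 0 n).

(** The first vertex of each class of twins in the graph without [v]. They induce a
    twin-free graph onto which this graph can be mapped. *)
Definition representatives n r v : seq nat :=
  [seq x <- iota 0 n | (x != v) &&
    all (fun y => (y == v) || ~~ twins_without n r v x y) (iota 0 x)].

Definition represented n r v : bool :=
  (representatives n r v != [::]) && all (fun x => (x == v) ||
    has (twins_without n r v x) (representatives n r v))
      (iota 0 n).

Definition graph_on_seq L r : sgraph :=
  graph_on (size L) (fun i j => r (nth 0 L i) (nth 0 L j)).

Lemma finite_colourable_without (F : graph_family) n r (v : graph_on n r) :
  represented n r v -> F (graph_on_seq (representatives n r v) r) ->
  colourable_without F v.
Proof.
rewrite /represented; set L := representatives n r v => /andP [L0 /allP repr] FL.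
have Lv y : y \in L -> (y != v :> nat) && (y < n).
  by rewrite mem_filter mem_iota => /andP [/andP [-> _] /andP [_ ->]].
have Lu : uniq L by rewrite filter_uniq // iota_uniq.
have sL : size L = (size L).-1.+1 by case: (L) L0.
pose g x := find (twins_without n r v x) L.
have gP (x : graph_on n r) : x != v ->
    g x < size L /\ twins_without n r v x (nth 0 L (g x)).
  move=> xv; have := repr x; rewrite mem_iota ltn_ord => /(_ isT).
  case/orP => [/eqP/val_inj e|h]; first by rewrite e eqxx in xv.
  by rewrite -has_find h; split=> //; exact: nth_find.
exists (graph_on_seq L r) => //.
exists (fun x : graph_on n r =>
  cast_ord (esym sL) (inord (g x)) : graph_on_seq L r) => x y xv yv.
have [gx /allP tx] := gP x xv; have [gy /allP ty] := gP y yv.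
rewrite !adj_erel /= !inordK -?sL //.
have -> : erel (fun i j => r (nth 0 L i) (nth 0 L j)) (g x) (g y) =
    erel r (nth 0 L (g x)) (nth 0 L (g y)).
  by rewrite /erel nth_uniq.
have /andP [gxv gxn] := Lv _ (mem_nth 0 gx).
have e1 : erel r y (nth 0 L (g x)) = erel r (nth 0 L (g y)) (nth 0 L (g x)).
  have := ty (nth 0 L (g x)); rewrite mem_iota gxn (negbTE gxv).
  by move=> /(_ isT)/eqP.
have e2 : erel r x y = erel r (nth 0 L (g x)) y.
  have := tx (nat_of_ord y); rewrite mem_iota ltn_ord => /(_ isT).
  by case/orP => [/eqP/val_inj e'|/eqP //]; rewrite e' eqxx in yv.
by rewrite e2 erel_sym -e1 erel_sym.
Qed.

Definition twin_freeb n r : bool :=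
  all (fun i => all (fun j => (i == j) ||
    has (fun z => erel r i z != erel r j z) (iota 0 n)) (iota 0 n)) (iota 0 n).

Lemma twin_freeP n r : twin_freeb n r -> twin_free (graph_on n r).
Proof.
move=> /allP tf u v uv; apply: val_inj => /=.
have := tf u; rewrite mem_iota ltn_ord => /(_ isT)/allP/(_ (nat_of_ord v)).
rewrite mem_iota ltn_ord => /(_ isT)/orP [/eqP //|/hasP [z]].
rewrite mem_iota => /= zn; have := uv (Ordinal zn); rewrite !adj_erel /= => ->.
by rewrite eqxx.
Qed.

Lemma finite_minimal_obstruction (F : graph_family) (Fb : nat -> rel nat -> bool) n r :
  hereditary F -> (forall m s, Fb m s -> F (graph_on m s)) -> ~ F (graph_on n r) ->
  twin_freeb n r && all (fun v => represented n r v &&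
    let L := representatives n r v in
    Fb (size L) (fun i j => r (nth 0 L i) (nth 0 L j))) (iota 0 n) ->
  minimal_obstruction F (graph_on n r).
Proof.
move=> hF FbP nF /andP [tf /allP FL]; apply: minimal_obstructionI => [col|v].
  exact/nF/(twin_free_colourable hF (twin_freeP tf)).
have := FL (nat_of_ord v); rewrite mem_iota ltn_ord => /(_ isT)/andP [repr /FbP].
exact: finite_colourable_without.
Qed.

(** An order in which each vertex is adjacent to all vertices between it and its later
    neighbours is an interval model: the interval of a vertex extends from its own
    position to that of its last neighbour. *)
Definition order_ok r t x : bool := (x \notin t) &&
  all (fun i => erel r (nth 0 t i) x ==> all (erel r (nth 0 t i)) (drop i.+1 t))
      (iota 0 (size t)).

Definition nat_intervalb n r : bool := search (order_ok r) n n [::].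

Lemma nat_intervalP n r : nat_intervalb n r -> nat_interval (graph_on n r).
Proof.
case/searchP => t st tP.
have ut : uniq t.
  apply/(uniqP 0) => i j; rewrite !inE st => im jm.
  wlog ij : i j im jm / i < j.
    by move=> W; case: (ltngtP i j) => // h e; [exact: W | apply/esym/W].
  have [_ /andP [new _]] := tP j jm; move=> e; case/negP: new.
  by rewrite -e -(nth_take 0 ij) mem_nth // size_takel // st ltnW.
have order i j k : i < j -> j < k -> k < n -> erel r (nth 0 t i) (nth 0 t k) ->
    erel r (nth 0 t i) (nth 0 t j).
  move=> ij jk kn ik; have [_ /andP [_ /allP old]] := tP k kn.
  have sk : size (take k t) = k by rewrite size_takel // st ltnW.
  have := old i; rewrite sk mem_iota (ltn_trans ij jk) nth_take ?(ltn_trans ij jk) //.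
  rewrite ik => /(_ isT)/allP; apply.
  rewrite -(nth_take 0 jk) -(subnKC ij) -nth_drop mem_nth // size_drop sk.
  by rewrite ltn_sub2r // (leq_ltn_trans ij jk).
have mt (u : graph_on n r) : nat_of_ord u \in t.
  have sub : {subset t <= iota 0 n}.
    by move=> x /(nthP 0) [i it <-]; rewrite mem_iota; have [] := tP i; rewrite -?st.
  by rewrite (uniq_min_size ut sub _).2 ?mem_iota ?ltn_ord // size_iota st.
pose h (u : graph_on n r) := index (nat_of_ord u) t.
have hn u : h u < n by rewrite -st index_mem.
have hI u v : h u = h v -> u = v.
  by move=> e; apply: val_inj; rewrite /= -(nth_index 0 (mt u)) -(nth_index 0 (mt v)) -/(h u) e.
have hE u v w : h u < h v -> h v < h w -> adj u w -> adj u v.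
  move=> uv vw; have := order _ _ _ uv vw (hn w).
  by rewrite !nth_index // !adj_erel.
pose e u := \max_(w | cadj u w) h w.
have he u v : cadj u v -> h v <= e u by move=> uv; exact: leq_bigmax_cond.
have meet u v : h u < h v -> h v <= e u -> adj u v.
  move=> uv; rewrite leqNgt => ve; apply: contraNT ve => nuv.
  rewrite -ltnS; have -> : (h v).+1 = (h v).-1.+2 by lia.
  rewrite !ltnS; apply/bigmax_leqP => w uw.
  have [lt|le] := ltnP (h w) (h v); first by lia.
  have uw' : adj u w by case/orP: uw => [/eqP ew|//]; rewrite -ew in le; lia.
  case: (ltngtP (h v) (h w)) le => // [vw _|/hI ew _].
    by rewrite (hE u v w) in nuv.
  by rewrite ew uw' in nuv.
exists h, e; split=> [u|u v uv]; first exact/he/cadjxx.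
apply/idP/idP => [a|/andP [uv' vu]].
  by rewrite !he // ?adj_cadj // adj_sym.
case: (ltngtP (h u) (h v)) => [lt|lt|/hI ew]; first exact: meet.
  by rewrite adj_sym; exact: meet.
by rewrite ew eqxx in uv.
Qed.
End Finite.

(** * Four-cycles in twin-free graphs *)

(** The vertices of the two paths are 0, 1, 2 and 3, 4, 5. *)
Definition co_2P3_edges : seq (nat * nat) :=
  [:: (0, 2); (3, 5); (0, 3); (0, 4); (0, 5); (1, 3); (1, 4); (1, 5);
      (2, 3); (2, 4); (2, 5)].

Lemma co_2P3_iso : isomorphic co_2P3 (graph_of_edges 6 co_2P3_edges).
Proof.
have lt6 (x : 'I_2 * 'I_3) : x.1 * 3 + x.2 < 6.
  by have := ltn_ord x.1; have := ltn_ord x.2; lia.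
exists (fun x : co_2P3 => Ordinal (lt6 x) : graph_of_edges 6 _).
  apply: inj_card_bij; last by rewrite card_prod !card_ord.
  move=> [i j] [i' j'] [/= e]; have := ltn_ord j; have := ltn_ord j'.
  by move=> h h'; congr (_, _); apply: val_inj; rewrite /=; lia.
apply/full_homE => -[[i hi] [j hj]] [[i' hi'] [j' hj']]; rewrite adj_erel /=.
case: i hi => [|[|i]] // hi; case: i' hi' => [|[|i']] // hi';
case: j hj => [|[|[|j]]] // hj; case: j' hj' => [|[|[|j']]] // hj'.
Qed.

Lemma two_K2_iso :
  isomorphic (copies 2 (complete_graph 2)) (graph_of_edges 4 [:: (0, 1); (2, 3)]).
Proof.
have lt4 (x : 'I_2 * 'I_2) : x.1 * 2 + x.2 < 4.
  by have := ltn_ord x.1; have := ltn_ord x.2; lia.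
exists (fun x : copies 2 (complete_graph 2) => Ordinal (lt4 x) : graph_of_edges 4 _).
  apply: inj_card_bij; last by rewrite card_prod !card_ord.
  move=> [i j] [i' j'] [/= e]; have := ltn_ord j; have := ltn_ord j'.
  by move=> h h'; congr (_, _); apply: val_inj; rewrite /=; lia.
apply/full_homE => -[[i hi] [j hj]] [[i' hi'] [j' hj']]; rewrite adj_erel /=.
case: i hi => [|[|i]] // hi; case: i' hi' => [|[|i']] // hi';
case: j hj => [|[|j]] // hj; case: j' hj' => [|[|j']] // hj'.
Qed.

Ltac lookup := first
  [ by [] | assumption | by rewrite eq_sym | by rewrite adj_sym
  | match goal with H : adj ?a ?b = _ |- adj ?a ?b = _ => exact: H
                  | H : adj ?a ?b = _ |- adj ?b ?a = _ => rewrite adj_sym; exact: H end ].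

Ltac four_cycle_cases := let i := fresh in let j := fresh in
  move=> i j; case: j => [|[|[|[|[|[|j]]]]]] //; case: i => [|[|[|[|[|i]]]]] //= _ _;
  split; lookup.

Section FourCycle.
Variable G : sgraph.
Implicit Types u v w : G.

Lemma twin_free_distinguish u v : twin_free G -> u != v ->
  exists w, adj u w != adj v w.
Proof.
move=> tf ne; apply/existsP; apply: contraR ne => /existsPn same.
by apply/eqP/tf => w; apply/eqP; rewrite -[_ == _]negbK same.
Qed.

(** If [v] or [w] sees exactly one of the two neighbours of the vertex it
    distinguishes, there is a house; otherwise each sees both or none, and the
    adjacency of [v] and [w] decides. *)
Lemma distinguished_four_cycle u1 u2 u3 u4 v w :
  adj u1 u2 = true -> adj u2 u3 = true -> adj u3 u4 = true -> adj u4 u1 = true ->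
  adj u1 u3 = false -> adj u2 u4 = false ->
  adj v u1 = true -> adj v u3 = false -> adj w u2 = true -> adj w u4 = false ->
  exists2 H, F_C4 H & embeds H G.
Proof.
move=> a12 a23 a34 a41 n13 n24 v1 nv3 w2 nw4.
have ne (a b c : G) : adj a c = true -> adj b c = false -> a != b.
  by move=> ac bc; apply: contraFneq bc => <-.
have [n12 n23 n34 n14] : [/\ u1 != u2, u2 != u3, u3 != u4 & u1 != u4].
  by split; rewrite 1?eq_sym ?adj_neq // adj_sym.
have ne13 : u1 != u3 by apply: (ne _ _ v); lookup.
have ne24 : u2 != u4 by apply: (ne _ _ w); lookup.
have nev1 : v != u1 by exact: adj_neq.
have nev2 : v != u2 by rewrite eq_sym; apply: (ne _ _ u3); lookup.
have nev3 : v != u3 by apply: (ne _ _ u1); lookup.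
have nev4 : v != u4 by rewrite eq_sym; apply: (ne _ _ u3); lookup.
have new1 : w != u1 by rewrite eq_sym; apply: (ne _ _ u4); lookup.
have new2 : w != u2 by exact: adj_neq.
have new3 : w != u3 by rewrite eq_sym; apply: (ne _ _ u4); lookup.
have new4 : w != u4 by apply: (ne _ _ u2); lookup.
pose G5 a b c d e := nth v [:: a; b; c; d; e]; pose G6 a b c d e f := nth v [:: a; b; c; d; e; f].
have Hh : F_C4 house by do 2 right; left.
have HA : F_C4 graph_A by left.
have HB : F_C4 graph_B by right; left.
have HX : F_C4 co_X170 by do 3 right; left.
have HP : F_C4 co_2P3 by do 4 right; left.
case v2 : (adj v u2); case v4 : (adj v u4); case w1 : (adj w u1); case w3 : (adj w u3).
(* the four houses in which [v] or [w] is the roof *)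
all: try by exists house => //; apply: (@embeds_graph_on _ _ G (G5 u1 u2 u3 u4 v));
  four_cycle_cases.
all: try by exists house => //; apply: (@embeds_graph_on _ _ G (G5 u1 u4 u3 u2 v));
  four_cycle_cases.
all: try by exists house => //; apply: (@embeds_graph_on _ _ G (G5 u1 u2 u3 u4 w));
  four_cycle_cases.
all: try by exists house => //; apply: (@embeds_graph_on _ _ G (G5 u2 u3 u4 u1 w));
  four_cycle_cases.
all: have nvw : v != w by apply/eqP => e; move: w2 nw4; rewrite -e ?v2 ?v4.
all: case vw : (adj v w).
- exists co_2P3 => //; apply: (embeds_trans (isomorphic_embeds co_2P3_iso).2).
  by apply: (@embeds_graph_on _ _ G (G6 u1 u3 v u2 u4 w)); four_cycle_cases.
- by exists house => //; apply: (@embeds_graph_on _ _ G (G5 u1 u4 u3 w v)); four_cycle_cases.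
- by exists house => //; apply: (@embeds_graph_on _ _ G (G5 u2 v u4 u3 w)); four_cycle_cases.
- by exists co_X170 => //; apply: (@embeds_graph_on _ _ G (G6 u2 u1 u4 u3 w v)); four_cycle_cases.
- by exists house => //; apply: (@embeds_graph_on _ _ G (G5 u1 w u3 u4 v)); four_cycle_cases.
- by exists co_X170 => //; apply: (@embeds_graph_on _ _ G (G6 u1 u2 u3 u4 v w)); four_cycle_cases.
- by exists graph_B => //; apply: (@embeds_graph_on _ _ G (G6 u1 u2 u3 u4 v w)); four_cycle_cases.
by exists graph_A => //; apply: (@embeds_graph_on _ _ G (G6 u1 u2 u3 u4 v w)); four_cycle_cases.
Qed.

(** Opposite vertices of a four-cycle are not twins, so some [v] distinguishes one
    pair and some [w] the other. Renaming the vertices of the cycle decides which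
    vertex of the pair is seen. *)
Theorem twin_free_four_cycle :
  twin_free G -> embeds (cycle_graph 4) G -> exists2 H, F_C4 H & embeds H G.
Proof.
move=> tf [f fI fA].
pose o i : cycle_graph 4 := inord i : 'I_4.
have fE i j : i < 4 -> j < 4 -> adj (f (o i)) (f (o j)) =
    erel (fun i j => i.+1 %% 4 == j) i j.
  by move=> i4 j4; rewrite fA adj_erel /o !inordK.
have fne i j : i < 4 -> j < 4 -> i != j -> f (o i) != f (o j).
  move=> i4 j4 ij; apply: contraNneq ij => /fI /(congr1 (@nat_of_ord 4)) /=.
  by rewrite !inordK // => ->.
have [v v13] := twin_free_distinguish tf (fne 0 2 isT isT isT).
have [w w24] := twin_free_distinguish tf (fne 1 3 isT isT isT).
have split_neq (b c : bool) : b != c -> b = true /\ c = false \/ b = false /\ c = true.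
  by case: b; case: c => //; [left|right].
have S (a b : G) c : adj a b = c -> adj b a = c by rewrite adj_sym.
case: (split_neq _ _ v13) => -[va vb]; case: (split_neq _ _ w24) => -[wa wb].
- by apply: (@distinguished_four_cycle (f (o 0)) (f (o 1)) (f (o 2)) (f (o 3)) v w);
    rewrite ?fE //; exact: S.
- by apply: (@distinguished_four_cycle (f (o 0)) (f (o 3)) (f (o 2)) (f (o 1)) v w);
    rewrite ?fE //; exact: S.
- by apply: (@distinguished_four_cycle (f (o 2)) (f (o 1)) (f (o 0)) (f (o 3)) v w);
    rewrite ?fE //; exact: S.
by apply: (@distinguished_four_cycle (f (o 2)) (f (o 3)) (f (o 0)) (f (o 1)) v w);
  rewrite ?fE //; exact: S.
Qed.
End FourCycle.

Lemma not_chordal_cycle G : ~ chordal G -> exists2 n, 4 <= n & embeds (cycle_graph n) G.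
Proof.
move=> nch; apply: NNPP => no; apply: nch => H [n n4 ->] /contains_inducedP emb.
by apply: no; exists n.
Qed.

(** * Forests *)

Lemma forest_hereditary : hereditary forest.
Proof.
move=> G H [f fI fA] forG s s2 /andP [cs us]; apply: (forG (map f s)).
  by rewrite size_map.
rewrite /ucycle map_inj_uniq // us andbT.
case: s cs {s2 us} => //= x s; rewrite -map_rcons path_map.
by apply: sub_path => u v; rewrite /= fA.
Qed.

Lemma cycle_not_forest n : 3 <= n -> ~ forest (cycle_graph n).
Proof.
case: n => [|n] // n3 forC.
pose g i : cycle_graph n.+1 := inord i : 'I_n.+1.
pose s := [seq g i | i <- iota 0 n.+1].
have gA i j : i < j -> j <= n -> adj (g i) (g j) = (j == i.+1) || (i == 0) && (j == n).
  by move=> ij jn; rewrite adj_graph_on !inordK ?cycle_relE; lia.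
apply: (forC s); first by rewrite size_map size_iota.
apply/andP; split; last first.
  rewrite map_inj_in_uniq ?iota_uniq // => i j; rewrite !mem_iota => im jm.
  by move/(congr1 (@nat_of_ord n.+1)); rewrite /g !inordK; lia.
change (path (@adj (cycle_graph n.+1)) (g 0) (rcons [seq g i | i <- iota 1 n] (g 0))).
apply/(pathP (g 0)) => i; rewrite size_rcons size_map size_iota ltnS => im.
have nthE k : k <= n -> nth (g 0) (g 0 :: rcons [seq g i | i <- iota 1 n] (g 0)) k = g k.
  case: k => // k kn; rewrite /= nth_rcons size_map size_iota kn.
  by rewrite (nth_map 0) ?size_iota // nth_iota.
rewrite -[rcons _ _]/(behead (g 0 :: rcons [seq g i | i <- iota 1 n] (g 0))).
rewrite nth_behead; have -> : nth (g 0) (g 0 :: behead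
    (g 0 :: rcons [seq g i | i <- iota 1 n] (g 0))) i = g i by rewrite nthE.
case: (ltngtP i n) im => // [lt _|-> _].
  by rewrite nthE // gA ?eqxx; lia.
rewrite -[nth _ (_ :: _) _]/(nth (g 0) (rcons [seq g i | i <- iota 1 n] (g 0)) n).
rewrite nth_rcons size_map size_iota ltnn eqxx adj_sym gA; lia.
Qed.

(** Removing [x] from a cycle leaves a path between two neighbours of [x]; its first
    vertex and the next neighbour of [x] on it form a triangle with [x]. *)
Lemma chordal_triangle_free_forest G :
  chordal G -> ~ embeds (cycle_graph 3) G -> forest G.
Proof.
move=> /chordal_links_closed lc no3 [|x p] //= p2 /andP [cyc /andP [xp up]].
pose q i := nth x p i; pose l := (size p).-1.
have p0 : 0 < size p by lia.
have lp : l < size p by rewrite /l; lia.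
have /pathP pth := cyc; rewrite size_rcons in pth.
have xq0 : adj x (q 0).
  by have := pth x 0 isT; rewrite nth_rcons p0.
have qq i : i.+1 < size p -> adj (q i) (q i.+1).
  move=> ip; have := pth x i.+1; rewrite -[nth _ (_ :: _) _]/(nth x (rcons p x) i).
  by rewrite !nth_rcons ip (ltnW ip); apply; exact: ltnW.
have xql : adj x (q l).
  have := pth x l.+1; have -> : l.+1 = size p by rewrite /l; lia.
  rewrite -[in nth _ (_ :: _) _](prednK p0) -[nth _ (_ :: _) _]/(nth x (rcons p x) l).
  by rewrite !nth_rcons lp ltnn eqxx adj_sym; apply.
have [j /andP [j0 xqj] jmin] : exists2 j, (0 < j) && adj x (q j) &
    forall i, (0 < i) && adj x (q i) -> j <= i.
  have ex : exists j, (0 < j) && adj x (q j) by exists l; rewrite xql /l; lia.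
  by case: (ex_minnP ex) => j ? ?; exists j.
have jl : j <= l by apply: jmin; rewrite xql /l; lia.
have : cadj (q 0) (q j).
  apply: (linked lc (T := seg q 0 j) xq0 xqj).
  - exact: mem_seg.
  - apply: walk_conn => // [t t_le|t t_le]; first by apply: mem_seg; lia.
    by apply: qq; lia.
  move=> y /segP [k kj ->] k0 kj'.
  have k0' : k <> 0 by move=> e; rewrite e eqxx in k0.
  have kj'' : k <> j by move=> e; rewrite e eqxx in kj'.
  rewrite /cadj negb_or; apply/andP; split.
    apply: contraNneq xp => ->; apply: mem_nth.
    by case/andP: kj => _ kj; exact: leq_ltn_trans (leq_trans kj jl) lp.
  by apply/negP => xk; have := jmin k; rewrite xk; lia.
case/orP => [/eqP e|q0j].
  have /eqP := e; rewrite nth_uniq //; [|exact: leq_ltn_trans jl lp].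
  by rewrite eq_sym eqn0Ngt j0.
apply: no3; apply: (@embeds_graph_on _ _ G (nth x [:: x; q 0; q j])).
move=> a b; case: b => [|[|[|b]]] //; case: a => [|[|a]] //= _ _.
- by rewrite adj_neq.
- by rewrite adj_neq.
by rewrite adj_neq.
Qed.

Lemma forest_no_cycle G n : 3 <= n -> forest G -> ~ embeds (cycle_graph n) G.
Proof. by move=> n3 forG /forest_hereditary/(_ forG); exact: cycle_not_forest. Qed.

(** * Split graphs *)

Lemma split_hereditary : hereditary split_graph.
Proof.
move=> G H [f fI fA] [K [clK indK]]; exists [set x | f x \in K]; split=> x y.
  by rewrite !inE => xK yK xy; rewrite -fA; apply: clK; rewrite ?(inj_eq fI).
by rewrite !inE => xK yK; rewrite -fA; exact: indK.
Qed.

Definition two_K2_rel : rel nat := fun i j => (i, j) \in [:: (0, 1); (2, 3)].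
Definition cycle_rel n : rel nat := fun i j => i.+1 %% n == j.
Definition path_rel : rel nat := fun i j => i.+1 == j.

(** Among the largest cliques take one with the largest sum of degrees. If [u v]
    were an edge outside it, [u] and [v] would each miss part of [K]; these parts
    are nested, and exchanging the only vertex [a] missed by [u] for [u] does not increase
    the sum of degrees. So [a] has a neighbour that [u] has not, which leads to one of
    the three graphs. *)
Theorem free_split G :
  ~ embeds (graph_on 4 two_K2_rel) G -> ~ embeds (cycle_graph 4) G ->
  ~ embeds (cycle_graph 5) G -> split_graph G.
Proof.
move=> no2K2 noC4 noC5.
pose clique (K : {set G}) := [forall x in K, forall y in K, (x == y) || adj x y].
have cliqueP (K : {set G}) : reflect (forall x y, x \in K -> y \in K -> cadj x y) (clique K).
  apply: (iffP forall_inP) => [h x y xK yK|h x xK].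
    by have /forall_inP := h x xK; apply.
  by apply/forall_inP => y yK; exact: h.
have cl0 : clique set0 by apply/cliqueP => x y; rewrite inE.
pose deg (x : G) := #|[set y | adj x y]|.
case: (arg_maxnP (fun K : {set G} => #|K|) cl0) => K1 cl1 max1.
pose largest (K : {set G}) := clique K && (#|K| == #|K1|).
have cl1' : largest K1 by rewrite /largest cl1 eqxx.
case: (arg_maxnP (fun K : {set G} => \sum_(x in K) deg x) cl1') => K /andP [clK /eqP sK] max2.
have maxK (K' : {set G}) : clique K' -> #|K'| <= #|K| by rewrite sK; exact: max1.
have maxD (K' : {set G}) : clique K' -> #|K'| = #|K| ->
  \sum_(x in K') deg x <= \sum_(x in K) deg x.
  by move=> c e; apply: max2; rewrite /largest c e sK eqxx.
have {cl0 max1 max2 cl1' cl1 sK largest K1} clK := cliqueP K clK.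
have adjK x y : x \in K -> y \in K -> x != y -> adj x y.
  by move=> xK yK xy; have := clK x y xK yK; rewrite /cadj (negbTE xy).
exists K; split=> // u0 v0 u0K v0K; apply/negP => uv0.
have noC4' (a b c d : G) : adj a b -> adj b c -> adj c d -> adj d a ->
    ~~ adj a c -> ~~ adj b d -> a != c -> b != d -> False.
  move=> /idP ab /idP bc /idP cd /idP da /negbTE ac /negbTE bd nac nbd; apply: noC4.
  have [nab nbc ncd nda] : [/\ a != b, b != c, c != d & d != a].
    by split; exact: adj_neq.
  by apply: (@embeds_graph_on _ _ G (nth a [:: a; b; c; d])); four_cycle_cases.
have no2K2' (a b c d : G) : adj a b -> adj c d ->
    ~~ adj a c -> ~~ adj a d -> ~~ adj b c -> ~~ adj b d -> False.
  move=> /idP ab /idP cd nac nad nbc nbd; apply: no2K2.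
  have nab := adj_neq ab; have ncd := adj_neq cd.
  have ne (x y z : G) : adj x z -> ~~ adj y z -> x != y.
    by move=> xz; apply: contraNneq => <-.
  have n1 : a != c by apply: (ne _ _ b) => //; rewrite adj_sym.
  have n2 : a != d by apply: (ne _ _ b) => //; rewrite adj_sym.
  have n3 : b != c by apply: (ne _ _ a); rewrite adj_sym.
  have n4 : b != d by apply: (ne _ _ a); rewrite adj_sym.
  move/negbTE: nac nad nbc nbd => nac /negbTE nad /negbTE nbc /negbTE nbd.
  by apply: (@embeds_graph_on _ _ G (nth a [:: a; b; c; d])); four_cycle_cases.
(* the non-neighbours of [u] in [K] are among those of [v] *)
wlog nest : u0 v0 u0K v0K uv0 / forall a, a \in K -> ~~ adj u0 a -> ~~ adj v0 a.
  move=> W; have [h|h] := classic (forall a, a \in K -> ~~ adj u0 a -> ~~ adj v0 a).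
    exact: (W u0 v0).
  apply: (W v0 u0) => //; first by rewrite adj_sym.
  move=> b bK nvb; apply/negP => ub; apply: h => a aK nua; apply/negP => va.
  have ab : a != b by apply: contraNneq nua => ->.
  apply: (noC4' u0 v0 a b) => //; try exact: adjK; try by rewrite adj_sym.
    by apply: contraNneq u0K => ->.
  by apply: contraNneq v0K => ->.
have exK w : w \notin K -> exists2 a, a \in K & ~~ adj w a.
  move=> wK; apply/exists_inP; apply: contraT => /exists_inPn h.
  have : clique (w |: K).
    apply/cliqueP => x y; rewrite !in_setU1 => /orP [/eqP ->|xK] /orP [/eqP ->|yK].
    - exact: cadjxx.
    - by rewrite adj_cadj //; have := h y yK; rewrite negbK.
    - by rewrite cadj_sym adj_cadj //; have := h x xK; rewrite negbK.
    exact: clK.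
  by move/maxK; rewrite cardsU1 wK ltnn.
have [a aK nua] := exK u0 u0K; have nva := nest a aK nua.
have ua : u0 != a by apply: contraNneq u0K => ->.
have onlya b : b \in K -> b != a -> adj u0 b.
  move=> bK ba; apply: contraT => nub; exfalso.
  by apply: (no2K2' u0 v0 a b) => //; [apply: adjK; rewrite // eq_sym | apply: nest].
pose K' := u0 |: (K :\ a).
have clK' : clique K'.
  apply/cliqueP => x y; rewrite !in_setU1 !in_setD1.
  case/orP => [/eqP ->|/andP [xa xK]] /orP [/eqP ->|/andP [ya yK]].
  - exact: cadjxx.
  - by rewrite adj_cadj ?onlya.
  - by rewrite cadj_sym adj_cadj ?onlya.
  exact: clK.
have u0Ka : u0 \notin K :\ a by rewrite in_setD1 (negbTE u0K) andbF.
have cK' : #|K'| = #|K| by rewrite cardsU1 u0Ka (cardsD1 a K) aK.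
(* [v] is adjacent to the rest of [K], or the clique could be enlarged *)
have [b bK /andP [nvb ba]] : exists2 b, b \in K & ~~ adj v0 b && (b != a).
  apply/exists_inP; apply: contraT => /exists_inPn h.
  have : clique (v0 |: K').
    apply/cliqueP => x y; rewrite !(in_setU1 _ v0).
    case/orP => [/eqP ->|xK] /orP [/eqP ->|yK].
    - exact: cadjxx.
    - apply: adj_cadj; move: yK; rewrite in_setU1 in_setD1.
      case/orP => [/eqP ->|/andP [ya yK]]; first by rewrite adj_sym.
      by have := h y yK; rewrite ya andbT negbK.
    - rewrite cadj_sym; apply: adj_cadj; move: xK; rewrite in_setU1 in_setD1.
      case/orP => [/eqP ->|/andP [xa xK]]; first by rewrite adj_sym.
      by have := h x xK; rewrite xa andbT negbK.
    exact: (cliqueP _ clK').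
  move/maxK; rewrite cardsU1 cK' in_setU1 in_setD1 (negbTE v0K) andbF orbF.
  by rewrite eq_sym (adj_neq uv0) ltnn.
have [w /andP [aw nuw]] : exists w, adj a w && ~~ adj u0 w.
  apply/existsP; apply: contraT => /existsPn h.
  have := maxD K' clK' cK'.
  rewrite (big_setD1 a aK) /= big_setU1 //= leq_add2r.
  have /proper_card : [set y | adj a y] \proper [set y | adj u0 y].
    apply/properP; split.
      apply/subsetP => y; rewrite !inE => ay.
      by have := h y; rewrite ay negbK.
    by exists v0; rewrite !inE // adj_sym.
  by rewrite [deg u0 <= _]leqNgt => ->.
have uw : u0 != w by apply: contraNneq nua => ->; rewrite adj_sym.
have wK : w \notin K.
  by apply: contra nuw => wK; apply: onlya => //; rewrite eq_sym adj_neq.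
have vw : adj v0 w.
  apply: contraT => nvw; exfalso.
  by apply: (no2K2' u0 v0 w a); rewrite // adj_sym.
have ub := onlya b bK ba; have ab := adjK a b aK bK.
rewrite eq_sym ba in ab; have {}ab := ab isT.
have va : v0 != a by apply: contraNneq v0K => ->.
have vb : v0 != b by apply: contraNneq v0K => ->.
have [wb|nwb] := boolP (adj w b).
  by apply: (noC4' u0 v0 w b) => //; rewrite adj_sym.
apply: noC5.
have nuv := adj_neq uv0; have nvw := adj_neq vw; have naw := adj_neq aw.
have nub := adj_neq ub; have nwb' : w != b by apply: contraNneq wK => ->.
move/idP: uv0 vw aw ab ub => uv0 /idP vw /idP aw /idP ab /idP ub.
move/negbTE: nua nva nuw nvb nwb => nua /negbTE nva /negbTE nuw /negbTE nvb /negbTE nwb.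
by apply: (@embeds_graph_on _ _ G (nth a [:: u0; v0; w; a; b])); four_cycle_cases.
Qed.

(** The possible cliques of a split partition, as lists of booleans. *)
Fixpoint masks n : seq bitseq :=
  if n is n'.+1 then [seq b :: m | b <- [:: true; false], m <- masks n'] else [:: [::]].

Definition not_splitb n r : bool := all (fun m => has (fun i => has (fun j =>
  (i != j) && ((nth false m i && nth false m j && ~~ erel r i j) ||
    (~~ nth false m i && ~~ nth false m j && erel r i j))) (iota 0 n)) (iota 0 n)) (masks n).

Lemma mem_masks m : m \in masks (size m).
Proof.
by elim: m => // b m IH; apply/allpairsP; exists (b, m); split=> //; case: b.
Qed.

Lemma not_splitP n r : not_splitb n r -> ~ split_graph (graph_on n r).
Proof.
case: n => [|n] // nspl [K [clK indK]].
pose k i := (inord i : graph_on n.+1 r) \in K.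
have : mkseq k n.+1 \in masks n.+1 by rewrite -{2}(size_mkseq k n.+1) mem_masks.
move/(allP nspl)/hasP => [i]; rewrite mem_iota => ik /hasP [j]; rewrite mem_iota => jk.
rewrite !nth_mkseq //; case/andP => ij.
have e : adj (inord i : graph_on n.+1 r) (inord j) = erel r i j by rewrite adj_erel !inordK.
rewrite -e; case/orP => /andP [/andP [iK jK]].
  move/negP; apply; apply: clK => //; rewrite -val_eqE /= !inordK //.
by move: (indK _ _ iK jK) => /negbTE ->.
Qed.

Lemma split_graphP G : split_graph G <->
  [/\ ~ embeds (graph_on 4 two_K2_rel) G, ~ embeds (cycle_graph 4) G &
      ~ embeds (cycle_graph 5) G].
Proof.
split=> [splG|[? ? ?]]; last exact: free_split.
by split=> /split_hereditary/(_ splG); apply: not_splitP; vm_compute.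
Qed.

(** * Threshold, quasi-threshold and split graphs *)

Definition quasi_thresholdb n r := ~~ embedsb 4 path_rel n r && ~~ embedsb 4 (cycle_rel 4) n r.
Definition thresholdb n r := ~~ embedsb 4 two_K2_rel n r && quasi_thresholdb n r.
Definition splitb n r := [&& ~~ embedsb 4 two_K2_rel n r, ~~ embedsb 4 (cycle_rel 4) n r &
  ~~ embedsb 5 (cycle_rel 5) n r].
Definition forestb n r := nat_intervalb n r && ~~ embedsb 3 (cycle_rel 3) n r.

Lemma quasi_thresholdP G : quasi_threshold G <->
  ~ embeds (path_graph 4) G /\ ~ embeds (cycle_graph 4) G.
Proof.
split=> [qG|[n1 n2] H]; last by case=> [<-|[<-|//]] /contains_inducedP.
by split=> /contains_inducedP; apply: qG; [left | right; left].
Qed.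

Lemma thresholdP G : threshold G <->
  [/\ ~ embeds (graph_on 4 two_K2_rel) G, ~ embeds (path_graph 4) G &
      ~ embeds (cycle_graph 4) G].
Proof.
have [i1 i2] := isomorphic_embeds two_K2_iso.
split=> [tG|[n1 n2 n3] H].
  split=> emb; [apply: (tG (copies 2 (complete_graph 2))) | apply: (tG (path_graph 4))
    | apply: (tG (cycle_graph 4))]; first [by left | by right; left | by right; right; left
    | apply/contains_inducedP => //].
  exact: embeds_trans i2 emb.
case=> [<-|[<-|[<-|//]]] /contains_inducedP // emb; apply: n1.
exact: embeds_trans i1 emb.
Qed.

Lemma quasi_threshold_decide n r : quasi_thresholdb n r -> quasi_threshold (graph_on n r).
Proof. by move=> /andP [n1 n2]; apply/quasi_thresholdP; split=> /embedsP; exact/negP. Qed.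

Lemma threshold_decide n r : thresholdb n r -> threshold (graph_on n r).
Proof. by move=> /and3P [n1 n2 n3]; apply/thresholdP; split=> /embedsP; exact/negP. Qed.

Lemma split_decide n r : splitb n r -> split_graph (graph_on n r).
Proof. by move=> /and3P [n1 n2 n3]; apply/split_graphP; split=> /embedsP; exact/negP. Qed.

Lemma forest_decide n r : forestb n r -> forest (graph_on n r).
Proof.
move=> /andP [/nat_intervalP/nat_interval_chordal ch n3].
by apply: chordal_triangle_free_forest => // /embedsP; exact/negP.
Qed.

Lemma embeds_decide m s n r : embedsb m s n r -> embeds (graph_on m s) (graph_on n r).
Proof. exact/embedsP. Qed.

Lemma quasi_threshold_hereditary : hereditary quasi_threshold.
Proof. exact: is_free_hereditary. Qed.

Lemma F_C4_cases H : F_C4 H -> [\/ H = graph_A, H = graph_B, H = house |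
   H = co_X170 \/ H = co_2P3].
Proof. 
by case=> [<-|[<-|[<-|[<-|[<-|//]]]]]; [constructor 1|constructor 2|constructor 3
 |constructor 4; left|constructor 4; right].
Qed.

Lemma quasi_threshold_obstructions :
  minimal_obstructions_are quasi_threshold (one_of [:: path_graph 4; co_2P3]).
Proof.
apply: minimal_obstructions_areI => [H|G tf nG].
  case=> [<-|[<-|//]].
    apply: (finite_minimal_obstruction _ quasi_threshold_decide).
    - exact: quasi_threshold_hereditary.
    - by move=> /quasi_thresholdP [n _]; apply: n; exact: embeds_refl.
    by vm_compute.
  apply: minimal_obstruction_iso co_2P3_iso _.
  apply: (finite_minimal_obstruction _ quasi_threshold_decide).
  - exact: quasi_threshold_hereditary.
  - by move=> /quasi_thresholdP [_ n]; apply: n; apply: embeds_decide; vm_compute.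
  by vm_compute.
have [P4|nP4] := classic (embeds (path_graph 4) G).
  by exists (path_graph 4) => //; left.
have [C4|nC4] := classic (embeds (cycle_graph 4) G); last first.
  by case: nG; apply/quasi_thresholdP.
have [H HF HG] := twin_free_four_cycle tf C4.
have P4in : embeds (path_graph 4) H -> False by move=> /embeds_trans/(_ HG).
case: (F_C4_cases HF) HG => [e|e|e|[e|e]] HG; last first.
  by exists co_2P3; [right; left | rewrite -e].
all: by case: P4in; rewrite e; apply: embeds_decide; vm_compute.
Qed.

Lemma threshold_obstructions : minimal_obstructions_are threshold
    (one_of [:: copies 2 (complete_graph 2); path_graph 4; co_2P3]).
Proof.
have [i1 i2] := isomorphic_embeds two_K2_iso.
have hT : hereditary threshold := @is_free_hereditary _.
apply: minimal_obstructions_areI => [H|G tf nG].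
  case=> [<-|[<-|[<-|//]]].
  - apply: minimal_obstruction_iso two_K2_iso _.
    apply: (finite_minimal_obstruction hT threshold_decide); last by vm_compute.
    by move=> /thresholdP [n _ _]; apply: n; exact: embeds_refl.
  - apply: (finite_minimal_obstruction hT threshold_decide); last by vm_compute.
    by move=> /thresholdP [_ n _]; apply: n; exact: embeds_refl.
  apply: minimal_obstruction_iso co_2P3_iso _.
  apply: (finite_minimal_obstruction hT threshold_decide); last by vm_compute.
  by move=> /thresholdP [_ _ n]; apply: n; apply: embeds_decide; vm_compute.
have [K2|nK2] := classic (embeds (graph_on 4 two_K2_rel) G).
  by exists (copies 2 (complete_graph 2)); [left | exact: embeds_trans i2 K2].
have [P4|nP4] := classic (embeds (path_graph 4) G).
  by exists (path_graph 4) => //; right; left.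
have [C4|nC4] := classic (embeds (cycle_graph 4) G); last first.
  by case: nG; apply/thresholdP.
have [H HF HG] := twin_free_four_cycle tf C4.
have P4in : embeds (path_graph 4) H -> False by move=> /embeds_trans/(_ HG).
case: (F_C4_cases HF) HG => [e|e|e|[e|e]] HG; last first.
  by exists co_2P3; [right; right; left | rewrite -e].
all: by case: P4in; rewrite e; apply: embeds_decide; vm_compute.
Qed.

Lemma split_obstructions : minimal_obstructions_are split_graph
    (one_of [:: copies 2 (complete_graph 2); cycle_graph 5; graph_A; house;
                co_X170; co_2P3]).
Proof.
have [i1 i2] := isomorphic_embeds two_K2_iso.
apply: minimal_obstructions_areI => [H|G tf nG].
  case=> [<-|[<-|[<-|[<-|[<-|[<-|//]]]]]];
    [apply: minimal_obstruction_iso two_K2_iso _ | | | | |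
      apply: minimal_obstruction_iso co_2P3_iso _];
    apply: (finite_minimal_obstruction split_hereditary split_decide);
    by [apply: not_splitP; vm_compute | vm_compute].
have [K2|nK2] := classic (embeds (graph_on 4 two_K2_rel) G).
  by exists (copies 2 (complete_graph 2)); [left | exact: embeds_trans i2 K2].
have [C5|nC5] := classic (embeds (cycle_graph 5) G).
  by exists (cycle_graph 5) => //; right; left.
have [C4|nC4] := classic (embeds (cycle_graph 4) G); last first.
  by case: nG; apply/split_graphP.
have [H HF HG] := twin_free_four_cycle tf C4.
case: (F_C4_cases HF) HG => [e|e|e|[e|e]] HG; first by exists H; rewrite // e; right; right; left.
- case: nK2; apply: embeds_trans HG; rewrite e.
  by apply: embeds_decide; vm_compute.
- by exists H; rewrite // e; do 3 right; left.
- by exists H; rewrite // e; do 4 right; left.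
by exists H; rewrite // e; do 5 right; left.
Qed.

(** * Cycles *)

(** The induced subgraphs of paths, by an injection into the natural numbers. *)
Definition linear (G : sgraph) : Prop := exists2 t : G -> nat, injective t &
  forall u v, adj u v = ((t u).+1 == t v) || ((t v).+1 == t u).

Lemma linear_nat_interval G : linear G -> nat_interval G.
Proof.
move=> [t tI A]; exists t, (fun u => (t u).+1); split=> [u|u v uv]; first exact: leqnSn.
rewrite A; have : t u <> t v by move=> /tI e; rewrite e eqxx in uv.
by lia.
Qed.

Lemma linear_forest G : linear G -> forest G.
Proof.
move=> linG; apply: chordal_triangle_free_forest.
  exact/nat_interval_chordal/linear_nat_interval.
case: linG => t tI A [f fI fA].
have e i j : i < 3 -> j < 3 -> i != j ->
    adj (f (inord i : 'I_3)) (f (inord j : 'I_3)).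
  move=> i3 j3 ij; rewrite fA adj_erel !inordK //.
  by case: i i3 ij => [|[|[|]]] // _; case: j j3 => [|[|[|]]].
have := e 0 1 isT isT isT; have := e 1 2 isT isT isT; have := e 0 2 isT isT isT.
by rewrite !A; lia.
Qed.

Lemma adj_cycle n (u v : cycle_graph n) : 2 < n -> u < v ->
  adj u v = (v == u.+1 :> nat) || (u == 0 :> nat) && (v.+1 == n).
Proof. by move=> n3 uv; rewrite adj_graph_on cycle_relE //; lia. Qed.

Lemma cycle_minus_linear n (v : cycle_graph n) (S : {set cycle_graph n}) :
  2 < n -> v \notin S -> linear (induced S).
Proof.
move=> n3 vS.
pose t (u : induced S) := 
  if nat_of_ord (val u) < v then nat_of_ord (val u) + n - v.+1
  else nat_of_ord (val u) - v.+1.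
have uv (u : induced S) : nat_of_ord (val u) <> nat_of_ord v.
  by move=> /val_inj e; move: vS; rewrite -e (valP u).
have un (u : induced S) : nat_of_ord (val u) < n := ltn_ord (val u).
have vn : v < n := ltn_ord v.
have tE u w : t u = t w -> nat_of_ord (val u) = nat_of_ord (val w).
  rewrite /t; have := uv u; have := uv w; have := un u; have := un w.
  move: (nat_of_ord (val u)) (nat_of_ord (val w)) => a b.
  by case: (ltnP a v); case: (ltnP b v); lia.
exists t => [u w /tE e|u w]; first by apply/val_inj/val_inj.
rewrite adj_induced.
have tA (a b : induced S) : nat_of_ord (val a) < nat_of_ord (val b) ->
    adj (val a) (val b) = ((t a).+1 == t b) || ((t b).+1 == t a).
  move=> ab; rewrite adj_cycle // /t.
  have := uv a; have := uv b; have := un a; have := un b; move: ab.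
  move: (nat_of_ord (val a)) (nat_of_ord (val b)) => x y.
  by case: (ltnP x v); case: (ltnP y v); lia.
case: (ltngtP (nat_of_ord (val u)) (nat_of_ord (val w))) => [h|h|/val_inj/val_inj ->].
- exact: tA.
- by rewrite adj_sym orbC tA.
by rewrite adj_irr; lia.
Qed.

Lemma adj_cycleE n (u v : cycle_graph n) : 2 < n -> adj u v =
  [|| v == u.+1 :> nat, u == v.+1 :> nat, (u == 0 :> nat) && (v.+1 == n) |
      (v == 0 :> nat) && (u.+1 == n)].
Proof.
move=> n3; have := ltn_ord u; have := ltn_ord v.
case: (ltngtP u v) => [h|h|/val_inj ->]; last by rewrite adj_irr; lia.
  by rewrite adj_cycle //; lia.
by rewrite adj_sym adj_cycle //; lia.
Qed.

Lemma cycle_twin_free n : n = 3 \/ 5 <= n -> twin_free (cycle_graph n).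
Proof.
move=> n35; have n3 : 2 < n by lia.
move=> u v uv; apply: val_inj => /=.
pose rel (a b : nat) := [|| b == a.+1, a == b.+1, (a == 0) && (b.+1 == n) | (b == 0) &&
  (a.+1 == n)].
have succ (x y : cycle_graph n) : (forall w, adj x w = adj y w) ->
    exists2 w, rel y w & (w == x.+1) || (w == 0) && (x.+1 == n).
  move=> xy; have xn := ltn_ord x.
  have wn : (if x.+1 == n then 0 else x.+1) < n by case: (x.+1 =P n :> nat); lia.
  exists (if x.+1 == n then 0 else x.+1); last by case: (x.+1 =P n :> nat); lia.
  have := xy (Ordinal wn : cycle_graph n); rewrite !adj_cycleE //= /rel => <-.
  by case: (x.+1 =P n :> nat); lia.
have pred : exists2 w, rel v w & (u == w.+1 :> nat) || (u == 0 :> nat) && (w.+1 == n).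
  have un := ltn_ord u.
  have wn : (if u == 0 :> nat then n.-1 else u.-1) < n by case: (u =P 0 :> nat); lia.
  exists (if u == 0 :> nat then n.-1 else u.-1); last by case: (u =P 0 :> nat); lia.
  have := uv (Ordinal wn : cycle_graph n); rewrite !adj_cycleE //= /rel => <-.
  by case: (u =P 0 :> nat); lia.
have [w1 r1 e1] := succ u v uv; have [w2 r2 e2] := pred.
have [w3 r3 e3] := succ v u (fun w => esym (uv w)).
move: (ltn_ord u) (ltn_ord v) r1 e1 r2 e2 r3 e3 n35; rewrite /rel; clear.
by move: (nat_of_ord u) (nat_of_ord v) => a b; lia.
Qed.

Lemma cycle_minimal (F : graph_family) n : hereditary F -> n = 3 \/ 5 <= n ->
  ~ F (cycle_graph n) -> (forall G, linear G -> F G) ->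
  minimal_obstruction F (cycle_graph n).
Proof.
move=> hF n35 nF linF; have n3 : 2 < n by lia.
apply: minimal_obstructionI => [|v].
  by move=> /(twin_free_colourable hF (cycle_twin_free n35)).
have [x xv] : exists x : cycle_graph n, x != v.
  have n0 : 0 < n by lia.
  have n1 : 1 < n by lia.
  have [e|ne] := eqVneq (Ordinal n0 : cycle_graph n) v; last by exists (Ordinal n0).
  by exists (Ordinal n1); rewrite -e.
by apply: (colourable_withoutI xv) => S vS; apply: linF; exact: cycle_minus_linear vS.
Qed.

Lemma forest_obstructions : minimal_obstructions_are forest
  (fun H => one_of [:: graph_A; graph_B] H \/
     exists2 n, n = 3 \/ 5 <= n & H = cycle_graph n).
Proof.
apply: minimal_obstructions_areI => [H|G tf nG].
  case=> [|[n n35 ->]]; last first.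
    apply: (cycle_minimal forest_hereditary n35); last exact: linear_forest.
    by apply: cycle_not_forest; lia.
  case=> [<-|[<-|//]];
    apply: (finite_minimal_obstruction forest_hereditary forest_decide); try by vm_compute.
    by move=> /(forest_no_cycle (isT : 3 <= 4)); apply; apply: embeds_decide; vm_compute.
  by move=> /(forest_no_cycle (isT : 3 <= 4)); apply; apply: embeds_decide; vm_compute.
have [C3|nC3] := classic (embeds (cycle_graph 3) G).
  by exists (cycle_graph 3) => //; right; exists 3 => //; left.
have [n n4 Cn] : exists2 n, 4 <= n & embeds (cycle_graph n) G.
  by apply: not_chordal_cycle => ch; apply: nG; exact: chordal_triangle_free_forest.
have [n5|n5] := leqP 5 n; first by exists (cycle_graph n) => //; right; exists n => //; right.
have e4 : n = 4 by lia.
rewrite {}e4 in Cn; have [H HF HG] := twin_free_four_cycle tf Cn.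
have C3in : embeds (cycle_graph 3) H -> False by move=> /embeds_trans/(_ HG).
case: (F_C4_cases HF) HG => [e|e|e|[e|e]] HG.
- by exists H; rewrite // e; left; left.
- by exists H; rewrite // e; left; right; left.
- by case: C3in; rewrite e; apply: embeds_decide; vm_compute.
- by case: C3in; rewrite e; apply: embeds_decide; vm_compute.
case: C3in; rewrite e; apply: embeds_trans (isomorphic_embeds co_2P3_iso).1.
by apply: embeds_decide; vm_compute.
Qed.

(** What the chordal, interval and strongly chordal cases have in common. The twin-free
    reductions of the proper induced subgraphs of non-chordal obstructions are interval
    graphs, hence in each of the families; a chordless cycle other than a four-cycle
    is an obstruction itself. *)
Lemma non_chordal_obstructions (F S : graph_family) :
  hereditary F -> (forall G, nat_interval G -> F G) -> (forall G, F G -> chordal G) ->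
  (forall H, S H -> minimal_obstruction F H) ->
  (forall G, twin_free G -> chordal G -> ~ F G -> exists2 H, S H & embeds H G) ->
  minimal_obstructions_are F
    (fun H => F_C4 H \/ (exists2 n, 5 <= n & H = cycle_graph n) \/ S H).
Proof.
move=> hF intF chF minS complete.
have nat_dec n r : nat_intervalb n r -> F (graph_on n r).
  by move=> /nat_intervalP; exact: intF.
have cycF n G : 4 <= n -> embeds (cycle_graph n) G -> ~ F G.
  by move=> n4 emb /chF/chordal_links_closed lc; exact: (links_closed_no_cycle n4 lc emb).
apply: minimal_obstructions_areI => [H|G tf nG].
  case=> [HF|[[n n5 ->]|]]; last exact: minS.
    case: (F_C4_cases HF) => [->|->|->|[->|->]];
      [ | | | | apply: minimal_obstruction_iso co_2P3_iso _];
    apply: (finite_minimal_obstruction hF nat_dec);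
      by [apply: (cycF 4) => //; apply: embeds_decide; vm_compute | vm_compute].
  apply: (cycle_minimal hF); [by right | | by move=> G /linear_nat_interval/intF].
  by apply: (cycF n); [lia | exact: embeds_refl].
have [ch|nch] := classic (chordal G).
  by have [H SH HG] := complete G tf ch nG; exists H => //; right; right.
have [n n4 Cn] := not_chordal_cycle nch.
have [n5|n5] := leqP 5 n.
  by exists (cycle_graph n) => //; right; left; exists n.
have e4 : n = 4 by lia.
rewrite {}e4 in Cn; have [H HF HG] := twin_free_four_cycle tf Cn.
by exists H => //; left.
Qed.

(** * Interval graphs and chordal graphs *)

Lemma avoids_seq n (r : rel nat) (z x : nat) s : z <= n ->
  all (fun i => [&& i <= n, i != z & ~~ erel r z i]) (x :: s) -> path (erel r) x s ->
  avoids (inord z : graph_on n.+1 r) (inord x) (inord (last x s)).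
Proof.
move=> zn; have out i : [&& i <= n, i != z & ~~ erel r z i] ->
    (inord i : graph_on n.+1 r) \in outN (inord z : graph_on n.+1 r).
  case/and3P => im iz nzi; rewrite inE /cadj adj_erel -val_eqE /= !inordK //.
  by rewrite eq_sym negb_or iz.
elim: s x => [|y s IH] x /=.
  by rewrite andbT => /out xO _; split=> //; exact: connect0.
move=> /andP [xP /andP [yP sP]] /andP [xy pth].
have [yO lO cl] : avoids (inord z : graph_on n.+1 r) (inord y) (inord (last y s)).
  by apply: IH => //=; rewrite yP.
split=> //; first exact: out.
apply: conn_trans cl; apply: conn_adj => //; first exact: out.
case/and3P: xP => xn _ _; case/and3P: yP => yn _ _.
by rewrite adj_erel !inordK.
Qed.

Lemma nat_interval_minus n (r : rel nat) (v : graph_on n r) (S : {set graph_on n r})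
    (l h : nat -> nat) : v \notin S -> (forall i, l i <= h i) ->
  (forall i j, i < j -> j < n -> i <> v -> j <> v ->
     r i j || r j i = (l i <= h j) && (l j <= h i)) ->
  nat_interval (induced S).
Proof.
move=> vS lh A.
have neq (u : induced S) : nat_of_ord (val u) <> v.
  by move=> /val_inj e; move: vS; rewrite -e (valP u).
exists (fun u => l (nat_of_ord (val u))), (fun u => h (nat_of_ord (val u))).
split=> [u|u w uw]; first exact: lh.
rewrite adj_induced adj_graph_on.
case: (ltngtP (nat_of_ord (val u)) (nat_of_ord (val w))) => [lt|lt|/val_inj/val_inj e] /=.
- exact: (A _ _ lt (ltn_ord (val w)) (neq u) (neq w)).
- by rewrite orbC andbC (A _ _ lt (ltn_ord (val u)) (neq w) (neq u)).
by rewrite e eqxx in uw.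
Qed.

Section IntervalObstructions.
Variable R : realType.

(** The maps [l] and [h] give the end points of an interval model of the graph
    without [v]. *)
Lemma LB_minimal n (r : rel nat) (a b c : graph_on n r) : asteroidal a b c ->
  (forall v : graph_on n r, exists l h : nat -> nat, (forall i, l i <= h i) /\
     forall i j, i < j -> j < n -> i <> v -> j <> v ->
     r i j || r j i = (l i <= h j) && (l j <= h i)) ->
  minimal_obstruction (interval_graph R) (graph_on n r).
Proof.
move=> ast rep; apply: minimal_obstructionI => [|v]; first exact: asteroidal_not_colourable ast.
have ne : a != b.
  by have [_ [aO _ _] _] := ast; move: aO; rewrite inE negb_or eq_sym => /andP [].
have [x xv] : exists x, x != v.
  by have [e|] := eqVneq a v; [exists b; rewrite -e eq_sym | exists a].
apply: (colourable_withoutI xv) => S vS; apply: nat_interval_interval_graph.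
have [l [h [lh A]]] := rep v.
exact: (nat_interval_minus vS lh A).
Qed.

Lemma path_iota (e : rel nat) m k :
  (forall i, m <= i < m + k -> e i i.+1) -> path e m (iota m.+1 k).
Proof.
elim: k m => //= k IH m em; rewrite em ?IH //; last by lia.
by move=> i im; apply: em; lia.
Qed.

Lemma last_iota m k : last m (iota m.+1 k) = m + k.
Proof. by elim: k m => [|k IH] m /=; rewrite ?addn0 // IH addSnnS. Qed.

Lemma one_hub_minimal k : 2 <= k -> minimal_obstruction (interval_graph R) (LB_one_hub k).
Proof.
move=> k2; rewrite /LB_one_hub; set r := (fun i j : nat => _).
apply: (@LB_minimal _ r (inord 0 : 'I_k.+4) (inord k.+1 : 'I_k.+4) (inord k.+3 : 'I_k.+4)).
  split.
  - have := @avoids_seq k.+3 r k.+3 0 (iota 1 k.+1); rewrite last_iota; apply => //.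
      apply/allP => i; rewrite -[0 :: _]/(iota 0 k.+2) mem_iota /erel /r; lia.
    by apply: path_iota => i ik; rewrite /erel /r; lia.
  - apply: (@avoids_seq k.+3 r k.+1 0 [:: 1; k.+2; k.+3]); rewrite //= /erel /r; lia.
  apply: (@avoids_seq k.+3 r 0 k.+1 [:: k; k.+2; k.+3]); rewrite //= /erel /r; lia.
move=> v; have vk := ltn_ord v.
(* the path consists of the intervals [s i, s i + 1] *)
have rep s cl ch d : cl <= ch ->
    (forall i j, i < j -> j <= k.+1 -> i <> v -> j <> v ->
      (i.+1 == j) = (s i <= (s j).+1) && (s j <= (s i).+1)) ->
    (forall i, i <= k.+1 -> i <> v -> v <> k.+2 :> nat ->
      (1 <= i <= k) = (s i <= ch) && (cl <= (s i).+1)) ->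
    (forall i, i <= k.+1 -> i <> v -> v <> k.+3 :> nat -> ~~ (s i <= d <= (s i).+1)) ->
    (v <= k.+1 -> cl <= d <= ch) ->
    exists l h : nat -> nat, (forall i, l i <= h i) /\
     forall i j, i < j -> j < k.+4 -> i <> v -> j <> v ->
     r i j || r j i = (l i <= h j) && (l j <= h i).
  move=> clch sP cP dP cd.
  exists (fun i => if i <= k.+1 then s i else if i == k.+2 then cl else d).
  exists (fun i => if i <= k.+1 then (s i).+1 else if i == k.+2 then ch else d).
  split=> [i|i j ij jk iv jv]; first by case: ifP => // _; case: ifP.
  case: (leqP j k.+1) => jk1.
    have ik1 : i <= k.+1 by lia.
    by rewrite ik1 -sP // /r; lia.
  case: (j =P k.+2) => jk2.
    have ik1 : i <= k.+1 by lia.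
    have vk2 : v <> k.+2 :> nat by lia.
    by rewrite ik1 -cP // /r; lia.
  have vk3 : v <> k.+3 :> nat by lia.
  case: (leqP i k.+1) => ik1; first by rewrite (negbTE (dP i ik1 iv vk3)) /r; lia.
  have -> : i = k.+2 by lia.
  by rewrite eqxx cd /r; lia.
move: (nat_of_ord v) vk rep => {v} v vk rep.
have [v1|v1] := leqP v k.+1; last first.
  have [v2|v2] := eqVneq v k.+2.
    by apply: (rep id 2 k (k + 9)); lia.
  by apply: (rep id 2 k (k + 9)); lia.
have [v0|v0] := eqVneq v 0; first by apply: (rep id 0 k 0); lia.
have [v3|v3] := eqVneq v k.+1; first by apply: (rep id 2 (k + 5) (k + 5)); lia.
(* without [x_v] there is a gap for [d] *)
by apply: (rep (fun i => i + (v < i)) 2 k.+1 v.+1); lia.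
Qed.

Lemma two_hubs_minimal k : 1 <= k -> minimal_obstruction (interval_graph R) (LB_two_hubs k).
Proof.
move=> k1; change (minimal_obstruction (interval_graph R) (graph_on k.+4.+1 (two_hubs_rel k))).
set r := two_hubs_rel k.
apply: (@LB_minimal _ r (inord 0 : 'I_k.+4.+1) (inord k.+1 : 'I_k.+4.+1)
                        (inord k.+4 : 'I_k.+4.+1)).
  split.
  - have := @avoids_seq k.+4 r k.+4 0 (iota 1 k.+1); rewrite last_iota; apply => //.
      apply/allP => i; rewrite -[0 :: _]/(iota 0 k.+2) mem_iota /erel /r /two_hubs_rel; lia.
    by apply: path_iota => i ik; rewrite /erel /r /two_hubs_rel; lia.
  - apply: (@avoids_seq k.+4 r k.+1 0 [:: k.+2; k.+4]); rewrite //= /erel /r /two_hubs_rel;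
    decide_nat.
  apply: (@avoids_seq k.+4 r 0 k.+1 [:: k.+3; k.+4]); rewrite //= /erel /r /two_hubs_rel;
    decide_nat.
have rE i j : i < j -> _ := @two_hubs_relE k i j.
rewrite -/r in rE; clearbody r; move=> v; have vk := ltn_ord v.
(* the path consists of the intervals [s i, s i + 2] *)
have rep s ll lh rl rh t : ll <= lh -> rl <= rh ->
    (forall i j, i < j -> j <= k.+1 -> i <> v -> j <> v ->
      (i.+1 == j) = (s i <= (s j).+2) && (s j <= (s i).+2)) ->
    (forall i, i <= k.+1 -> i <> v -> v <> k.+2 :> nat ->
      (i <= k) = (s i <= lh) && (ll <= (s i).+2)) ->
    (forall i, i <= k.+1 -> i <> v -> v <> k.+3 :> nat ->
      (1 <= i) = (s i <= rh) && (rl <= (s i).+2)) ->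
    (forall i, i <= k.+1 -> i <> v -> v <> k.+4 :> nat -> ~~ (s i <= t <= (s i).+2)) ->
    (v <> k.+2 :> nat -> v <> k.+3 :> nat -> (ll <= rh) && (rl <= lh)) ->
    (v <> k.+2 :> nat -> v <> k.+4 :> nat -> ll <= t <= lh) ->
    (v <> k.+3 :> nat -> v <> k.+4 :> nat -> rl <= t <= rh) ->
    exists l h : nat -> nat, (forall i, l i <= h i) /\
     forall i j, i < j -> j < k.+4.+1 -> i <> v -> j <> v ->
     r i j || r j i = (l i <= h j) && (l j <= h i).
  move=> lll rlr sP lP rP tP lr lt rt.
  exists (fun i => if i <= k.+1 then s i else if i == k.+2 then ll else
                   if i == k.+3 then rl else t).
  exists (fun i => if i <= k.+1 then (s i).+2 else if i == k.+2 then lh else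
                   if i == k.+3 then rh else t).
  split=> [i|i j ij jk iv jv].
    by case: (i <= k.+1); case: (i == k.+2); case: (i == k.+3); rewrite ?leqW ?leqnSn.
  case: (leqP j k.+1) => jk1.
    have ik1 : i <= k.+1 by lia.
    by rewrite rE // ik1 -sP //; decide_nat.
  case: (j =P k.+2) => jk2.
    have ik1 : i <= k.+1 by lia.
    have vk2 : v <> k.+2 :> nat by lia.
    by rewrite rE // ik1 -lP //; decide_nat; lia.
  case: (j =P k.+3) => jk3.
    have vk3 : v <> k.+3 :> nat by lia.
    case: (leqP i k.+1) => ik1; first by rewrite rE // -rP //; decide_nat; lia.
    have ik2 : i = k.+2 by lia.
    by rewrite rE // ik2 eqxx lr //; decide_nat; lia.
  have vk4 : v <> k.+4 :> nat by lia.
  case: (leqP i k.+1) => ik1; first by rewrite rE // (negbTE (tP i ik1 iv vk4)); decide_nat.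
  case: (i =P k.+2) => ik2; first by rewrite rE // lt; [decide_nat|lia|lia].
  have ik3 : i = k.+3 by lia.
  by rewrite rE // ik3 eqxx rt; [decide_nat|lia|lia].
move: (nat_of_ord v) vk rep => {v} v vk rep.
have [v1|v1] := leqP v k.+1; last first.
  have [v2|v2] := eqVneq v k.+2.
    by apply: (rep (fun i => 2 * i) 0 (2 * k + 9) 3 (2 * k + 9) (2 * k + 9)); lia.
  have [v3|v3] := eqVneq v k.+3.
    by apply: (rep (fun i => 2 * i + 2) 0 (2 * k + 3) 0 (2 * k + 9) 0); lia.
  by apply: (rep (fun i => 2 * i) 1 (2 * k + 1) 3 (2 * k + 3) 0); lia.
have [v0|v0] := eqVneq v 0.
  by apply: (rep (fun i => 2 * i) 0 (2 * k + 1) 0 (2 * k + 3) 0); lia.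
have [v3|v3] := eqVneq v k.+1.
  by apply: (rep (fun i => 2 * i) 1 (2 * k + 9) 3 (2 * k + 9) (2 * k + 9)); lia.
(* without [x_v] there is a gap for [t] *)
by apply: (rep (fun i => 2 * (i + (v < i))) 1 (2 * k + 3) 3 (2 * k + 5) (2 * v + 1)); lia.
Qed.

Lemma LB_obstructions_minimal H :
  LB_obstructions H -> minimal_obstruction (interval_graph R) H.
Proof.
have dec n r : nat_intervalb n r -> interval_graph R (graph_on n r).
  by move=> /nat_intervalP; exact: nat_interval_interval_graph.
case=> [[<-|[<-|//]]|[[k k2 ->]|[k k1 ->]]].
- apply: (finite_minimal_obstruction (@interval_graph_hereditary R) dec).
    move/family_colourable; rewrite /subdivided_claw /graph_of_edges; set r := (fun i j :
      nat => _).
    apply: (@asteroidal_not_colourable R (graph_on 7 r) (inord 4 : 'I_7) (inord 5 :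
      'I_7) (inord 6 : 'I_7)).
    split.
    + exact: (@avoids_seq 6 r 6 4 [:: 1; 0; 2; 5]).
    + exact: (@avoids_seq 6 r 5 4 [:: 1; 0; 3; 6]).
    exact: (@avoids_seq 6 r 4 5 [:: 2; 0; 3; 6]).
  by vm_compute.
- apply: (finite_minimal_obstruction (@interval_graph_hereditary R) dec).
    move/family_colourable; rewrite /umbrella /graph_of_edges; set r := (fun i j : nat => _).
    apply: (@asteroidal_not_colourable R (graph_on 7 r) (inord 0 : 'I_7) (inord 4 :
      'I_7) (inord 6 : 'I_7)).
    split.
    + exact: (@avoids_seq 6 r 6 0 [:: 5; 4]).
    + exact: (@avoids_seq 6 r 4 0 [:: 1; 2; 6]).
    exact: (@avoids_seq 6 r 0 4 [:: 3; 2; 6]).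
  by vm_compute.
- exact: one_hub_minimal.
exact: two_hubs_minimal.
Qed.

Lemma interval_obstructions : minimal_obstructions_are (interval_graph R)
    (fun H => F_C4 H \/ (exists2 n, 5 <= n & H = cycle_graph n) \/ LB_obstructions H).
Proof.
apply: non_chordal_obstructions.
- exact: interval_graph_hereditary.
- exact: nat_interval_interval_graph.
- exact: interval_graph_chordal.
- exact: LB_obstructions_minimal.
move=> G _ ch nG; have [intG|//] := chordal_nat_interval_or_LB ch.
by case: nG; exact: nat_interval_interval_graph.
Qed.
End IntervalObstructions.

Lemma chordal_obstructions : minimal_obstructions_are chordal
    (fun H => F_C4 H \/ exists2 n, 5 <= n & H = cycle_graph n).
Proof.
have obs : minimal_obstructions_are chordal
    (fun H => F_C4 H \/ (exists2 n, 5 <= n & H = cycle_graph n) \/ False).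
  apply: (@non_chordal_obstructions chordal (fun _ => False)) => //.
  - exact: is_free_hereditary.
  - exact: nat_interval_chordal.
move=> G; split=> [/obs [H SH iso]|[H SH iso]].
  by exists H => //; case: SH => [|[|//]]; [left | right].
by apply/obs; exists H => //; case: SH => [|]; [left | right; left].
Qed.

(** * Trampolines *)

Section Trampolines.
Implicit Types n m i j e : nat.

Definition succ_mod n i := if i.+1 == n then 0 else i.+1.

Lemma succ_mod_modn n i : i < n -> i.+1 %% n = succ_mod n i.
Proof.
by move=> i_n; rewrite /succ_mod; case: eqP => [->|ne]; rewrite ?modnn ?modn_small //; lia.
Qed.

Lemma succ_mod_lt n i : i < n -> succ_mod n i < n.
Proof. by rewrite /succ_mod; case: eqP; lia. Qed.

Lemma succ_mod_inj n i j : i < n -> j < n -> succ_mod n i = succ_mod n j -> i = j.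
Proof. by rewrite /succ_mod; case: (i.+1 =P n); case: (j.+1 =P n); lia. Qed.

Lemma succ_mod2_neq n i : 2 < n -> i < n -> succ_mod n (succ_mod n i) <> i.
Proof. by rewrite /succ_mod; case: (i.+1 =P n); case: eqP; lia. Qed.

Lemma succ_mod_neq n i : 1 < n -> i < n -> succ_mod n i <> i.
Proof. by rewrite /succ_mod; case: (i.+1 =P n); lia. Qed.

Lemma succ_mod_onto n i : i < n -> exists2 j, j < n & succ_mod n j = i.
Proof.
move=> i_n; exists (if i == 0 then n.-1 else i.-1); first by case: eqP; lia.
by rewrite /succ_mod; case: (i =P 0); case: eqP; lia.
Qed.

Section OneTrampoline.
Variable n : nat.
Implicit Types u v a z : trampoline n.

Lemma adj_inner u v : u < n -> v < n -> adj u v = (u != v).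
Proof. by move=> un vn; rewrite adj_graph_on un vn /= andbT -val_eqE. Qed.

Lemma adj_inner_outer u v : u < n -> n <= v ->
  adj u v = (u == v - n :> nat) || (u == succ_mod n (v - n) :> nat).
Proof.
move=> un nv; have vn : v - n < n by have := ltn_ord v; lia.
have vF : v < n = false by rewrite ltnNge nv.
have uF : n <= u = false by rewrite leqNgt un.
rewrite adj_graph_on un nv vF uF /= succ_mod_modn //.
by have -> : u != v :> nat by lia.
Qed.

Lemma adj_outer u v : n <= u -> n <= v -> adj u v = false.
Proof. by move=> nu nv; rewrite adj_graph_on !(ltnNge _ n) nu nv !andbF. Qed.

(** Outer vertices are simplicial, so that neither chordless cycles nor the inner
    vertices of an embedded trampoline can use them. *)
Lemma outer_neighbours a u v : n <= a -> adj a u -> adj a v -> cadj u v.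
Proof.
move=> na au av.
have un : u < n by rewrite ltnNge; apply/negP => nu; rewrite adj_outer in au.
have vn : v < n by rewrite ltnNge; apply/negP => nv; rewrite adj_outer in av.
by rewrite /cadj adj_inner //; case: eqP.
Qed.

Lemma conn_step (G : sgraph) (T : {set G}) (x y : G) :
  conn T x y -> x != y -> exists2 z, z \in T & adj x z.
Proof.
case/connectP => -[|z s] /=; first by move=> _ ->; rewrite eqxx.
by case/andP => /and3P [xz _ zT] _ _ _; exists z.
Qed.

(** A link between neighbours of [a] that starts in an outer vertex continues in an
    inner one, which is adjacent to [a]. *)
Lemma trampoline_links_closed : links_closed (trampoline n).
Proof.
move=> a u v T au av uT cuv out; rewrite -/(cadj u v).
have [na|an] := leqP n a; first exact: outer_neighbours au av.
have [<-|uv] := eqVneq u v; first exact: cadjxx.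
have outer_end (x y : trampoline n) : n <= x -> adj a x -> conn T x y -> x != y ->
    (forall z, z \in T -> z != x -> z != y -> z != a /\ ~~ adj a z) -> adj x y.
  move=> nx ax cxy xy out'; have [z zT xz] := conn_step cxy xy.
  have [<- //|zy] := eqVneq z y.
  have zx : z != x by rewrite eq_sym adj_neq.
  have [za naz] := out' z zT zx zy.
  have := outer_neighbours nx xz (etrans (adj_sym _ _) ax).
  by rewrite /cadj (negbTE za) adj_sym (negbTE naz).
have [nu|un] := leqP n u; first by rewrite adj_cadj // outer_end.
have [nv|vn] := leqP n v.
  rewrite cadj_sym adj_cadj // outer_end //; [by rewrite conn_sym | by rewrite eq_sym |].
  by move=> z zT zv zu; exact: out.
by rewrite /cadj adj_inner //; case: eqP.
Qed.

Hypothesis n3 : 2 < n.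

Lemma trampoline_twin_free : twin_free (trampoline n).
Proof.
move=> u v uv; apply/eqP; apply: contraT => ne; exfalso.
have nvu : u != v :> nat by [].
have inner_outer (x y : trampoline n) : x < n -> n <= y -> (forall w, adj x w = adj y w) -> False.
  move=> xn ny xy; have zn : n + x < n + n by lia.
  have nz : n <= (Ordinal zn : trampoline n) := leq_addr _ _.
  have := xy (Ordinal zn); rewrite (adj_inner_outer xn nz) (adj_outer ny nz) /= addKn.
  by rewrite eqxx.
have [un|nu] := ltnP u n; have [vn|nv] := ltnP v n.
- by have := uv v; rewrite adj_irr adj_inner // ne.
- exact: (inner_outer u v).
- by apply: (inner_outer v u) => // w; rewrite uv.
have e1 := ltn_ord u; have e2 := ltn_ord v.
have un : u - n < n by lia.
have vn : v - n < n by lia.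
have wn : u - n < n + n by lia.
have w2n : succ_mod n (u - n) < n + n by have := succ_mod_lt un; lia.
have nx := succ_mod_lt un.
have := uv (Ordinal wn); have := uv (Ordinal w2n).
rewrite !(adj_sym _ (Ordinal _ : trampoline n)).
rewrite (adj_inner_outer (u := Ordinal wn) un nu) (adj_inner_outer (u := Ordinal wn) un nv).
rewrite (adj_inner_outer (u := Ordinal w2n) nx nu) (adj_inner_outer (u := Ordinal w2n) nx nv).
rewrite /= !eqxx orbT /=.
move=> /esym/orP h2 /esym/orP h1.
case: h1 => /eqP h1; first by lia.
case: h2 => /eqP h2; last by move: (succ_mod_inj un vn h2); lia.
by apply: (succ_mod2_neq n3 vn); rewrite -h1.
Qed.

End OneTrampoline.

Ltac tramp rO rE rE' rI := by rewrite /=;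
  repeat match goal with |- is_true (andb _ _) => apply/andP; split end; first
  [ lia | rewrite rO; lia | rewrite rE; lia | rewrite rE'; lia | rewrite rI; lia ].

Lemma avoids_ord N (r : rel nat) (z x y : graph_on N r) s : last (nat_of_ord x) s = y ->
  all (fun i => [&& i < N, i != z & ~~ erel r z i]) (nat_of_ord x :: s) ->
  path (erel r) x s -> avoids z x y.
Proof.
case: N z x y => [|N] z x y; first by case: x.
move=> e out pth; have zN : z <= N by rewrite -ltnS.
have := avoids_seq zN out pth.
by rewrite e (inord_val z) (inord_val x) (inord_val y).
Qed.

Lemma trampoline_asteroidal n : 2 < n -> exists a b c : trampoline n, asteroidal a b c.
Proof.
move=> n3; rewrite /trampoline; set r := (fun i j : nat => _).
have lt0 : n < n + n by lia.
have lt1 : n.+1 < n + n by lia.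
have lt2 : n.+2 < n + n by lia.
have rE i j : i < n -> n <= j -> j < n + n -> erel r i j = (i == j - n) ||
  (i == succ_mod n (j - n)).
  move=> i_n nj jn; have in' : i < n + n by lia.
  have := @adj_inner_outer n (Ordinal in') (Ordinal jn) i_n nj.
  by rewrite adj_erel.
have rI i j : i < n -> j < n -> erel r i j = (i != j).
  move=> i_n j_n; have jn : j < n + n by lia.
  have in' : i < n + n by lia.
  have := @adj_inner n (Ordinal in') (Ordinal jn) i_n j_n.
  by rewrite adj_erel -val_eqE.
have rO i j : n <= i -> n <= j -> i < n + n -> j < n + n -> erel r i j = false.
  move=> ni nj in' jn; have := @adj_outer n (Ordinal in') (Ordinal jn) ni nj.
  by rewrite adj_erel.
have rE' i j : i < n -> n <= j -> j < n + n -> erel r j i = (i == j - n) ||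
  (i == succ_mod n (j - n)).
  by move=> *; rewrite erel_sym rE.
have nx0 : succ_mod n (n - n) = 1 by rewrite subnn /succ_mod; case: eqP; lia.
have nx1 : succ_mod n (n.+1 - n) = 2 by rewrite subSnn /succ_mod; case: eqP; lia.
have nx2 : succ_mod n (n.+2 - n) = 0 /\ n = 3 \/ succ_mod n (n.+2 - n) = 3 /\ 3 < n.
  rewrite /succ_mod; have -> : n.+2 - n = 2 by lia.
  by case: (3 =P n); lia.
clearbody r.
(* three consecutive outer vertices *)
exists (Ordinal lt0), (Ordinal lt1), (Ordinal lt2); split.
- by apply: (avoids_ord (s := [:: 1; n.+1])); [| tramp rO rE rE' rI | tramp rO rE rE' rI].
- have [n_3|n_4] := eqVneq n 3.
    by apply: (avoids_ord (s := [:: 0; n.+2])); [| tramp rO rE rE' rI | tramp rO rE rE' rI].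
  by apply: (avoids_ord (s := [:: 0; 3; n.+2])); [| tramp rO rE rE' rI | tramp rO rE rE' rI].
by apply: (avoids_ord (s := [:: 2; n.+2])); [| tramp rO rE rE' rI | tramp rO rE rE' rI].
Qed.

(** Inner vertices go to inner vertices, since only these have two non-adjacent
    neighbours; hence outer vertices go to outer ones. So consecutive inner vertices
    go to consecutive ones, the direction never changes, and the hamiltonian cycle
    goes round the whole of the larger one. *)
Lemma trampoline_embeds m n (f : trampoline m -> trampoline n) : 2 < m -> 2 < n ->
  injective f -> (forall u v, adj (f u) (f v) = adj u v) -> n <= m.
Proof.
move=> m3 n3 fI fA.
have mm0 : 0 < m + m by lia.
pose o i : trampoline m := insubd (Ordinal mm0) i.
have oE i : i < m + m -> nat_of_ord (o i) = i by move=> im; rewrite val_insubd im.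
pose F i := nat_of_ord (f (o i)).
have o_neq i j : i < m + m -> j < m + m -> i <> j -> o i != o j.
  by move=> im jm ij; apply/eqP => /(congr1 (@nat_of_ord _)); rewrite !oE.
have Fn i : F i < n + n := ltn_ord (f (o i)).
have F_inj i j : i < m + m -> j < m + m -> F i = F j -> i = j.
  by move=> im jm /val_inj/fI/(congr1 (@nat_of_ord _)); rewrite !oE.
have inn i : i < m -> o i < m by move=> im; rewrite oE //; lia.
have outr i : i < m -> m <= o (m + i) by move=> im; rewrite oE //; lia.
have oo i : i < m -> o (m + i) - m = i :> nat by move=> im; rewrite oE; lia.
have io i j : i < m -> j < m -> adj (o j) (o (m + i)) = (j == i) || (j == succ_mod m i).
  by move=> im jm; rewrite (adj_inner_outer (inn j jm) (outr i im)) oo // oE; lia.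
have F_inner i : i < m -> F i < n.
  move=> im; rewrite ltnNge; apply/negP => nF.
  have [j jm ji] := succ_mod_onto im.
  have ij : j <> i by move=> e; move: (succ_mod_neq (ltnW m3) jm); rewrite ji e.
  have : cadj (f (o (m + i))) (f (o (m + j))).
    apply: (outer_neighbours nF); rewrite fA io ?eqxx //.
    by rewrite ji eqxx orbT.
  rewrite /cadj fA (inj_eq fI) (adj_outer (outr i im) (outr j jm)) orbF.
  by apply/negP/o_neq; lia.
have F_outer i : i < m -> n <= F (m + i).
  move=> im; rewrite leqNgt; apply/negP => nF.
  have [k km [ki kn]] : exists2 k, k < m & k <> i /\ k <> succ_mod m i.
    have i1 := succ_mod_lt im.
    exists (succ_mod m (succ_mod m i)); first exact: succ_mod_lt.
    by split; [exact: succ_mod2_neq | exact: succ_mod_neq (ltnW m3) i1].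
  have := adj_inner (F_inner k km) nF; rewrite fA io // (inj_eq fI).
  rewrite (o_neq k (m + i)); [|lia|lia|lia].
  by case: eqP => // _; case: eqP.
have near i : i < m -> F (succ_mod m i) = succ_mod n (F i) \/ F i = succ_mod n (F (succ_mod m i)).
  move=> im; have im' := succ_mod_lt im.
  have e1 : adj (f (o i)) (f (o (m + i))) by rewrite fA io ?eqxx.
  have e2 : adj (f (o (succ_mod m i))) (f (o (m + i))) by rewrite fA io ?eqxx ?orbT.
  rewrite (adj_inner_outer (F_inner i im) (F_outer i im)) in e1.
  rewrite (adj_inner_outer (F_inner _ im') (F_outer i im)) in e2.
  have ne : F i <> F (succ_mod m i).
    by move/F_inj => h; apply: (succ_mod_neq (ltnW m3) im); rewrite -h; lia.
  move: e1 e2 ne; rewrite -/(F i) -/(F (succ_mod m i)) -/(F (m + i)).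
  by case/orP => /eqP -> /orP [] /eqP -> // _; [left | right].
have nextF i : i < m -> exists2 j, j < m & F j = succ_mod n (F i).
  have nonturn i' : i' < m -> F (succ_mod m (succ_mod m i')) <> F i'.
    move=> im; have i1 := succ_mod_lt im; have i2 := succ_mod_lt i1.
    by move/F_inj => h; apply: (succ_mod2_neq m3 im); apply: h; lia.
  have m0 : 0 < m by lia.
  case: (near 0 m0) => [start|start].
    have all_fwd j : j < m -> F (succ_mod m j) = succ_mod n (F j).
      elim: j => // j IH jm; have jm' := ltnW jm.
      have nj : succ_mod m j = j.+1 by rewrite /succ_mod; case: eqP; lia.
      case: (near j.+1 jm) => // back.
      case: (nonturn j jm'); apply: (succ_mod_inj (n := n)); rewrite ?F_inner //; last first.
        by rewrite nj -back -nj IH.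
      by apply: succ_mod_lt; rewrite nj.
    by move=> im; exists (succ_mod m i); [exact: succ_mod_lt | exact: all_fwd].
  have all_bwd j : j < m -> F j = succ_mod n (F (succ_mod m j)).
    elim: j => // j IH jm; have jm' := ltnW jm.
    have nj : succ_mod m j = j.+1 by rewrite /succ_mod; case: eqP; lia.
    case: (near j.+1 jm) => // fwd.
    by case: (nonturn j jm'); rewrite nj fwd -nj -IH.
  move=> im; have [j jm ji] := succ_mod_onto im.
  by exists j; rewrite // all_bwd // ji.
pose A := [seq F i | i <- iota 0 m].
have AP x : reflect (exists2 i, i < m & x = F i) (x \in A).
  apply: (iffP mapP) => [[i]|[i im ->]]; first by rewrite mem_iota; exists i.
  by exists i; rewrite // mem_iota.
have Anext x : x \in A -> succ_mod n x \in A.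
  by case/AP => i im ->; have [j jm e] := nextF i im; apply/AP; exists j.
have up x d : x \in A -> x + d < n -> x + d \in A.
  move=> xA; elim: d => [|d IH] xd; first by rewrite addn0.
  have := Anext _ (IH (ltnW (leq_ltn_trans (eq_leq (esym (addnS x d))) xd))).
  rewrite /succ_mod; case: eqP => [e|_]; last by rewrite addnS.
  by move: xd; rewrite addnS e ltnn.
have F0 : F 0 \in A by apply/AP; exists 0; lia.
have F0n : F 0 < n by apply: F_inner; lia.
have topA : n.-1 \in A.
  have -> : n.-1 = F 0 + (n.-1 - F 0) by lia.
  by apply: up => //; lia.
have zeroA : 0 \in A.
  by have := Anext _ topA; rewrite /succ_mod prednK ?eqxx //; lia.
rewrite -(size_iota 0 n) -(size_iota 0 m) -(size_map F (iota 0 m)).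
apply: uniq_leq_size; first exact: iota_uniq.
by move=> x; rewrite mem_iota => xn; rewrite -[x]add0n; apply: up.
Qed.

Lemma strongly_chordal_hereditary : hereditary strongly_chordal.
Proof. by move=> G H HG [ch tf]; split; [apply: is_free_hereditary HG ch |
  apply: is_free_hereditary HG tf]. Qed.

Lemma nat_interval_strongly_chordal G : nat_interval G -> strongly_chordal G.
Proof.
move=> intG; split; first exact: nat_interval_chordal.
move=> H [n n3 ->] /contains_inducedP/nat_interval_hereditary/(_ intG) intT.
have [a [b [c ast]]] := trampoline_asteroidal n3.
exact: nat_interval_no_asteroidal intT _ _ _ ast.
Qed.

Lemma trampoline_minimal n : 3 <= n -> minimal_obstruction strongly_chordal (trampoline n).
Proof.
move=> n3; apply: minimal_obstructionI => [|v].
  move=> /(twin_free_colourable strongly_chordal_hereditary (trampoline_twin_free n3)) [_ tf].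
  by apply: (tf (trampoline n)); [exists n | apply/contains_inducedP; exact: embeds_refl].
have [x xv] : exists x : trampoline n, x != v.
  have [a [b [c [_ [aO _ _] _]]]] := trampoline_asteroidal n3.
  have ab : b != a by move: aO; rewrite inE negb_or => /andP [].
  by have [e|] := eqVneq a v; [exists b; rewrite -e | exists a].
apply: (colourable_withoutI xv) => S vS; split.
  apply: (is_free_hereditary (embeds_induced S)).
  exact/links_closed_chordal/trampoline_links_closed.
move=> H [m m3 ->] /contains_inducedP [f fI fA].
have gA u w : adj (val (f u)) (val (f w)) = adj u w by rewrite -adj_induced fA.
have gI : injective (fun u => val (f u)) by move=> u w /val_inj/fI.
have nm := trampoline_embeds m3 n3 gI gA.
have : #|[set val (f u) | u : trampoline m]| <= #|[set~ v]|.
  apply/subset_leq_card/subsetP => y /imsetP [u _ ->]; rewrite !inE.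
  by apply: contraNneq vS => <-; exact: valP.
by rewrite card_imset // cardsC1 !card_ord; lia.
Qed.

Lemma strongly_chordal_obstructions : minimal_obstructions_are strongly_chordal
    (fun H => F_C4 H \/ (exists2 n, 5 <= n & H = cycle_graph n) \/
       exists2 n, 3 <= n & H = trampoline n).
Proof.
apply: non_chordal_obstructions.
- exact: strongly_chordal_hereditary.
- exact: nat_interval_strongly_chordal.
- by move=> G [].
- by move=> H [n n3 ->]; exact: trampoline_minimal.
move=> G _ ch nG; apply: NNPP => no; apply: nG; split=> // H TH /contains_inducedP HG.
by apply: no; exists H.
Qed.
End Trampolines.

Theorem theorem8 :
  minimal_obstructions_are quasi_threshold (one_of [:: path_graph 4; co_2P3]) /\
  minimal_obstructions_are threshold
    (one_of [:: copies 2 (complete_graph 2); path_graph 4; co_2P3]) /\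
  minimal_obstructions_are split_graph
    (one_of [:: copies 2 (complete_graph 2); cycle_graph 5; graph_A; house;
                co_X170; co_2P3]) /\
  minimal_obstructions_are forest
    (fun H => one_of [:: graph_A; graph_B] H \/
       exists2 n, n = 3 \/ 5 <= n & H = cycle_graph n) /\
  minimal_obstructions_are chordal
    (fun H => F_C4 H \/ exists2 n, 5 <= n & H = cycle_graph n) /\
  (forall R : realType, minimal_obstructions_are (interval_graph R)
    (fun H => F_C4 H \/ (exists2 n, 5 <= n & H = cycle_graph n) \/
       LB_obstructions H)) /\
  minimal_obstructions_are strongly_chordal
    (fun H => F_C4 H \/ (exists2 n, 5 <= n & H = cycle_graph n) \/
       exists2 n, 3 <= n & H = trampoline n).
Proof.
split; first exact: quasi_threshold_obstructions.
split; first exact: threshold_obstructions.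
split; first exact: split_obstructions.
split; first exact: forest_obstructions.
split; first exact: chordal_obstructions.
by split; [exact: interval_obstructions | exact: strongly_chordal_obstructions].
Qed.
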